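(* Let $\mathcal A_\Theta$ be a noncommutative $n$-torus with its spectral triple $(\mathcal A_\Theta,\mathcal H_\Theta,D_\Theta)$, made even with grading operator $\gamma$, and let $\mathcal A^\infty_\hbar$ be the quantum Heisenberg manifold algebra with parameters $c$ (a positive integer) and $\hbar,\mu,\nu\in\mathbb R$, $\mu^2+\nu^2\ne0$, such that $\{1,\hbar\mu,\hbar\nu\}$ is linearly independent over $\mathbb Q$, with its spectral triple $(\mathcal A^\infty_\hbar,\mathcal H_\hbar,D_\hbar)$. Let $\mathcal A=\mathcal A_\Theta\otimes\mathcal A^\infty_\hbar$ and $D=D_\Theta\otimes1+\gamma\otimes D_\hbar$. Then $$\Omega_D^2(\mathcal A)\cong\Omega_{D_\Theta}^2(\mathcal A_\Theta)\otimes\mathcal A^\infty_\hbar\,\bigoplus\,\mathcal A_\Theta\otimes\Omega_{D_\hbar}^2(\mathcal A^\infty_\hbar)\,\bigoplus\,\Omega_{D_\Theta}^1(\mathcal A_\Theta)\otimes\Omega_{D_\hbar}^1(\mathcal A^\infty_\hbar)$$ as $\mathcal A$-bimodules.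
   Context: Noncommutative torus: for a real skew-symmetric $\Theta\in M_n(\mathbb R)$, consider the universal $C^*$-algebra generated by unitaries $U_1,\dots,U_n$ with $U_kU_m=e^{2\pi i\Theta_{mk}}U_mU_k$; $\mathcal A_\Theta$ denotes its smooth subalgebra $\{\sum a_{\mathbf r}U^{\mathbf r}:(a_{\mathbf r})\text{ rapidly decreasing on }\mathbb Z^n\}$. $\tau(\sum a_{\mathbf r}U^{\mathbf r})=a_{\mathbf 0}$; $\delta_j(\sum a_{\mathbf r}U^{\mathbf r})=\sum2\pi i\,r_ja_{\mathbf r}U^{\mathbf r}$. With $N=2^{\lfloor n/2\rfloor}$ and Clifford matrices $\gamma_1,\dots,\gamma_n\in M_N(\mathbb C)$, $\gamma_r\gamma_s+\gamma_s\gamma_r=2\delta_{rs}$, from the irreducible representation of $\mathbb C\ell(n)$ on $\mathbb C^N$, set $\mathcal H_\Theta=L^2(\mathcal A_\Theta,\tau)\otimes\mathbb C^N$ (GNS space), $D_\Theta=-i\sum_j\delta_j\otimes\gamma_j$. For $n$ even this is an even spectral triple with grading coming from the Clifford representation. If it is not even it is replaced by $(\mathcal A_\Theta,\mathcal H_\Theta\otimes\mathbb C^2,D_\Theta\otimes\sigma,\gamma=1\otimes\sigma')$ with $\sigma,\sigma'$ two distinct $2\times2$ Pauli matrices (still written $\mathcal H_\Theta,D_\Theta$). Quantum Heisenberg manifold: write $e(x)=e^{2\pi ix}$. $S^c$ is the space of smooth functions $\Phi:\mathbb R\times\mathbb T\times\mathbb Z\to\mathbb C$ such that (1) $\Phi(x+k,y,p)=e(ckpy)\Phi(x,y,p)$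 for all $k\in\mathbb Z$; (2) for every polynomial $P$ on $\mathbb Z$ and every $\widetilde X=\frac{\partial^{m+n}}{\partial x^m\partial y^n}$, the function $P(p)(\widetilde X\Phi)(x,y,p)$ is bounded on $K\times\mathbb Z$ for every compact $K\subset\mathbb R\times\mathbb T$. $\mathcal A^\infty_\hbar$ is $S^c$ with $(\Phi\star\Psi)(x,y,p)=\sum_q\Phi(x-\hbar(q-p)\mu,y-\hbar(q-p)\nu,q)\Psi(x-\hbar q\mu,y-\hbar q\nu,p-q)$ and $\Phi^*(x,y,p)=\overline{\Phi}(x,y,-p)$. The trace is $\tau(\phi)=\int_0^1\int_{\mathbb T}\phi(x,y,0)\,dx\,dy$, with GNS space $L^2(\mathcal A^\infty_\hbar,\tau)\cong L^2([0,1]\times[0,1]\times\mathbb Z)$. Fix a real $\alpha>1$ and put $\delta_1(f)=-\frac{\partial f}{\partial x}$, $\delta_2(f)=2\pi icpx f(x,y,p)-\frac{\partial f}{\partial y}$, $\delta_3(f)=2\pi ipc\alpha f(x,y,p)$, and $\sigma_1=\begin{pmatrix}1&0\\0&-1\end{pmatrix}$, $\sigma_2=\begin{pmatrix}0&-1\\-1&0\end{pmatrix}$, $\sigma_3=\begin{pmatrix}0&i\\-i&0\end{pmatrix}$; $D_\hbar=\sum_{j=1}^3i\delta_j\otimes\sigma_j$ on $\mathcal H_\hbar=L^2(\mathcal A^\infty_\hbar,\tau)\otimes\mathbb C^2$. For a spectral triple $(\mathcal A,\mathcal H,D)$ (with $\mathcal A$ identified with its image in $\mathcal B(\mathcal H)$):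 $\Omega_D^1(\mathcal A)=\{\sum a_j[D,b_j]\}$, $\pi(\Omega^2(\mathcal A))=\{\sum a_j[D,b_j][D,c_j]\}$, $\pi(dJ_0^1(\mathcal A))=\{\sum[D,b_j][D,c_j]:\sum b_j[D,c_j]=0\}$ (subspaces of $\mathcal B(\mathcal H)$), and $\Omega_D^2(\mathcal A)=\pi(\Omega^2(\mathcal A))/\pi(dJ_0^1(\mathcal A))$; all are $\mathcal A$-bimodules. *)

(* Defs.v *)
From HB Require Import structures.
From mathcomp Require Import all_boot all_order all_algebra.
From mathcomp Require Import generic_quotient ring_quotient.
From mathcomp Require Import finmap.
From mathcomp Require Import all_classical all_reals all_analysis.
From mathcomp Require Import complex mxtens ring lra.

Set Implicit Arguments.
Unset Strict Implicit.
Unset Printing Implicit Defensive.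
Import Order.TTheory GRing.Theory Num.Theory.
Import numFieldNormedType.Exports.
Local Open Scope ring_scope.

(** * Subspaces and quotients of vector spaces *)

Section Subspace.
Variables (K : pzRingType) (V : lmodType K) (S : submodClosed V).

Record subsp := SubSp { subsp_val :> V; _ : subsp_val \in S }.

HB.instance Definition _ := [isSub for subsp_val].
HB.instance Definition _ := [Choice of subsp by <:].
HB.instance Definition _ := [SubChoice_isSubLmodule of subsp by <:].

End Subspace.

Section QuotientSpace.
Variables (K : pzRingType) (V : lmodType K) (S : submodClosed V).
Local Open Scope quotient_scope.

(* [submodClosed] does not inherit from [zmodClosed]. *)
Definition zmod_of_submod : {pred V} := fun v => v \in S.
Lemma zmod_of_submod_closed : zmod_closed zmod_of_submod.
Proof.
split=> [|u v Su Sv]; first exact: rpred0.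
by rewrite -scaleN1r; apply: (rpredD (Su : u \in S)); apply: rpredZ.
Qed.
HB.instance Definition _ :=
  GRing.isZmodClosed.Build V zmod_of_submod zmod_of_submod_closed.

Definition quotsp := Quotient.quot zmod_of_submod.
HB.instance Definition _ := GRing.Zmodule.on quotsp.

Definition qproj (v : V) : quotsp := \pi_(Quotient.quot zmod_of_submod) v.

Lemma qproj_eq u v : qproj u = qproj v <-> u - v \in S.
Proof.
rewrite -[u - v \in S]/(u - v \in zmod_of_submod) /qproj.
by rewrite Quotient.idealrBE; split=> [->|/eqP].
Qed.

Lemma qprojD u v : qproj (u + v) = qproj u + qproj v.
Proof. exact: (raddfD (\pi_(Quotient.quot zmod_of_submod))). Qed.

Lemma qproj0 : qproj 0 = 0. Proof. exact: (raddf0 (\pi_(Quotient.quot zmod_of_submod))). Qed.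
Lemma qproj_surj (x : quotsp) : exists v, x = qproj v.
Proof. by exists (repr x); rewrite /qproj reprK. Qed.

Definition qscale (k : K) (x : quotsp) : quotsp := qproj (k *: repr x).

Lemma qscaleE k v : qscale k (qproj v) = qproj (k *: v).
Proof.
apply/qproj_eq; rewrite -scalerBr rpredZ//; apply/qproj_eq.
by rewrite /qproj reprK.
Qed.

Let qscaleA a b x : qscale a (qscale b x) = qscale (a * b) x.
Proof. by have [v ->] := qproj_surj x; rewrite !qscaleE scalerA. Qed.
Let qscale1 x : qscale 1 x = x.
Proof. by have [v ->] := qproj_surj x; rewrite qscaleE scale1r. Qed.
Let qscaleDr : right_distributive qscale +%R.
Proof.
move=> k x y; have [u ->] := qproj_surj x; have [v ->] := qproj_surj y.
by rewrite -qprojD !qscaleE scalerDr qprojD.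
Qed.
Let qscaleDl x : {morph qscale^~ x : a b / a + b}.
Proof.
by move=> a b; have [v ->] := qproj_surj x; rewrite !qscaleE scalerDl qprojD.
Qed.

HB.instance Definition _ :=
  GRing.Zmodule_isLmodule.Build K quotsp qscaleA qscale1 qscaleDr qscaleDl.

Lemma qprojZ k v : qproj (k *: v) = k *: qproj v.
Proof. by rewrite -qscaleE. Qed.

End QuotientSpace.

(** * Algebraic tensor products of vector spaces *)

Definition bilin (K : pzRingType) (U V W : lmodType K) (f : U -> V -> W) :=
  (forall v, linear (f^~ v)) /\ (forall u, linear (f u)).

Section Tensor.
Variables (K : comPzRingType) (U V : lmodType K).
Local Open Scope quotient_scope.

Definition tsum (W : lmodType K) (f : U -> V -> W) (s : seq (U * V)) : W :=
  \sum_(p <- s) f p.1 p.2.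

(* Formal sums of pairs (u, v), two of them being identified when every
   bilinear map gives them the same value; [tlift] and [tlift_uniq] below are
   the universal property. *)
Definition tens_rel (s t : seq (U * V)) : bool :=
  `[< forall (W : lmodType K) (f : U -> V -> W), bilin f ->
        tsum f s = tsum f t >].

Lemma tens_rel_equiv : equiv_class_of tens_rel.
Proof.
split=> [s|s t|t s u].
- exact/asboolP.
- by apply/asboolP/asboolP => h W f bf; rewrite h.
- by move=> /asboolP h /asboolP h'; apply/asboolP => W f bf; rewrite h// h'.
Qed.
Canonical tens_equiv := EquivRelPack tens_rel_equiv.
Canonical tens_encModRel := defaultEncModRel tens_rel.

Definition tens := {eq_quot tens_rel}.
HB.instance Definition _ := Choice.on tens.

Definition tcls (s : seq (U * V)) : tens := \pi_tens s.
Definition tlift (W : lmodType K) (f : U -> V -> W) (x : tens) : W :=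
  tsum f (repr x).

Lemma tlift_cls (W : lmodType K) (f : U -> V -> W) s : bilin f -> tlift f (tcls s) = tsum f s.
Proof.
move=> bf; rewrite /tlift.
have : repr (tcls s) == s %[mod tens] by rewrite reprK.
by rewrite piE => /asboolP; apply.
Qed.

Lemma tens_ext (x y : tens) :
  (forall (W : lmodType K) (f : U -> V -> W), bilin f -> tlift f x = tlift f y)
  -> x = y.
Proof.
move=> h; rewrite -[x]reprK -[y]reprK; apply/eqP; rewrite piE.
by apply/asboolP.
Qed.

Lemma tsum_cat (W : lmodType K) (f : U -> V -> W) s t : tsum f (s ++ t) = tsum f s + tsum f t.
Proof. exact: big_cat. Qed.

Definition seqZ (k : K) (s : seq (U * V)) := [seq (k *: p.1, p.2) | p <- s].

Lemma bilinZl (W : lmodType K) (f : U -> V -> W) k u v :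
  bilin f -> f (k *: u) v = k *: f u v.
Proof.
case=> fl _; have f0 : f 0 v = 0.
  by have /= := fl v (-1) 0 0; rewrite scaler0 addr0 scaleN1r addNr.
by have /= := fl v k u 0; rewrite !addr0 f0 addr0.
Qed.
Lemma bilinZr (W : lmodType K) (f : U -> V -> W) k u v :
  bilin f -> f u (k *: v) = k *: f u v.
Proof.
case=> _ fl; have f0 : f u 0 = 0.
  by have /= := fl u (-1) 0 0; rewrite scaler0 addr0 scaleN1r addNr.
by have /= := fl u k v 0; rewrite !addr0 f0 addr0.
Qed.
Lemma bilinDl (W : lmodType K) (f : U -> V -> W) u u' v :
  bilin f -> f (u + u') v = f u v + f u' v.
Proof. by case=> fl _; have /= := fl v 1 u u'; rewrite !scale1r. Qed.
Lemma bilinDr (W : lmodType K) (f : U -> V -> W) u v v' :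
  bilin f -> f u (v + v') = f u v + f u v'.
Proof. by case=> _ fl; have /= := fl u 1 v v'; rewrite !scale1r. Qed.

Lemma bilinPl (W : lmodType K) (f : U -> V -> W) k u u' v :
  bilin f -> f (k *: u + u') v = k *: f u v + f u' v.
Proof. by case=> fl _; apply: fl. Qed.
Lemma bilinPr (W : lmodType K) (f : U -> V -> W) k u v v' :
  bilin f -> f u (k *: v + v') = k *: f u v + f u v'.
Proof. by case=> _ fl; apply: fl. Qed.

Lemma tsumZ (W : lmodType K) (f : U -> V -> W) k s :
  bilin f -> tsum f (seqZ k s) = k *: tsum f s.
Proof.
move=> bf; rewrite /tsum /seqZ big_map scaler_sumr.
by apply: eq_bigr => p _; rewrite bilinZl.
Qed.

Definition tadd (x y : tens) := tcls (repr x ++ repr y).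
Definition tzero := tcls [::].
Definition tscale k (x : tens) := tcls (seqZ k (repr x)).
Definition topp := tscale (-1).

Let tliftD (W : lmodType K) (f : U -> V -> W) x y : bilin f ->
  tlift f (tadd x y) = tlift f x + tlift f y.
Proof. by move=> bf; rewrite tlift_cls// tsum_cat. Qed.
Let tlift0 (W : lmodType K) (f : U -> V -> W) : bilin f -> tlift f tzero = 0.
Proof. by move=> bf; rewrite tlift_cls// /tsum big_nil. Qed.
Let tliftZ (W : lmodType K) (f : U -> V -> W) k x : bilin f ->
  tlift f (tscale k x) = k *: tlift f x.
Proof. by move=> bf; rewrite tlift_cls// tsumZ. Qed.

Let taddA : associative tadd.
Proof. by move=> x y z; apply: tens_ext => W f bf; rewrite !tliftD// addrA. Qed.
Let taddC : commutative tadd.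
Proof. by move=> x y; apply: tens_ext => W f bf; rewrite !tliftD// addrC. Qed.
Let tadd0 : left_id tzero tadd.
Proof.
by move=> x; apply: tens_ext => W f bf; rewrite !tliftD// tlift0// add0r.
Qed.
Let taddN : left_inverse tzero topp tadd.
Proof.
move=> x; apply: tens_ext => W f bf.
by rewrite !tliftD// tlift0// tliftZ// scaleN1r addNr.
Qed.
HB.instance Definition _ := GRing.isZmodule.Build tens taddA taddC tadd0 taddN.

Let tscaleA a b x : tscale a (tscale b x) = tscale (a * b) x.
Proof. by apply: tens_ext => W f bf; rewrite !tliftZ// scalerA. Qed.
Let tscale1 x : tscale 1 x = x.
Proof. by apply: tens_ext => W f bf; rewrite !tliftZ// scale1r. Qed.
Let tscaleDr : right_distributive tscale +%R.
Proof.
move=> k x y; apply: tens_ext => W f bf; rewrite /GRing.add/=.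
by rewrite tliftZ// !tliftD// !tliftZ// scalerDr.
Qed.
Let tscaleDl x : {morph tscale^~ x : a b / a + b}.
Proof.
move=> a b; apply: tens_ext => W f bf.
rewrite {2}/GRing.add/=.
by rewrite tliftD// !tliftZ// scalerDl.
Qed.
HB.instance Definition _ :=
  GRing.Zmodule_isLmodule.Build K tens tscaleA tscale1 tscaleDr tscaleDl.

Definition tpair (u : U) (v : V) : tens := tcls [:: (u, v)].

Lemma tlift_linear (W : lmodType K) (f : U -> V -> W) : bilin f -> linear (tlift f).
Proof. by move=> bf k x y; rewrite -tliftZ// -tliftD. Qed.

Lemma tlift_pair (W : lmodType K) (f : U -> V -> W) u v : bilin f -> tlift f (tpair u v) = f u v.
Proof. by move=> bf; rewrite tlift_cls// /tsum big_seq1. Qed.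

Lemma tpair_bilin : bilin tpair.
Proof.
split=> [v|u] k x y; apply: tens_ext => W f bf;
  rewrite tlift_linear// !tlift_pair//.
- by rewrite bilinDl// bilinZl.
- by rewrite bilinDr// bilinZr.
Qed.

Lemma tens_sum (x : tens) : x = \sum_(p <- repr x) tpair p.1 p.2.
Proof.
apply: tens_ext => W f bf; rewrite {1}/tlift /tsum.
elim: (repr x) => [|p s ih]; first by rewrite !big_nil -/tzero tlift0.
by rewrite !big_cons [in RHS]/GRing.add /= tliftD// tlift_pair// ih.
Qed.

Lemma tlift_uniq (W : lmodType K) (g h : tens -> W) : linear g -> linear h ->
  (forall u v, g (tpair u v) = h (tpair u v)) -> g =1 h.
Proof.
move=> lg lh e x; rewrite [x]tens_sum.
elim: (repr x) => [|p s ih].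
  have z (k : tens -> W) : linear k -> k 0 = 0.
    by move=> lk; have := lk (-1) 0 0; rewrite scaler0 addr0 scaleN1r addNr.
  by rewrite big_nil !z.
rewrite big_cons -[tpair _ _]scale1r lg lh ih; congr (_ *: _ + _).
exact: e.
Qed.

Lemma tens_ind (P : tens -> Prop) : (forall u v, P (tpair u v)) ->
  (forall x y, P x -> P y -> P (x + y)) -> forall x, P x.
Proof.
move=> hp hD x; rewrite [x]tens_sum; elim: (repr x) => [|p s ih].
  rewrite big_nil.
  have -> : 0 = tpair 0 0 :> tens; last exact: hp.
  have := bilinZl 0 0 0 tpair_bilin.
  by rewrite !scale0r => ->.
by rewrite big_cons; apply: hD.
Qed.

End Tensor.

Section TensorOfBilinear.
Variables (K : comPzRingType) (A1 A2 M1 M2 N1 N2 : lmodType K).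
Variables (l1 : A1 -> M1 -> N1) (l2 : A2 -> M2 -> N2).

(* The bilinear map (a1 (x) a2, m1 (x) m2) |-> l1 a1 m1 (x) l2 a2 m2. *)
Definition tact (x : tens A1 A2) (m : tens M1 M2) : tens N1 N2 :=
  tlift (fun a1 a2 m' => tlift (fun m1 m2 => tpair (l1 a1 m1) (l2 a2 m2)) m')
    x m.

Hypotheses (b1 : bilin l1) (b2 : bilin l2).

Let inner_bilin a1 a2 : bilin (fun m1 m2 => tpair (l1 a1 m1) (l2 a2 m2)).
Proof.
split=> [m2|m1] k x y.
- by rewrite (bilinPr _ _ _ _ b1) (bilinPl _ _ _ _ (tpair_bilin _ _)).
- by rewrite (bilinPr _ _ _ _ b2) (bilinPr _ _ _ _ (tpair_bilin _ _)).
Qed.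

Let comb_linear (F G : tens M1 M2 -> tens N1 N2) k : linear F -> linear G ->
  linear (fun m => k *: F m + G m).
Proof.
move=> lF lG c u v; rewrite lF lG !scalerDr !scalerA [k * c]mulrC.
by rewrite addrACA.
Qed.

Let outer_bilin : @bilin K A1 A2 (tens M1 M2 -> tens N1 N2)
  (fun a1 a2 m' => tlift (fun m1 m2 => tpair (l1 a1 m1) (l2 a2 m2)) m').
Proof.
have lin a1 a2 := tlift_linear (inner_bilin a1 a2).
split=> [a2|a1] k x y; apply/funext;
  apply: (tlift_uniq (lin _ _) (comb_linear k (lin _ _) (lin _ _))) => m1 m2;
  rewrite !tlift_pair//.
- by rewrite (bilinPl _ _ _ _ b1) (bilinPl _ _ _ _ (tpair_bilin _ _)).
- by rewrite (bilinPl _ _ _ _ b2) (bilinPr _ _ _ _ (tpair_bilin _ _)).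
Qed.

Lemma tact_pair a1 a2 m1 m2 :
  tact (tpair a1 a2) (tpair m1 m2) = tpair (l1 a1 m1) (l2 a2 m2).
Proof. by rewrite /tact !tlift_pair. Qed.

Lemma tact_bilin : bilin tact.
Proof.
split=> [m|x].
- by move=> k x y; rewrite /tact (tlift_linear outer_bilin).
- move=> k m m'; elim/tens_ind: x => [a1 a2|x y hx hy].
    by rewrite /tact !tlift_pair//; apply: tlift_linear.
  have tactD z : tact (x + y) z = tact x z + tact y z.
    have := tlift_linear outer_bilin 1 x y.
    by rewrite !scale1r /tact => ->.
  by rewrite !tactD hx hy scalerDr addrACA.
Qed.

End TensorOfBilinear.

(** * Algebras and bimodules *)

(* Unital associative algebras, the zero algebra included: [algType] requires
   [1 != 0], which is not available for bounded operators on an arbitrary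
   Hilbert space nor for tensor products. *)
Record algebra (K : comPzRingType) := Algebra {
  acar :> lmodType K;
  amul : acar -> acar -> acar;
  aone : acar;
  amul_bilin : bilin amul;
  amulA : associative amul;
  amul1a : left_id aone amul;
  amula1 : right_id aone amul
}.
Arguments amul {K a}.
Arguments aone {K a}.

(* [ract a m] is m.a. *)
Record bimodule (K : comPzRingType) (A : algebra K) := Bimodule {
  bcar :> lmodType K;
  lact : A -> bcar -> bcar;
  ract : A -> bcar -> bcar;
  lact_bilin : bilin lact;
  ract_bilin : bilin ract;
  lact1 : forall m, lact aone m = m;
  ract1 : forall m, ract aone m = m;
  lactM : forall a b m, lact (amul a b) m = lact a (lact b m);
  ractM : forall a b m, ract (amul a b) m = ract b (ract a m);
  lractC : forall a b m, lact a (ract b m) = ract b (lact a m)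
}.

Definition bimodule_iso (K : comPzRingType) (A : algebra K)
    (M N : bimodule A) : Prop :=
  exists f : M -> N, [/\ linear f, bijective f,
    forall a m, f (lact a m) = lact a (f m) &
    forall a m, f (ract a m) = ract a (f m)].

Section TensorAlgebra.
Variables (K : comPzRingType) (A B : algebra K).

Let mul := tact (@amul K A) (@amul K B).
Let mul_bilin : bilin mul.
Proof. by apply: tact_bilin; exact: amul_bilin. Qed.
Let mulE a b a' b' : mul (tpair a b) (tpair a' b') =
  tpair (amul a a') (amul b b').
Proof. by apply: tact_pair; exact: amul_bilin. Qed.

Lemma talg_mulA : associative mul.
Proof.
move=> x y z; elim/tens_ind: x => [a b|x x' hx hx']; last first.
  by rewrite !(bilinDl _ _ _ mul_bilin) hx hx'.
elim/tens_ind: y => [a' b'|y y' hy hy']; last first.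
  by rewrite (bilinDl _ _ _ mul_bilin) !(bilinDr _ _ _ mul_bilin)
    (bilinDl _ _ _ mul_bilin) hy hy'.
elim/tens_ind: z => [c d|z z' hz hz']; last first.
  by rewrite !(bilinDr _ _ _ mul_bilin) hz hz'.
by rewrite !mulE !amulA.
Qed.

Lemma talg_mul1a : left_id (tpair aone aone) mul.
Proof.
move=> x; elim/tens_ind: x => [a b|x y hx hy]; first by rewrite mulE !amul1a.
by rewrite (bilinDr _ _ _ mul_bilin) hx hy.
Qed.

Lemma talg_mula1 : right_id (tpair aone aone) mul.
Proof.
move=> x; elim/tens_ind: x => [a b|x y hx hy]; first by rewrite mulE !amula1.
by rewrite (bilinDl _ _ _ mul_bilin) hx hy.
Qed.

Definition talg : algebra K := Algebra mul_bilin talg_mulA talg_mul1a talg_mula1.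

End TensorAlgebra.

(* The outer tensor product, a bimodule over the tensor product algebra. *)
Section TensorBimodule.
Variables (K : comPzRingType) (A B : algebra K).
Variables (M : bimodule A) (N : bimodule B).

Let L := tact (@lact K A M) (@lact K B N).
Let R := tact (@ract K A M) (@ract K B N).
Let L_bilin : bilin L.
Proof. by apply: tact_bilin; exact: lact_bilin. Qed.
Let R_bilin : bilin R.
Proof. by apply: tact_bilin; exact: ract_bilin. Qed.
Let LE a b m n : L (tpair a b) (tpair m n) = tpair (lact a m) (lact b n).
Proof. by apply: tact_pair; exact: lact_bilin. Qed.
Let RE a b m n : R (tpair a b) (tpair m n) = tpair (ract a m) (ract b n).
Proof. by apply: tact_pair; exact: ract_bilin. Qed.
Let mulE a b a' b' : amul (tpair a b : talg A B) (tpair a' b') =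
  tpair (amul a a') (amul b b').
Proof. by apply: tact_pair; exact: amul_bilin. Qed.

Let L1 m : L (@aone _ (talg A B)) m = m.
Proof.
elim/tens_ind: m => [m n|x y hx hy]; first by rewrite LE !lact1.
by rewrite (bilinDr _ _ _ L_bilin) hx hy.
Qed.
Let R1 m : R (@aone _ (talg A B)) m = m.
Proof.
elim/tens_ind: m => [m n|x y hx hy]; first by rewrite RE !ract1.
by rewrite (bilinDr _ _ _ R_bilin) hx hy.
Qed.
Let mul_bilin := @amul_bilin K (talg A B).
Let LM a b m : L (@amul _ (talg A B) a b) m = L a (L b m).
Proof.
elim/tens_ind: a => [a1 a2|x x' hx hx']; last first.
  by rewrite (bilinDl _ _ _ mul_bilin) !(bilinDl _ _ _ L_bilin) hx hx'.
elim/tens_ind: b => [b1 b2|y y' hy hy']; last first.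
  by rewrite (bilinDr _ _ _ mul_bilin) !(bilinDl _ _ _ L_bilin)
    (bilinDr _ _ _ L_bilin) hy hy'.
elim/tens_ind: m => [c d|z z' hz hz']; last first.
  by rewrite !(bilinDr _ _ _ L_bilin) hz hz'.
by rewrite mulE !LE !lactM.
Qed.
Let RM a b m : R (@amul _ (talg A B) a b) m = R b (R a m).
Proof.
elim/tens_ind: a => [a1 a2|x x' hx hx']; last first.
  by rewrite (bilinDl _ _ _ mul_bilin) !(bilinDl _ _ _ R_bilin)
    (bilinDr _ _ _ R_bilin) hx hx'.
elim/tens_ind: b => [b1 b2|y y' hy hy']; last first.
  by rewrite (bilinDr _ _ _ mul_bilin) !(bilinDl _ _ _ R_bilin) hy hy'.
elim/tens_ind: m => [c d|z z' hz hz']; last first.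
  by rewrite !(bilinDr _ _ _ R_bilin) hz hz'.
by rewrite mulE !RE !ractM.
Qed.
Let LRC a b m : L a (R b m) = R b (L a m).
Proof.
elim/tens_ind: a => [a1 a2|x x' hx hx']; last first.
  by rewrite !(bilinDl _ _ _ L_bilin) (bilinDr _ _ _ R_bilin) hx hx'.
elim/tens_ind: b => [b1 b2|y y' hy hy']; last first.
  by rewrite !(bilinDl _ _ _ R_bilin) (bilinDr _ _ _ L_bilin) hy hy'.
elim/tens_ind: m => [c d|z z' hz hz']; last first.
  by rewrite !(bilinDr _ _ _ R_bilin, bilinDr _ _ _ L_bilin) hz hz'.
by rewrite RE !LE RE !lractC.
Qed.

Definition tbimod : bimodule (talg A B) :=
  @Bimodule K (talg A B) (tens M N) L R L_bilin R_bilin L1 R1 LM RM LRC.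

End TensorBimodule.

Section SumBimodule.
Variables (K : comPzRingType) (A : algebra K) (M N : bimodule A).

Let L (a : A) (x : M * N) : M * N := (lact a x.1, lact a x.2).
Let R (a : A) (x : M * N) : M * N := (ract a x.1, ract a x.2).
Let L_bilin : bilin L.
Proof.
split=> [m|a] k x y.
- by congr (_, _); apply: (bilinPl _ _ _ _ (lact_bilin _)).
- by congr (_, _); apply: (bilinPr _ _ _ _ (lact_bilin _)).
Qed.
Let R_bilin : bilin R.
Proof.
split=> [m|a] k x y.
- by congr (_, _); apply: (bilinPl _ _ _ _ (ract_bilin _)).
- by congr (_, _); apply: (bilinPr _ _ _ _ (ract_bilin _)).
Qed.
Let L1 m : L aone m = m. Proof. by case: m => x y; rewrite /L !lact1. Qed.
Let R1 m : R aone m = m. Proof. by case: m => x y; rewrite /R !ract1. Qed.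
Let LM a b m : L (amul a b) m = L a (L b m).
Proof. by case: m => x y; rewrite /L !lactM. Qed.
Let RM a b m : R (amul a b) m = R b (R a m).
Proof. by case: m => x y; rewrite /R !ractM. Qed.
Let LRC a b m : L a (R b m) = R b (L a m).
Proof. by rewrite /L /R /= !lractC. Qed.

Definition sbimod : bimodule A := Bimodule L_bilin R_bilin L1 R1 LM RM LRC.

End SumBimodule.

Definition rbimod (K : comPzRingType) (A : algebra K) : bimodule A :=
  @Bimodule K A A amul (fun a m => amul m a) (amul_bilin A)
    (conj (amul_bilin A).2 (amul_bilin A).1) (@amul1a K A) (@amula1 K A)
    (fun a b m => esym (amulA a b m)) (fun a b m => amulA m a b)
    (fun a b m => amulA a m b).

Section SubQuotientBimodule.
Variables (K : comPzRingType) (A : algebra K) (M : bimodule A).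
Variable S : submodClosed M.

Definition bistable := (forall a m, m \in S -> lact a m \in S) /\
  (forall a m, m \in S -> ract a m \in S).

Hypothesis stabS : bistable.

Let subL (a : A) (x : subsp S) : subsp S :=
  SubSp (stabS.1 a (subsp_val x) (valP x)).
Let subR (a : A) (x : subsp S) : subsp S :=
  SubSp (stabS.2 a (subsp_val x) (valP x)).
Let subL_bilin : bilin subL.
Proof.
split=> [m|a] k x y; apply: val_inj => /=.
- exact: (bilinPl _ _ _ _ (lact_bilin _)).
- exact: (bilinPr _ _ _ _ (lact_bilin _)).
Qed.
Let subR_bilin : bilin subR.
Proof.
split=> [m|a] k x y; apply: val_inj => /=.
- exact: (bilinPl _ _ _ _ (ract_bilin _)).
- exact: (bilinPr _ _ _ _ (ract_bilin _)).
Qed.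
Let subL1 x : subL aone x = x. Proof. exact/val_inj/lact1. Qed.
Let subR1 x : subR aone x = x. Proof. exact/val_inj/ract1. Qed.
Let subLM a b x : subL (amul a b) x = subL a (subL b x).
Proof. exact/val_inj/lactM. Qed.
Let subRM a b x : subR (amul a b) x = subR b (subR a x).
Proof. exact/val_inj/ractM. Qed.
Let subLRC a b x : subL a (subR b x) = subR b (subL a x).
Proof. exact/val_inj/lractC. Qed.

Definition subbimod : bimodule A :=
  Bimodule subL_bilin subR_bilin subL1 subR1 subLM subRM subLRC.

Let quoL (a : A) (x : quotsp S) : quotsp S := qproj S (lact a (repr x)).
Let quoR (a : A) (x : quotsp S) : quotsp S := qproj S (ract a (repr x)).
Let quoLE a m : quoL a (qproj S m) = qproj S (lact a m).
Proof.
apply/qproj_eq.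
rewrite -scaleN1r -(bilinZr _ _ _ (lact_bilin M)).
rewrite -(bilinDr _ _ _ (lact_bilin M)) scaleN1r.
by apply: stabS.1; apply/qproj_eq; rewrite /qproj reprK.
Qed.
Let quoRE a m : quoR a (qproj S m) = qproj S (ract a m).
Proof.
apply/qproj_eq.
rewrite -scaleN1r -(bilinZr _ _ _ (ract_bilin M)).
rewrite -(bilinDr _ _ _ (ract_bilin M)) scaleN1r.
by apply: stabS.2; apply/qproj_eq; rewrite /qproj reprK.
Qed.
Let quoL_bilin : bilin quoL.
Proof.
split=> [m|a] k x y.
- have [v ->] := qproj_surj m; rewrite !quoLE -qprojZ -qprojD.
  by congr qproj; exact: (bilinPl _ _ _ _ (lact_bilin _)).
- have [u ->] := qproj_surj x; have [v ->] := qproj_surj y.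
  rewrite -qprojZ -qprojD !quoLE -qprojZ -qprojD.
  by congr qproj; exact: (bilinPr _ _ _ _ (lact_bilin _)).
Qed.
Let quoR_bilin : bilin quoR.
Proof.
split=> [m|a] k x y.
- have [v ->] := qproj_surj m; rewrite !quoRE -qprojZ -qprojD.
  by congr qproj; exact: (bilinPl _ _ _ _ (ract_bilin _)).
- have [u ->] := qproj_surj x; have [v ->] := qproj_surj y.
  rewrite -qprojZ -qprojD !quoRE -qprojZ -qprojD.
  by congr qproj; exact: (bilinPr _ _ _ _ (ract_bilin _)).
Qed.
Let quoL1 x : quoL aone x = x.
Proof. by have [v ->] := qproj_surj x; rewrite quoLE lact1. Qed.
Let quoR1 x : quoR aone x = x.
Proof. by have [v ->] := qproj_surj x; rewrite quoRE ract1. Qed.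
Let quoLM a b x : quoL (amul a b) x = quoL a (quoL b x).
Proof. by have [v ->] := qproj_surj x; rewrite !quoLE lactM. Qed.
Let quoRM a b x : quoR (amul a b) x = quoR b (quoR a x).
Proof. by have [v ->] := qproj_surj x; rewrite !quoRE ractM. Qed.
Let quoLRC a b x : quoL a (quoR b x) = quoR b (quoL a x).
Proof. by have [v ->] := qproj_surj x; rewrite !(quoLE, quoRE) lractC. Qed.

Definition quotbimod : bimodule A :=
  Bimodule quoL_bilin quoR_bilin quoL1 quoR1 quoLM quoRM quoLRC.

End SubQuotientBimodule.

(** * Connes' forms of degree one and two *)

(* [B] stands for the bounded operators, [pi] for the representation and [d]
   for the map a |-> [D, a]. *)
Section Calculus.
Variables (K : comPzRingType) (A B : algebra K) (pi d : A -> B).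
Local Notation "x ** y" := (amul x y) (at level 40, left associativity).

Definition Omega1_pred : {pred B} := fun x =>
  `[< exists s : seq (A * A), x = \sum_(p <- s) pi p.1 ** d p.2 >].

(* The space pi(Omega^2(A)). *)
Definition piOmega2_pred : {pred B} := fun x =>
  `[< exists s : seq (A * A * A),
        x = \sum_(p <- s) pi p.1.1 ** d p.1.2 ** d p.2 >].

(* The space pi(dJ_0^1(A)). *)
Definition dJ_pred : {pred B} := fun x =>
  `[< exists2 s : seq (A * A), \sum_(p <- s) pi p.1 ** d p.2 = 0 &
        x = \sum_(p <- s) d p.1 ** d p.2 >].

Hypotheses (pi_lin : linear pi) (d_lin : linear d).

Let mulDl (x y z : B) : (x + y) ** z = x ** z + y ** z.
Proof. exact: (bilinDl _ _ _ (amul_bilin B)). Qed.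
Let mulDr (x y z : B) : x ** (y + z) = x ** y + x ** z.
Proof. exact: (bilinDr _ _ _ (amul_bilin B)). Qed.
Let mulZl k (x y : B) : (k *: x) ** y = k *: (x ** y).
Proof. exact: (bilinZl _ _ _ (amul_bilin B)). Qed.
Let mulZr k (x y : B) : x ** (k *: y) = k *: (x ** y).
Proof. exact: (bilinZr _ _ _ (amul_bilin B)). Qed.
Let mul0l (y : B) : 0 ** y = 0.
Proof. by have := mulZl 0 0 y; rewrite !scale0r. Qed.
Let mul0r (y : B) : y ** 0 = 0.
Proof. by have := mulZr 0 y 0; rewrite !scale0r. Qed.
Let linZ (V W : lmodType K) (f : V -> W) k x : linear f -> f (k *: x) = k *: f x.
Proof.
move=> lf; have f0 : f 0 = 0.
  by have := lf (-1) 0 0; rewrite scaler0 addr0 scaleN1r addNr.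
by have := lf k x 0; rewrite !addr0 f0 addr0.
Qed.
Let mul_suml (I : Type) (s : seq I) (F : I -> B) y :
  (\sum_(i <- s) F i) ** y = \sum_(i <- s) F i ** y.
Proof.
elim: s => [|i s ih]; last by rewrite !big_cons mulDl ih.
by rewrite !big_nil mul0l.
Qed.
Let mul_sumr (I : Type) (s : seq I) (F : I -> B) y :
  y ** (\sum_(i <- s) F i) = \sum_(i <- s) y ** F i.
Proof.
elim: s => [|i s ih]; last by rewrite !big_cons mulDr ih.
by rewrite !big_nil mul0r.
Qed.

Lemma Omega1_submod : submod_closed Omega1_pred.
Proof.
split; first by apply/asboolP; exists [::]; rewrite big_nil.
move=> k x y /asboolP[s ->] /asboolP[t ->]; apply/asboolP.
exists ([seq (k *: p.1, p.2) | p <- s] ++ t).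
rewrite big_cat big_map scaler_sumr /=; congr (_ + _).
by apply: eq_bigr => p _; rewrite linZ// mulZl.
Qed.
HB.instance Definition _ :=
  GRing.isSubmodClosed.Build K B Omega1_pred Omega1_submod.

Lemma piOmega2_submod : submod_closed piOmega2_pred.
Proof.
split; first by apply/asboolP; exists [::]; rewrite big_nil.
move=> k x y /asboolP[s ->] /asboolP[t ->]; apply/asboolP.
exists ([seq (k *: p.1.1, p.1.2, p.2) | p <- s] ++ t).
rewrite big_cat big_map scaler_sumr /=; congr (_ + _).
by apply: eq_bigr => p _; rewrite linZ// !mulZl.
Qed.
HB.instance Definition _ :=
  GRing.isSubmodClosed.Build K B piOmega2_pred piOmega2_submod.

Lemma dJ_submod : submod_closed dJ_pred.
Proof.
split; first by apply/asboolP; exists [::]; rewrite big_nil.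
move=> k x y /asboolP[s s0 ->] /asboolP[t t0 ->]; apply/asboolP.
exists ([seq (k *: p.1, p.2) | p <- s] ++ t).
  rewrite big_cat big_map /= t0 addr0.
  under eq_bigr do rewrite linZ// mulZl.
  by rewrite -scaler_sumr s0 scaler0.
rewrite big_cat big_map scaler_sumr /=; congr (_ + _).
by apply: eq_bigr => p _; rewrite (linZ _ _ d_lin) mulZl.
Qed.
HB.instance Definition _ :=
  GRing.isSubmodClosed.Build K B dJ_pred dJ_submod.

Hypothesis pi_mul : forall a b, pi (amul a b) = pi a ** pi b.
Hypothesis pi_one : pi aone = aone.
Hypothesis d_leibniz : forall a b, d (amul a b) = d a ** pi b + pi a ** d b.

Let opL (a : A) (x : B) := pi a ** x.
Let opR (a : A) (x : B) := x ** pi a.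
Let opL_bilin : bilin opL.
Proof.
split=> [x|a] k u v; rewrite /opL.
- by rewrite pi_lin mulDl mulZl.
- by rewrite mulDr mulZr.
Qed.
Let opR_bilin : bilin opR.
Proof.
split=> [x|a] k u v; rewrite /opR.
- by rewrite pi_lin mulDr mulZr.
- by rewrite mulDl mulZl.
Qed.
Let opL1 x : opL aone x = x. Proof. by rewrite /opL pi_one amul1a. Qed.
Let opR1 x : opR aone x = x. Proof. by rewrite /opR pi_one amula1. Qed.
Let opLM a b x : opL (amul a b) x = opL a (opL b x).
Proof. by rewrite /opL pi_mul amulA. Qed.
Let opRM a b x : opR (amul a b) x = opR b (opR a x).
Proof. by rewrite /opR pi_mul amulA. Qed.
Let opLRC a b x : opL a (opR b x) = opR b (opL a x).
Proof. by rewrite /opL /opR amulA. Qed.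

(* [B] as an [A]-bimodule. *)
Definition opbimod : bimodule A :=
  Bimodule opL_bilin opR_bilin opL1 opR1 opLM opRM opLRC.

Let sum_closed (S : submodClosed B) (I : Type) (s : seq I) (F : I -> B) :
  (forall i, F i \in S) -> \sum_(i <- s) F i \in S.
Proof. by move=> h; apply: rpred_sum => i _. Qed.

Let Omega1_gen a b : pi a ** d b \in Omega1_pred.
Proof. by apply/asboolP; exists [:: (a, b)]; rewrite big_seq1. Qed.
Let Omega2_gen a b c : pi a ** d b ** d c \in piOmega2_pred.
Proof. by apply/asboolP; exists [:: (a, b, c)]; rewrite big_seq1. Qed.
Let d_mul_pi a b : d a ** pi b = d (amul a b) - pi a ** d b.
Proof. by rewrite d_leibniz addrK. Qed.
Let subB (S : submodClosed B) u v : u \in S -> v \in S -> u - v \in S.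
Proof. by move=> Su Sv; rewrite -scaleN1r rpredD// rpredZ. Qed.
Let mulBl (x y z : B) : (x - y) ** z = x ** z - y ** z.
Proof. by rewrite mulDl -scaleN1r mulZl scaleN1r. Qed.
Let mulBr (x y z : B) : z ** (x - y) = z ** x - z ** y.
Proof. by rewrite mulDr -scaleN1r mulZr scaleN1r. Qed.

Lemma Omega1_stable : @bistable K A opbimod Omega1_pred.
Proof.
split=> a x /asboolP[s ->] /=.
- rewrite /opL mul_sumr; apply: sum_closed => p.
  by rewrite amulA -pi_mul Omega1_gen.
- rewrite /opR mul_suml; apply: sum_closed => p.
  rewrite -amulA d_mul_pi mulBr amulA -pi_mul.
  by apply: subB; exact: Omega1_gen.
Qed.

Lemma piOmega2_stable : @bistable K A opbimod piOmega2_pred.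
Proof.
split=> a x /asboolP[s ->] /=.
- rewrite /opL mul_sumr; apply: sum_closed => p.
  by rewrite !amulA -pi_mul Omega2_gen.
- rewrite /opR mul_suml; apply: sum_closed => -[[p q] r] /=.
  rewrite -!amulA d_mul_pi !mulBr; apply: subB.
    by rewrite amulA Omega2_gen.
  rewrite [d q ** _]amulA d_mul_pi mulBl mulBr; apply: subB.
    by rewrite amulA Omega2_gen.
  by rewrite !amulA -pi_mul Omega2_gen.
Qed.

Lemma dJ_stable : @bistable K A opbimod dJ_pred.
Proof.
split=> a x /asboolP[s s0 ->] /=; apply/asboolP.
- exists [seq (amul a p.1, p.2) | p <- s]; rewrite big_map /=.
    under eq_bigr do rewrite pi_mul -amulA.
    by rewrite -mul_sumr s0 mul0r.
  under [RHS]eq_bigr do rewrite d_leibniz mulDl -!amulA.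
  rewrite big_split /= -!mul_sumr s0 /opL.
  by rewrite mul0r add0r.
- exists ([seq (p.1, amul p.2 a) | p <- s] ++
          [seq (- amul p.1 p.2, a) | p <- s]).
  + rewrite big_cat !big_map /= -big_split /=.
    under eq_bigr => p _.
      rewrite -[- amul _ _]scaleN1r (linZ _ _ pi_lin) mulZl scaleN1r pi_mul.
      rewrite d_leibniz mulDr amulA -[pi _ ** pi _ ** d a]amulA addrK.
      over.
    by rewrite -mul_suml s0 mul0l.
  + rewrite big_cat !big_map /= -big_split /= /opR.
    under [RHS]eq_bigr => p _.
      rewrite -[- amul _ _]scaleN1r (linZ _ _ d_lin) mulZl scaleN1r.
      rewrite !d_leibniz mulDr mulDl amulA -[d _ ** pi _ ** d a]amulA.
      rewrite opprD addrA addrK.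
      over.
    rewrite big_split /= sumrN -!mul_suml s0.
    by rewrite mul0l subr0.
Qed.

Definition Omega1 : bimodule A := subbimod Omega1_stable.
Definition piOmega2 : bimodule A := subbimod piOmega2_stable.

Definition dJ_in_piOmega2 : {pred piOmega2} := fun x => subsp_val x \in dJ_pred.
Lemma dJ_in_piOmega2_submod : submod_closed dJ_in_piOmega2.
Proof.
split; first exact: dJ_submod.1.
by move=> k x y; exact: dJ_submod.2.
Qed.
HB.instance Definition _ :=
  GRing.isSubmodClosed.Build K piOmega2 dJ_in_piOmega2 dJ_in_piOmega2_submod.
Lemma dJ_in_piOmega2_stable : bistable dJ_in_piOmega2.
Proof.
by split=> a x xJ; [exact: dJ_stable.1|exact: dJ_stable.2].
Qed.

Definition Omega2 : bimodule A := quotbimod dJ_in_piOmega2_stable.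

End Calculus.

(** * Hilbert spaces and bounded operators *)

(* Inner products are linear in the second variable. *)
Record prehilbert (R : realType) := PreHilbert {
  hcar :> lmodType R[i];
  hdot : hcar -> hcar -> R[i];
  hdot_linear : forall x k y z, hdot x (k *: y + z) = k * hdot x y + hdot x z;
  hdot_conj : forall x y, hdot y x = (hdot x y)^*%C;
  hdot_ge0 : forall x, 0 <= hdot x x;
  hdot_eq0 : forall x, hdot x x = 0 -> x = 0
}.

Definition hnorm (R : realType) (H : prehilbert R) (x : H) : R :=
  Num.sqrt (complex.Re (hdot x x)).

Definition hcvg (R : realType) (H : prehilbert R) (u : nat -> H) (l : H) :=
  forall e : R, 0 < e ->
    exists N, forall k, (N <= k)%N -> hnorm (u k - l) < e.

Definition hcauchy (R : realType) (H : prehilbert R) (u : nat -> H) :=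
  forall e : R, 0 < e ->
    exists N, forall j k, (N <= j)%N -> (N <= k)%N -> hnorm (u j - u k) < e.

Definition hdense (R : realType) (H : prehilbert R) (P : H -> Prop) :=
  forall (x : H) (e : R), 0 < e -> exists2 y, P y & hnorm (x - y) < e.

Record hilbert (R : realType) := Hilbert {
  hpre :> prehilbert R;
  hcomplete : forall u : nat -> hpre, hcauchy u -> exists l, hcvg u l
}.

Section BoundedOperators.
Variables (R : realType) (H : hilbert R).

Definition bounded_op : {pred H -> H} := fun T =>
  `[< linear T /\ exists M : R, forall x, hnorm (T x) <= M * hnorm x >].

Let dotPr (x y z : H) : hdot x (y + z) = hdot x y + hdot x z.
Proof. by have := hdot_linear x 1 y z; rewrite scale1r mul1r. Qed.
Let dot0r (x : H) : hdot x 0 = 0.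
Proof. by apply: (addrI (hdot x 0)); rewrite -dotPr !addr0. Qed.
Let dotZr (x y : H) k : hdot x (k *: y) = k * hdot x y.
Proof. by have := hdot_linear x k y 0; rewrite !addr0 dot0r addr0. Qed.
Let dotPl (x y z : H) : hdot (x + y) z = hdot x z + hdot y z.
Proof.
rewrite (hdot_conj z (x + y)) dotPr (hdot_conj z x) (hdot_conj z y).
exact: (rmorphD (@conjc R)).
Qed.
Let dotZl (x y : H) k : hdot (k *: x) y = k^*%C * hdot x y.
Proof.
rewrite (hdot_conj y (k *: x)) dotZr (hdot_conj y x).
exact: (rmorphM (@conjc R)).
Qed.

Let sqn (x : H) := complex.Re (hdot x x).
Let sqn_ge0 x : 0 <= sqn x.
Proof. by have := hdot_ge0 x; rewrite lecE => /andP[]. Qed.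
Let hnorm_ge0 (x : H) : 0 <= hnorm x. Proof. exact: sqrtr_ge0. Qed.
Let hnorm_sqr (x : H) : hnorm x ^+ 2 = sqn x.
Proof. by rewrite sqr_sqrtr//; exact: sqn_ge0. Qed.

Lemma hnorm_eq0 (x : H) : hnorm x = 0 -> x = 0.
Proof.
move=> h; apply: hdot_eq0; have := hdot_ge0 x; have := hnorm_sqr x.
rewrite h expr0n /sqn /=; case: (hdot x x) => a b /= <-.
by rewrite lecE /= => /andP[/eqP-> _].
Qed.

Lemma hnormZ k (x : H) : hnorm (k *: x) = complex.Re `|k| * hnorm x.
Proof.
rewrite /hnorm dotZl dotZr normc_def; case: k => a b /=.
set s := Num.sqrt (a ^+ 2 + _); have s0 : 0 <= s := sqrtr_ge0 _.
have ss : s ^+ 2 = a ^+ 2 + b ^+ 2 by rewrite sqr_sqrtr// addr_ge0 ?sqr_ge0.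
rewrite -[s in RHS](ger0_norm s0) -sqrtr_sqr -sqrtrM ?sqr_ge0// ss.
by congr Num.sqrt; case: (hdot x x) => c d /=; ring.
Qed.

(* A weak form of the triangle inequality, from the parallelogram law. *)
Lemma hnormD (x y : H) : hnorm (x + y) <= 2 * (hnorm x + hnorm y).
Proof.
have par : sqn (x + y) <= 2 * sqn x + 2 * sqn y.
  have := sqn_ge0 (x + (-1) *: y).
  rewrite /sqn !(dotPl, dotPr, dotZl, dotZr) rmorphN rmorph1 /=.
  case: (hdot x x) => a b; case: (hdot x y) => c d; case: (hdot y x) => e f.
  case: (hdot y y) => g h /=; lra.
rewrite -(ler_pXn2r (_ : (0 < 2)%N)) ?nnegrE ?mulr_ge0 ?addr_ge0//.
rewrite hnorm_sqr (le_trans par)// -!hnorm_sqr.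
have := hnorm_ge0 x; have := hnorm_ge0 y; move: (hnorm x) (hnorm y) => a b.
by move=> b0 a0; nra.
Qed.

Lemma bounded_op_submod : submod_closed bounded_op.
Proof.
split.
  apply/asboolP; split; first by move=> k x y; rewrite scaler0 addr0.
  by exists 0 => x; rewrite mul0r /hnorm dot0r sqrtr0.
move=> k S T /asboolP[lS [M bM]] /asboolP[lT [N bN]]; apply/asboolP; split.
  move=> a x y; rewrite /= -[(_ + _) _]/(k *: S _ + T _) lS lT.
  rewrite -[(_ + _) x]/(k *: S x + T x) -[(_ + _) y]/(k *: S y + T y).
  by rewrite !scalerDr !scalerA [k * a]mulrC addrACA.
exists (2 * (complex.Re `|k| * M + N)) => x.
rewrite -[(_ + _) x]/(k *: S x + T x) (le_trans (hnormD _ _))//.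
rewrite -mulrA ler_pM2l// mulrDl lerD// hnormZ -mulrA.
rewrite ler_wpM2l// normc_def; exact: sqrtr_ge0.
Qed.
HB.instance Definition _ :=
  GRing.isSubmodClosed.Build R[i] (H -> H) bounded_op bounded_op_submod.

Definition bop := subsp bounded_op.
Definition bopf (T : bop) : H -> H := subsp_val T.

Lemma bop_linear (T : bop) : linear (bopf T).
Proof. by case: T => T /= /asboolP[]. Qed.
Lemma bop_bounded (T : bop) : exists M, forall x, hnorm (bopf T x) <= M * hnorm x.
Proof. by case: T => T /= /asboolP[]. Qed.

Lemma bounded_op_comp (S T : bop) : (bopf S \o bopf T) \in bounded_op.
Proof.
apply/asboolP; split; first by move=> k x y; rewrite /= !bop_linear.
have [M bM] := bop_bounded S; have [N bN] := bop_bounded T.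
exists (`|M| * N) => x /=; rewrite (le_trans (bM _))// -mulrA.
apply: (@le_trans _ _ (`|M| * hnorm (bopf T x))).
  by rewrite ler_wpM2r// ler_norm.
by rewrite ler_wpM2l.
Qed.
Definition bcomp (S T : bop) : bop := SubSp (bounded_op_comp S T).

Lemma bounded_op_id : id \in bounded_op.
Proof. by apply/asboolP; split=> //; exists 1 => x; rewrite mul1r. Qed.
Definition bid : bop := SubSp bounded_op_id.

Let bcomp_bilin : bilin bcomp.
Proof.
split=> [T|S] k x y; apply: val_inj; apply/funext => v //=.
exact: bop_linear.
Qed.

Let bcompA : associative bcomp.
Proof. by move=> x y z; apply: val_inj. Qed.
Let bcomp1l : left_id bid bcomp. Proof. by move=> x; apply: val_inj. Qed.
Let bcomp1r : right_id bid bcomp. Proof. by move=> x; apply: val_inj. Qed.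

Definition bop_alg : algebra R[i] :=
  @Algebra _ bop bcomp bid bcomp_bilin bcompA bcomp1l bcomp1r.

Lemma bop_dense_eq (P : H -> Prop) (S T : bop) : hdense P ->
  (forall v, P v -> bopf S v = bopf T v) -> S = T.
Proof.
move=> dP e; apply: val_inj; apply/funext => x; apply/eqP; rewrite -subr_eq0.
apply/eqP/hnorm_eq0/eqP; rewrite eq_le hnorm_ge0 andbT.
apply/ler_addgt0Pl => d d0; rewrite addr0.
have [M bM] := bop_bounded (S - T).
have sub v : bopf (S - T) v = bopf S v - bopf T v by [].
have dp : 0 < d / (`|M| + 1) by rewrite divr_gt0// ltr_wpDl.
have [v Pv vx] := dP x _ dp.
have -> : val S x - val T x = bopf (S - T) (x - v).
  have -> : x - v = (-1) *: v + x by rewrite scaleN1r addrC.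
  rewrite bop_linear scaleN1r.
  by rewrite !sub (e v Pv) subrr oppr0 add0r.
rewrite (le_trans (bM _))//.
apply: (@le_trans _ _ ((`|M| + 1) * hnorm (x - v))).
  by rewrite ler_wpM2r// (le_trans (ler_norm M))// lerDl.
by rewrite mulrC -ler_pdivlMr ?ltr_wpDl// ltW.
Qed.

End BoundedOperators.

Coercion bopf : bop >-> Funclass.

(** * Spectral triples *)

Record spectral_triple (R : realType) (A : algebra R[i]) := SpectralTriple {
  st_hilb : hilbert R;
  st_rep : A -> bop st_hilb;
  st_rep_linear : linear st_rep;
  st_rep_mul : forall a b, st_rep (amul a b) = bcomp (st_rep a) (st_rep b);
  st_rep_one : st_rep aone = bid st_hilb;
  st_rep_inj : injective st_rep;
  (* the image of A is closed under adjoints *)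
  st_rep_star : forall a, exists b, forall u v : st_hilb,
    hdot (st_rep a u) v = hdot u (st_rep b v);
  (* the operator D, only used on its domain, is self-adjoint *)
  st_dom : st_hilb -> Prop;
  st_dom0 : st_dom 0;
  st_dom_lin : forall k u v, st_dom u -> st_dom v -> st_dom (k *: u + v);
  st_dom_dense : hdense st_dom;
  st_D : st_hilb -> st_hilb;
  st_D_linear : forall k u v, st_dom u -> st_dom v ->
    st_D (k *: u + v) = k *: st_D u + st_D v;
  st_D_sym : forall u v, st_dom u -> st_dom v ->
    hdot (st_D u) v = hdot u (st_D v);
  st_D_selfadjoint : forall v w,
    (forall u, st_dom u -> hdot (st_D u) v = hdot u w) -> st_dom v;
  (* (D + i)^-1 is compact *)
  st_D_compact : forall u : nat -> st_hilb, (forall k, st_dom (u k)) ->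
    (exists M, forall k, hnorm (st_D (u k) + 'i%C *: u k) <= M) ->
    exists (phi : nat -> nat) l,
      {homo phi : j k / (j < k)%N >-> (j < k)%N} /\ hcvg (u \o phi) l;
  st_rep_dom : forall a v, st_dom v -> st_dom (st_rep a v);
  (* the bounded extension of [D, a] *)
  st_comm : A -> bop st_hilb;
  st_commE : forall a v, st_dom v ->
    st_comm a v = st_D (st_rep a v) - st_rep a (st_D v)
}.

Section FormsOfTriple.
Variables (R : realType) (A : algebra R[i]) (T : spectral_triple A).
Let B := bop_alg (st_hilb T).
Local Notation rep := (@st_rep R A T).
Local Notation comm := (@st_comm R A T).
Local Notation D := (@st_D R A T).

Lemma st_comm_linear : linear (comm : A -> B).
Proof.
move=> k a b; apply: bop_dense_eq (@st_dom_dense R A T) _ => v dv.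
have lin (f : A -> B) w : (k *: f a + f b : bop _) w = k *: bopf (f a) w + bopf (f b) w.
  by [].
rewrite lin !st_commE// st_rep_linear !lin.
rewrite st_D_linear; try exact: st_rep_dom.
by rewrite scalerBr opprD addrACA.
Qed.

Lemma st_comm_leibniz a b : (comm (amul a b) : B) =
  amul (comm a : B) (rep b) + amul (rep a : B) (comm b).
Proof.
apply: bop_dense_eq (@st_dom_dense R A T) _ => v dv.
rewrite st_commE// st_rep_mul.
rewrite -[RHS]/(comm a (rep b v) + rep a (comm b v)).
rewrite !st_commE//; last exact: st_rep_dom.
rewrite -[bopf (bcomp _ _) _]/(rep a (rep b v)).
rewrite -[bopf (bcomp _ _) _]/(rep a (rep b (D v))).
have -> (x y : st_hilb T) : rep a (x - y) = rep a x - rep a y.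
  have -> : x - y = (-1) *: y + x by rewrite scaleN1r addrC.
  by rewrite bop_linear scaleN1r addrC.
by rewrite addrA subrK.
Qed.

Definition Omega1_D : bimodule A :=
  Omega1 (@st_rep_linear R A T : linear (rep : A -> B)) (@st_rep_mul R A T)
    (@st_rep_one R A T) st_comm_leibniz.

Definition Omega2_D : bimodule A :=
  Omega2 (@st_rep_linear R A T : linear (rep : A -> B)) st_comm_linear
    (@st_rep_mul R A T) (@st_rep_one R A T) st_comm_leibniz.

End FormsOfTriple.

(* The triple (A, L^2(A, tau) (x) C^m, D), where D is
   \sum_j delta_j (x) M_j on A (x) C^m. The vector [ket a u] is a (x) u; these
   vectors span a core of D, so D is the only self-adjoint operator satisfying
   the last two conditions. *)
Definition is_gns_triple (R : realType) (A : algebra R[i])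
    (tau : A -> R[i]) (star : A -> A) (k m : nat)
    (delta : 'I_k -> A -> A) (M : 'I_k -> 'M[R[i]]_m)
    (T : spectral_triple A) (ket : A -> 'cV[R[i]]_m -> st_hilb T) : Prop :=
  [/\ bilin ket,
      forall a b u v, hdot (ket a u) (ket b v) =
        tau (amul (star a) b) * \sum_i (u i 0)^*%C * v i 0,
      hdense (fun x => exists s : seq (A * 'cV_m), x = \sum_(p <- s) ket p.1 p.2),
      forall a b u, st_rep T a (ket b u) = ket (amul a b) u &
      forall a u, st_dom (ket a u) /\
        st_D (ket a u) = \sum_j ket (delta j a) (M j *m u)].

(* The triple (A1 (x) A2, H1 (x) H2, D1 (x) 1 + gamma (x) D2). *)
Definition is_product_triple (R : realType) (A1 A2 : algebra R[i])
    (T1 : spectral_triple A1) (gamma : bop (st_hilb T1))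
    (T2 : spectral_triple A2) (T : spectral_triple (talg A1 A2)) : Prop :=
  exists t : st_hilb T1 -> st_hilb T2 -> st_hilb T,
  [/\ bilin t,
      forall u v u' v', hdot (t u v) (t u' v') = hdot u u' * hdot v v',
      hdense (fun x => exists s : seq (st_hilb T1 * st_hilb T2),
        x = \sum_(p <- s) t p.1 p.2),
      forall a b u v, st_rep T (tpair a b) (t u v) =
        t (st_rep T1 a u) (st_rep T2 b v) &
      forall u v, st_dom u -> st_dom v -> st_dom (t u v) /\
        st_D (t u v) = t (st_D u) v + t (gamma u) (st_D v)].

Arguments is_product_triple {R A1 A2} T1 gamma T2 T.

(** * Unconditional sums *)

Definition has_sum (R : realType) (I : choiceType) (f : I -> R[i]) (s : R[i]) :=
  forall e : R, 0 < e -> exists F : {fset I}, forall G : {fset I},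
    (F `<=` G)%fset -> `|\sum_(i <- G) f i - s| < e%:C%C.

(* e(x) = exp(2 pi i x) *)
Definition expi (R : realType) (x : R) : R[i] :=
  (cos (2 * pi * x) +i* sin (2 * pi * x))%C.

(** * Noncommutative tori *)

Section NoncommutativeTorus.
Variables (R : realType) (n : nat) (Theta : 'M[R]_n).

Definition rapidly_decreasing (a : 'rV[int]_n -> R[i]) : Prop :=
  forall k : nat, exists M : R, forall r : 'rV[int]_n,
    (1 + \sum_j absz (r ord0 j))%:R ^+ k * `|a r| <= M%:C%C.

(* With U^r = U_1^(r_1) ... U_n^(r_n), the relations
   U_k U_m = e(Theta_mk) U_m U_k give U^r U^s = nct_phase r s U^(r + s). *)
Definition nct_phase (r s : 'rV[int]_n) : R[i] :=
  expi (\sum_(k < n) \sum_(j < n | (j < k)%N)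
          Theta j k * (r 0 k)%:~R * (s 0 j)%:~R).

(* The *-algebra of the series \sum_r a_r U^r, [nct_coef a r] being a_r. *)
Record nctorus := NCTorus {
  nct_alg :> algebra R[i];
  nct_coef : nct_alg -> 'rV[int]_n -> R[i];
  nct_coef_linear : linear nct_coef;
  nct_coef_inj : injective nct_coef;
  nct_coef_range : forall f,
    rapidly_decreasing f <-> exists a, nct_coef a = f;
  nct_coef1 : forall r, nct_coef aone r = (r == 0)%:R;
  nct_coefM : forall a b r,
    has_sum (fun s => nct_coef a s * nct_coef b (r - s) * nct_phase s (r - s))
      (nct_coef (amul a b) r);
  (* (U^r)^* = nct_phase r r U^(-r) *)
  nct_star : nct_alg -> nct_alg;
  nct_coef_star : forall a r,
    nct_coef (nct_star a) r = (nct_coef a (- r))^*%C * nct_phase r r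
}.

Definition nct_trace (A : nctorus) (a : A) : R[i] := nct_coef a 0.

(* delta_j (\sum_r a_r U^r) = \sum_r 2 pi i r_j a_r U^r *)
Definition is_nct_derivations (A : nctorus) (delta : 'I_n -> A -> A) : Prop :=
  forall j a r,
    nct_coef (delta j a) r = (2 * pi * (r 0 j)%:~R)%:C%C * 'i%C * nct_coef a r.

End NoncommutativeTorus.

(* Hermitian matrices generating a representation of Cl(n) on C^N; it is
   irreducible when N = 2^(n./2). *)
Definition clifford (R : realType) (n N : nat) (g : 'I_n -> 'M[R[i]]_N) : Prop :=
  (forall r, (map_mx conjc (g r))^T = g r) /\
  (forall r s, g r *m g s + g s *m g r = (2 * (r == s)%:R)%:M).

Definition mx22 (R : realType) (a b c d : R[i]) : 'M[R[i]]_2 :=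
  \matrix_(i, j) if (i == 0) && (j == 0) then a else if i == 0 then b
    else if j == 0 then c else d.

Definition pauli (R : realType) (k : 'I_3) : 'M[R[i]]_2 :=
  match val k with
  | 0 => mx22 0 1 1 0
  | 1 => mx22 0 (- 'i%C) 'i%C 0
  | _ => mx22 1 0 0 (-1)
  end.

(* The grading i^m gamma_1 ... gamma_n of the Clifford representation, for
   n = 2m. *)
Definition clifford_grading (R : realType) (n N : nat) (g : 'I_n -> 'M[R[i]]_N) :
    'M[R[i]]_N :=
  'i%C ^+ n./2 *: \big[mulmx/1%:M]_(j < n) g j.

(* The even spectral triple of a noncommutative torus: D = -i \sum_j delta_j
   (x) G_j and gamma = 1 (x) Gamma, where G and Gamma are the Clifford matrices
   and their grading if n is even, and are doubled by two distinct Pauli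
   matrices if n is odd. *)
Definition is_nct_triple_with (R : realType) (n : nat) (Theta : 'M[R]_n)
    (A : nctorus Theta) (m : nat) (G : 'I_n -> 'M[R[i]]_m) (Gamma : 'M[R[i]]_m)
    (T : spectral_triple A) (gamma : bop (st_hilb T)) : Prop :=
  exists (delta : 'I_n -> A -> A) (ket : A -> 'cV_m -> st_hilb T),
  [/\ is_nct_derivations delta,
      is_gns_triple (@nct_trace _ _ _ A) (@nct_star _ _ _ A) delta
        (fun j => - 'i%C *: G j) ket &
      forall a u, gamma (ket a u) = ket a (Gamma *m u)].

Definition is_nct_triple (R : realType) (n : nat) (Theta : 'M[R]_n)
    (A : nctorus Theta) (T : spectral_triple A) (gamma : bop (st_hilb T)) : Prop :=
  exists2 g : 'I_n -> 'M[R[i]]_(2 ^ n./2), clifford g &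
  if odd n then
    exists k l : 'I_3, k != l /\
      is_nct_triple_with (fun j => g j *t pauli R k)
        ((1%:M : 'M[R[i]]_(2 ^ n./2)) *t pauli R l) gamma
  else is_nct_triple_with g (clifford_grading g) gamma.

Arguments is_nct_triple {R n Theta A} T gamma.

(** * Quantum Heisenberg manifolds *)

Section ComplexDerivatives.
Variable R : realType.

Definition cderivable (f : R -> R[i]) (x : R) : Prop :=
  derivable (fun t => complex.Re (f t)) x 1 /\
  derivable (fun t => complex.Im (f t)) x 1.
Definition cderive (f : R -> R[i]) (x : R) : R[i] :=
  (derive1 (fun t => complex.Re (f t)) x +i*
   derive1 (fun t => complex.Im (f t)) x)%C.

Definition ddx (F : R -> R -> int -> R[i]) : R -> R -> int -> R[i] :=
  fun x y p => cderive (fun t => F t y p) x.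
Definition ddy (F : R -> R -> int -> R[i]) : R -> R -> int -> R[i] :=
  fun x y p => cderive (fun t => F x t p) y.

(* All iterated partial derivatives exist and are continuous. *)
Definition smooth (F : R -> R -> int -> R[i]) : Prop :=
  forall (w : seq bool) (p : int),
  let G := foldr (fun b => if b then ddx else ddy) F w in
  [/\ forall x y, cderivable (fun t => G t y p) x,
      forall x y, cderivable (fun t => G x t p) y,
      continuous (fun z : R * R => complex.Re (G z.1 z.2 p)) &
      continuous (fun z : R * R => complex.Im (G z.1 z.2 p))].

End ComplexDerivatives.

Section QuantumHeisenberg.
Variables (R : realType) (c : nat) (hbar mu nu : R).

(* The space S^c; functions on the circle R/Z are 1-periodic functions on R. *)
Definition Sc (F : R -> R -> int -> R[i]) : Prop :=
  [/\ smooth F,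
      forall x y p, F x (y + 1) p = F x y p,
      forall (k : int) x y p,
        F (x + k%:~R) y p = expi (c%:R * k%:~R * p%:~R * y) * F x y p &
      forall (P : {poly R[i]}) (m n : nat) (K : set (R * R)), compact K ->
        exists M : R, forall x y p, K (x, y) ->
          `|P.[p%:~R] * iter m (@ddx R) (iter n (@ddy R) F) x y p| <= M%:C%C].

(* The *-algebra S^c with the product of the quantum Heisenberg manifold,
   [qhm_fun a] being the function a. *)
Record qheisenberg := QHeisenberg {
  qhm_alg :> algebra R[i];
  qhm_fun : qhm_alg -> R -> R -> int -> R[i];
  qhm_fun_linear : linear qhm_fun;
  qhm_fun_inj : injective qhm_fun;
  qhm_fun_range : forall F, Sc F <-> exists a, qhm_fun a = F;
  qhm_fun1 : forall x y p, qhm_fun aone x y p = (p == 0)%:R;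
  qhm_funM : forall a b x y p,
    has_sum (fun q : int =>
        qhm_fun a (x - hbar * (q - p)%:~R * mu) (y - hbar * (q - p)%:~R * nu) q
        * qhm_fun b (x - hbar * q%:~R * mu) (y - hbar * q%:~R * nu) (p - q))
      (qhm_fun (amul a b) x y p);
  qhm_star : qhm_alg -> qhm_alg;
  qhm_fun_star : forall a x y p,
    qhm_fun (qhm_star a) x y p = (qhm_fun a x y (- p))^*%C
}.

Definition qhm_trace (A : qheisenberg) (a : A) : R[i] :=
  let I (f : R -> R -> R) := (\int[lebesgue_measure]_(x in `[0%R, 1%R])
    \int[lebesgue_measure]_(y in `[0%R, 1%R]) f x y)%R in
  (I (fun x y => complex.Re (qhm_fun a x y 0%Z)) +i*
   I (fun x y => complex.Im (qhm_fun a x y 0%Z)))%C.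

Definition qhm_delta (alpha : R) (j : 'I_3) (F : R -> R -> int -> R[i]) :
    R -> R -> int -> R[i] := fun x y p =>
  match val j with
  | 0 => - ddx F x y p
  | 1 => (2 * pi * c%:R * p%:~R * x)%:C%C * 'i%C * F x y p - ddy F x y p
  | _ => (2 * pi * p%:~R * c%:R * alpha)%:C%C * 'i%C * F x y p
  end.

Definition qhm_sigma (j : 'I_3) : 'M[R[i]]_2 :=
  match val j with
  | 0 => mx22 1 0 0 (-1)
  | 1 => mx22 0 (-1) (-1) 0
  | _ => mx22 0 'i%C (- 'i%C) 0
  end.

(* D = \sum_j i delta_j (x) sigma_j *)
Definition is_qhm_triple (A : qheisenberg) (alpha : R)
    (T : spectral_triple A) : Prop :=
  exists (delta : 'I_3 -> A -> A) (ket : A -> 'cV_2 -> st_hilb T),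
    (forall j a, qhm_fun (delta j a) = qhm_delta alpha j (qhm_fun a)) /\
    is_gns_triple (@qhm_trace A) (@qhm_star A) delta
      (fun j => 'i%C *: qhm_sigma j) ket.

End QuantumHeisenberg.

(* Main.v *)
Require Import Defs.
From mathcomp Require Import all_boot all_order all_algebra.
From mathcomp Require Import finmap.
From mathcomp Require Import all_classical all_reals all_analysis.
From mathcomp Require Import complex mxtens ring lra.

Set Implicit Arguments.
Unset Strict Implicit.
Unset Printing Implicit Defensive.
Import Order.TTheory GRing.Theory Num.Theory.
Import numFieldNormedType.Exports.
Local Open Scope ring_scope.

(** Consider a Dirac operator D = \sum_j del_j (x) M_j on A (x) C^m, where the
    del_j are derivations of A whose brackets are combinations of the del_j,
    and where the matrices M_j anticommute and have nonzero scalar squares. A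
    one-form is then \sum_j c_j M_j, and an element of pi(Omega^2) is
    \sum_(j, k) c_jk M_j M_k, with coefficients in A. Traces against products
    of the M_j recover the c_j, and recover the c_jk up to a symmetric family;
    a symmetric family gives an element of A, since M_j M_k + M_k M_j is
    scalar. The junk forms are exactly the elements of A ([dJ_predE]):
    differentiating \sum a del_k b = 0 shows that their coefficients are
    symmetric, and an invertible common eigenvector of the derivations exhibits
    the unit as junk. Hence Omega^1 embeds in the functions J -> A, with image
    spanned by the a del_j b, and Omega^2 in the functions J * J -> A, with
    image spanned by the antisymmetrised a del_j b del_k c
    ([Omega1_coefficients], [Omega2_coefficients]).

    Both factors are of this form, and so is the product: the matrices
    M_j (x) 1 and Gamma (x) M_k anticommute because the grading Gamma
    anticommutes with the M_j ([prod_clifford_triple]). The indices of the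
    product are those of the torus and those of the Heisenberg manifold; a pair
    of indices lies in the torus, lies in the Heisenberg manifold or is mixed,
    and these cases are the three summands ([two_forms_of_product]). The tensor
    products of spaces of functions embed in functions with values in
    A1 (x) A2 because the Fourier coefficients separate the points of the torus
    algebra ([tens_separated]).

    It remains to see that the two algebras carry such derivations. The
    eigenvectors are a generator of the torus and the function e(y) at p = 0.
    On the Heisenberg manifold the product is a series, and the Leibniz rule
    ([qhm_leibniz]) comes from the flows that the derivations generate: a flow
    acts on the series term by term, and uniform bounds on second derivatives
    allow the series to be differentiated ([derive_has_sum]). The bracket of
    the derivations along x and y comes from the phase in the second one, once
    the mixed partial derivatives are known to agree ([mixed_derivatives]). *)

(** * Linear and bilinear maps *)

Section LinearMaps.
Variables (K : pzRingType) (V W : lmodType K) (f : V -> W).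
Hypothesis lf : linear f.

Lemma lin0 : f 0 = 0.
Proof. by have := lf (-1) 0 0; rewrite scaler0 addr0 scaleN1r addNr. Qed.

Lemma linD u v : f (u + v) = f u + f v.
Proof. by have := lf 1 u v; rewrite !scale1r. Qed.

Lemma linZ k u : f (k *: u) = k *: f u.
Proof. by have := lf k u 0; rewrite !addr0 lin0 addr0. Qed.

Lemma linN u : f (- u) = - f u.
Proof. by rewrite -scaleN1r linZ scaleN1r. Qed.

Lemma lin_sum (I : Type) (s : seq I) (P : pred I) (F : I -> V) :
  f (\sum_(i <- s | P i) F i) = \sum_(i <- s | P i) f (F i).
Proof. by apply: (big_morph f linD lin0). Qed.

End LinearMaps.

Section BilinearSums.
Variables (K : pzRingType) (U V W : lmodType K) (f : U -> V -> W).
Hypothesis bf : bilin f.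

Lemma bilin_suml (I : Type) (s : seq I) (P : pred I) (F : I -> U) v :
  f (\sum_(i <- s | P i) F i) v = \sum_(i <- s | P i) f (F i) v.
Proof. exact: (lin_sum (bf.1 v)). Qed.

Lemma bilin_sumr (I : Type) (s : seq I) (P : pred I) (F : I -> V) u :
  f u (\sum_(i <- s | P i) F i) = \sum_(i <- s | P i) f u (F i).
Proof. exact: (lin_sum (bf.2 u)). Qed.

Lemma bilin0l v : f 0 v = 0. Proof. exact: (lin0 (bf.1 v)). Qed.
Lemma bilin0r u : f u 0 = 0. Proof. exact: (lin0 (bf.2 u)). Qed.
Lemma bilinNl u v : f (- u) v = - f u v. Proof. exact: (linN (bf.1 v)). Qed.
Lemma bilinNr u v : f u (- v) = - f u v. Proof. exact: (linN (bf.2 u)). Qed.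

End BilinearSums.

Lemma lin_comp (K : pzRingType) (U V W : lmodType K) (f : V -> W)
  (g : U -> V) : linear f -> linear g -> linear (f \o g).
Proof. by move=> lf lg k u v; rewrite /= lg lf. Qed.

(** * Tensor products over a field *)

Section TensorSeparation.
Variables (K : fieldType) (U V : lmodType K).

Definition contract (phi : U -> K) : tens U V -> V :=
  tlift (fun u v => phi u *: v).

Lemma contract_bilin (phi : U -> K) : linear (phi : U -> K^o) ->
  bilin (fun u (v : V) => phi u *: v).
Proof.
move=> lphi; split=> [v|u] k x y.
- by rewrite lphi scalerDl scalerA.
- by rewrite scalerDr !scalerA mulrC.
Qed.

(** A tensor is written with as few terms as possible; its right-hand entries
    are then linearly independent, so that the functionals kill every
    left-hand entry. *)
Lemma tens_separated (I : Type) (phi : I -> U -> K) :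
  (forall i, linear (phi i : U -> K^o)) ->
  (forall u, (forall i, phi i u = 0) -> u = 0) ->
  forall x : tens U V, (forall i, contract (phi i) x = 0) -> x = 0.
Proof.
move=> lphi sep x; have tb := tpair_bilin U V.
suff main n (u : 'I_n -> U) (v : 'I_n -> V) :
    (forall i, \sum_k phi i (u k) *: v k = 0) -> \sum_k tpair (u k) (v k) = 0.
  rewrite [x]tens_sum (big_nth (0, 0)) big_mkord => h.
  apply: main => i; have cb := contract_bilin (lphi i).
  rewrite -[RHS](h i) /contract (lin_sum (tlift_linear cb)).
  by apply: eq_bigr => k _; rewrite tlift_pair.
elim: n u v => [|n ih] u v h; first by rewrite big_ord0.
have [[l [j lj0 dep]]|indep] :=
  pselect (exists l : 'I_n.+1 -> K, exists2 j, l j != 0 & \sum_k l k *: v k = 0).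
(* A right-hand entry that depends on the others is eliminated. *)
- have vj : v j = \sum_(k < n) (- (l (lift j k) / l j)) *: v (lift j k).
    move: dep; rewrite (bigD1_ord j)//= => /eqP; rewrite addr_eq0 => /eqP e.
    apply: (scalerI lj0); rewrite e scaler_sumr -sumrN.
    apply: eq_bigr => k _.
    by rewrite scalerA mulrN mulrCA mulfV// mulr1 scaleNr.
  pose u' k := u (lift j k) - (l (lift j k) / l j) *: u j.
  rewrite (bigD1_ord j)//= {1}vj (bilin_sumr tb) -big_split/=.
  rewrite (eq_bigr (fun k => tpair (u' k) (v (lift j k)))) => [|k _].
    apply: ih => i; rewrite -[RHS](h i) [RHS](bigD1_ord j)//= {1}vj scaler_sumr.
    rewrite -big_split; apply: eq_bigr => k _ /=.
    rewrite (linD (lphi i)) (linN (lphi i)) (linZ (lphi i)).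
    rewrite scalerDl addrC scalerA mulrN; congr (_ *: _ + _).
    by rewrite (mulrC (phi i _)).
  rewrite (bilinDl _ _ _ tb) (bilinNl tb) (bilinZl _ _ _ tb) addrC.
  by rewrite (bilinZr _ _ _ tb) scaleNr.
- apply: big1 => k _; rewrite (sep (u k)) ?(bilin0l tb)// => i.
  apply/eqP/negP => /negP nz; apply: indep.
  by exists (fun k => phi i (u k)), k.
Qed.

End TensorSeparation.

(** No bases of U and V are needed: functionals on U' pull back to functionals
    that separate the points of U. *)
Lemma tens_map_injective (K : fieldType) (U U' V V' : lmodType K)
    (I J L : Type) (f : I -> U -> U') (g : J -> V -> V') (phi : L -> U' -> K) :
  (forall i, linear (f i)) -> (forall j, linear (g j)) ->
  (forall l, linear (phi l : U' -> K^o)) ->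
  (forall u, (forall l, phi l u = 0) -> u = 0) ->
  (forall u, (forall i, f i u = 0) -> u = 0) ->
  (forall v, (forall j, g j v = 0) -> v = 0) ->
  forall x : tens U V,
    (forall i j, tlift (fun u v => tpair (f i u) (g j v)) x = 0) -> x = 0.
Proof.
move=> lf lg lphi sep injf injg x h.
have tb := tpair_bilin U' V'.
have bfg i j : bilin (fun u v => tpair (f i u) (g j v)).
  by split=> [v|u] k a b; rewrite ?lf ?lg (bilinPl, bilinPr).
have lp (p : L * I) : linear (fun u => phi p.1 (f p.2 u) : K^o).
  by move=> k a b; rewrite lf lphi.
apply: (tens_separated (phi := fun p : L * I => fun u => phi p.1 (f p.2 u))) => //.
  by move=> u hu; apply: injf => i; apply: sep => l; apply: (hu (l, i)).
move=> [l i]; apply: injg => j.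
rewrite -[RHS](lin0 (tlift_linear (contract_bilin V' (lphi l)))).
rewrite -(h i j).
apply: (tlift_uniq (g := fun x => g j (tlift _ x))
  (h := fun x => tlift _ (tlift (fun u v => tpair (f i u) (g j v)) x))).
- apply: (@lin_comp _ _ _ _ (g j) (tlift _)) => //.
  exact: (tlift_linear (contract_bilin V (lp (l, i)))).
- apply: (@lin_comp _ _ _ _ (tlift _) (tlift _)); apply: tlift_linear => //.
  exact: contract_bilin.
- move=> u v; rewrite !tlift_pair//; try exact: contract_bilin.
  by rewrite (linZ (lg j)).
Qed.

(** The isomorphism chooses preimages; injectivity makes the choice linear and
    compatible with the actions. *)
Lemma bimodule_iso_of_image (K : comPzRingType) (A : algebra K)
    (M N W : bimodule A) (f : M -> W) (g : N -> W) :
  linear f -> linear g ->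
  (forall m, f m = 0 -> m = 0) -> (forall n, g n = 0 -> n = 0) ->
  (forall a m, f (lact a m) = lact a (f m)) ->
  (forall a m, f (ract a m) = ract a (f m)) ->
  (forall a n, g (lact a n) = lact a (g n)) ->
  (forall a n, g (ract a n) = ract a (g n)) ->
  (forall m, exists n, g n = f m) -> (forall n, exists m, f m = g n) ->
  bimodule_iso M N.
Proof.
move=> lf lg injf injg fL fR gL gR fg gf.
have inj (P Q : lmodType K) (h : P -> Q) : linear h ->
    (forall m, h m = 0 -> m = 0) -> injective h.
  move=> lh h0 x y e; apply/eqP; rewrite -subr_eq0; apply/eqP/h0.
  by rewrite (linD lh) (linN lh) e subrr.
have {}injf := inj _ _ _ lf injf; have {}injg := inj _ _ _ lg injg.
have [t tE] := choice fg; have [r rE] := choice gf.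
exists t; split.
- by move=> k x y; apply: injg; rewrite lg !tE lf.
- by exists r => x; [apply: injf; rewrite rE tE|apply: injg; rewrite tE rE].
- by move=> a m; apply: injg; rewrite gL !tE fL.
- by move=> a m; apply: injg; rewrite gR !tE fR.
Qed.

(** * Families of anticommuting matrices *)

Definition anticommuting_family (C : numFieldType) (J : eqType) (m : nat)
    (M : J -> 'M[C]_m) (s : J -> C) : Prop :=
  [/\ forall j, s j != 0, forall j, M j *m M j = (s j)%:M &
      forall j k, j != k -> M j *m M k = - (M k *m M j)].

(** Conjugation by N preserves the trace and changes the sign of Y. *)
Lemma mxtrace_anticommute (C : numFieldType) (m : nat) (N Y : 'M[C]_m) a :
  a != 0 -> N *m N = a%:M -> N *m Y = - (Y *m N) -> \tr Y = 0.
Proof.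
move=> a0 NN NY.
have e : a * \tr Y = - (a * \tr Y).
  have l : a * \tr Y = \tr (N *m (N *m Y)).
    by rewrite mulmxA NN mul_scalar_mx mxtraceZ.
  have r : a * \tr Y = \tr (N *m (Y *m N)).
    by rewrite mxtrace_mulC -mulmxA NN mul_mx_scalar mxtraceZ.
  by rewrite {1}l r NY mulmxN raddfN.
have : a * \tr Y *+ 2 = 0 by rewrite mulr2n {1}e addNr.
by move=> /eqP; rewrite mulrn_eq0 mulf_eq0 (negPf a0) => /eqP.
Qed.

Section AnticommutingFamily.
Variables (C : numFieldType) (J : finType) (m : nat).
Variables (M : J -> 'M[C]_m) (s : J -> C).
Hypotheses (m_gt0 : (0 < m)%N) (cM : anticommuting_family M s).

Let s_neq0 j : s j != 0. Proof. by case: cM => h _ _; exact: h. Qed.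
Let sq j : M j *m M j = (s j)%:M. Proof. by case: cM => _ h _; exact: h. Qed.
Let anti j k : j != k -> M j *m M k = - (M k *m M j).
Proof. by case: cM => _ _ h; apply: h. Qed.

Lemma trace_pair j k : \tr (M j *m M k) = (s j * m%:R) *+ (j == k).
Proof.
have [<-|jk] := eqVneq j k; first by rewrite sq mxtrace_scalar mulr_natr.
apply: (mxtrace_anticommute (s_neq0 j) (sq j)).
by rewrite mulmxA sq -mulmxA (anti (_ : k != j)) 1?eq_sym// mulmxN mulmxA sq opprK.
Qed.

(** Unless the pairs have the same entries or p is diagonal, some generator
    lies in exactly one of them; it anticommutes with the product of all four,
    whose trace then vanishes. *)
Lemma trace_two_pairs j k (p : J * J) : j != k ->
  \tr (M k *m M j *m (M p.1 *m M p.2)) =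
  (s j * s k * m%:R) *+ (p == (j, k)) - (s j * s k * m%:R) *+ (p == (k, j)).
Proof.
case: p => x y /= jk; have kj : k != j by rewrite eq_sym.
have tkj : \tr (M k *m M j) = 0 by rewrite trace_pair (negPf kj).
rewrite !xpair_eqE.
have [<-|xy] := eqVneq x y.
  have [e|xj] := eqVneq x j; rewrite sq mul_mx_scalar mxtraceZ tkj mulr0.
    by rewrite e (negPf jk) ?andbF ?mulr0n subrr.
  by case: (x == k); rewrite ?mulr0n subrr.
have through l u v : l != u -> l != v ->
    M l *m (M u *m M v) = M u *m M v *m M l.
  move=> lu lv.
  by rewrite mulmxA (anti lu) mulNmx -!mulmxA (anti lv) mulmxN opprK.
have ends u v : u != v -> M u *m (M u *m M v) = - (M u *m M v *m M u).
  by move=> uv; rewrite -(mulmxA (M u)) -mulmxN -anti// eq_sym.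
have ends' u v : u != v -> M v *m (M u *m M v) = - (M u *m M v *m M v).
  by move=> uv; rewrite mulmxA -mulNmx -anti// eq_sym.
have kill l : (l == j) || (l == k) -> l != x -> l != y ->
    \tr (M k *m M j *m (M x *m M y)) = 0.
  move=> ljk lx ly; apply: (mxtrace_anticommute (s_neq0 l) (sq l)).
  have -> : M l *m (M k *m M j *m (M x *m M y)) =
      M l *m (M k *m M j) *m (M x *m M y) by rewrite mulmxA.
  have -> : M l *m (M k *m M j) = - (M k *m M j *m M l).
    by case/orP: ljk => /eqP ->; [exact: ends'|exact: ends].
  by rewrite mulNmx -!mulmxA [M l *m _]mulmxA -mulmxA through// !mulmxA.
have [xj|xj] := eqVneq x j; have [yk|yk] := eqVneq y k => /=.
- subst x y; rewrite (negPf jk) /= subr0.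
  have -> : M k *m M j *m (M j *m M k) = (s j * s k)%:M.
    rewrite -mulmxA (mulmxA (M j)) sq mul_scalar_mx -scalemxAr sq.
    by rewrite scale_scalar_mx.
  by rewrite mxtrace_scalar mulr1n mulr_natr.
- subst x; rewrite (negPf jk) /= subrr; apply: (kill k).
  + by rewrite eqxx orbT.
  + by [].
  + by rewrite eq_sym.
- subst y; rewrite [k == j](negPf kj) andbF subrr; apply: (kill j) => //.
  + by rewrite eqxx.
  + by rewrite eq_sym.
- have [xk|xk] := eqVneq x k; have [yj|yj] := eqVneq y j => /=.
  + subst x y; rewrite mulr0n sub0r.
    have -> : M k *m M j *m (M k *m M j) = - (s j * s k)%:M.
      rewrite -mulmxA (mulmxA (M j)) (anti jk) mulNmx mulmxN.
      rewrite -(mulmxA (M k)) sq mul_mx_scalar -scalemxAr sq.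
      by rewrite scale_scalar_mx.
    by rewrite raddfN /= mxtrace_scalar mulr1n mulr_natr.
  + subst x; rewrite !mulr0n subrr; apply: (kill j); rewrite ?eqxx// eq_sym//.
  + subst y; rewrite !mulr0n subrr; apply: (kill k); rewrite ?eqxx ?orbT// eq_sym//.
  + rewrite !mulr0n subrr; apply: (kill j); rewrite ?eqxx// eq_sym//.
Qed.

Variable V : lmodType C.

Let trace_coef (I : finType) (N : I -> 'M[C]_m) (c : I -> V) (Y : 'M[C]_m) :
  (forall i l, \sum_p N p i l *: c p = 0) -> \sum_p \tr (Y *m N p) *: c p = 0.
Proof.
move=> h; rewrite /mxtrace.
transitivity (\sum_i \sum_l Y i l *: (\sum_p N p l i *: c p)); last first.
  by apply: big1 => i _; apply: big1 => l _; rewrite h scaler0.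
under eq_bigr do rewrite scaler_suml; rewrite exchange_big /=.
apply: eq_bigr => i _; under [RHS]eq_bigr do rewrite scaler_sumr.
rewrite [RHS]exchange_big; apply: eq_bigr => p _ /=.
rewrite mxE scaler_suml; apply: eq_bigr => l _.
by rewrite scalerA.
Qed.

Lemma coef1_unique (c : J -> V) :
  (forall i l, \sum_j M j i l *: c j = 0) -> forall j, c j = 0.
Proof.
move=> /trace_coef h j; have := h (M j).
rewrite (bigD1 j)//= big1 ?addr0 => [|k kj]; last first.
  by rewrite trace_pair eq_sym (negPf kj) scale0r.
rewrite trace_pair eqxx mulr1n => /eqP; rewrite scaler_eq0 mulf_eq0.
by rewrite (negPf (s_neq0 j)) pnatr_eq0 (gtn_eqF m_gt0) => /eqP.
Qed.

(** The symmetric part of the coefficients meets only the scalars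
    M_j M_k + M_k M_j, and cannot be recovered. *)
Lemma coef2_symmetric (c : J * J -> V) :
  (forall i l, \sum_p (M p.1 *m M p.2) i l *: c p = 0) ->
  forall j k, c (j, k) = c (k, j).
Proof.
move=> /trace_coef h j k; have [->//|jk] := eqVneq j k.
have := h (M k *m M j).
under eq_bigr do rewrite trace_two_pairs// scalerBl.
have pick q : \sum_p ((s j * s k * m%:R) *+ (p == q)) *: c p =
    (s j * s k * m%:R) *: c q.
  rewrite (bigD1 q)//= eqxx big1 ?addr0// => p /negPf ->.
  by rewrite scale0r.
rewrite sumrB !pick -scalerBr => /eqP; rewrite scaler_eq0 !mulf_eq0.
rewrite !(negPf (s_neq0 _)) pnatr_eq0 (gtn_eqF m_gt0) /= subr_eq0.
by move/eqP.
Qed.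

End AnticommutingFamily.

(** * Derivations and Dirac operators of Clifford type *)

(** The commutators close up linearly, as in a Lie algebra acting on [A]; the
    invertible eigenvector is what puts the unit among the junk forms. *)
Record lie_derivations (K : fieldType) (A : algebra K) (J : finType)
    (del : J -> A -> A) : Prop := LieDerivations {
  ld_linear : forall j, linear (del j);
  ld_leibniz : forall j a b,
    del j (amul a b) = amul (del j a) b + amul a (del j b);
  ld_bracket : exists c : J -> J -> J -> K, forall j k a,
    del j (del k a) - del k (del j a) = \sum_l c j k l *: del l a;
  ld_unitary : exists j0 (u v : A) (r : K),
    [/\ r != 0, amul u v = aone, amul v u = aone,
        forall j, del j u = (if j == j0 then r else 0) *: u &
        forall j, del j v = - (if j == j0 then r else 0) *: v]
}.

(** The dense copy [ket] of A (x) C^m in the Hilbert space, on which D is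
    \sum_j del_j (x) M_j; only the orthogonality of the m summands matters, so
    that the inner product on A is left unspecified. *)
Record clifford_triple (R : realType) (A : algebra R[i])
    (T : spectral_triple A) (J : finType) (del : J -> A -> A) (m : nat)
    (M : J -> 'M[R[i]]_m) (ket : A -> 'cV[R[i]]_m -> st_hilb T) : Prop :=
  CliffordTriple {
  ct_gt0 : (0 < m)%N;
  ct_anticommuting : exists s, anticommuting_family M s;
  ct_bilin : bilin ket;
  ct_dot : exists q : A -> A -> R[i], forall a b u v,
    hdot (ket a u) (ket b v) = q a b * \sum_i (u i 0)^*%C * v i 0;
  ct_dense : hdense (fun x => exists s : seq (A * 'cV_m),
    x = \sum_(p <- s) ket p.1 p.2);
  ct_rep : forall a b u, st_rep T a (ket b u) = ket (amul a b) u;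
  ct_D : forall a u, st_dom (ket a u) /\
    st_D (ket a u) = \sum_j ket (del j a) (M j *m u)
}.

Section InnerProduct.
Variables (R : realType) (H : prehilbert R).

Lemma hdot_linearr (x : H) : linear (hdot x : H -> R[i]^o).
Proof. by move=> k y z; rewrite hdot_linear. Qed.

Lemma hdotDl (x y z : H) : hdot (x + y) z = hdot x z + hdot y z.
Proof.
rewrite (hdot_conj z) (linD (hdot_linearr z)).
rewrite (hdot_conj z x) (hdot_conj z y).
exact: (rmorphD (@conjc R)).
Qed.

Lemma hdotZl k (x z : H) : hdot (k *: x) z = k^*%C * hdot x z.
Proof.
rewrite (hdot_conj z) (linZ (hdot_linearr z)) (hdot_conj z x).
exact: (rmorphM (@conjc R)).
Qed.

Lemma hdot_suml (I : Type) (s : seq I) (F : I -> H) z :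
  hdot (\sum_(i <- s) F i) z = \sum_(i <- s) hdot (F i) z.
Proof.
apply: (big_morph (fun x => hdot x z)) => [x y|]; first exact: hdotDl.
by apply: (addrI (hdot 0 z)); rewrite -hdotDl !addr0.
Qed.

Lemma hdot_sumr (I : Type) (s : seq I) (F : I -> H) z :
  hdot z (\sum_(i <- s) F i) = \sum_(i <- s) hdot z (F i).
Proof. exact: (lin_sum (hdot_linearr z)). Qed.

End InnerProduct.

Lemma bopf_sum (R : realType) (H : hilbert R) (I : Type) (s : seq I)
  (F : I -> bop_alg H) (x : H) :
  bopf (\sum_(i <- s) F i) x = \sum_(i <- s) bopf (F i) x.
Proof. exact: (big_morph (fun X => bopf X x)). Qed.

Lemma cV_sum_delta (C : pzRingType) (m : nat) (u : 'cV[C]_m) :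
  u = \sum_i u i 0 *: delta_mx i 0.
Proof.
apply/colP => i; rewrite summxE (bigD1 i)//= big1 ?addr0 => [|k ki].
  by rewrite !mxE !eqxx mulr1.
by rewrite !mxE eq_sym (negPf ki) mulr0.
Qed.

Section CliffordTriple.
Variables (R : realType) (A : algebra R[i]) (T : spectral_triple A).
Variables (J : finType) (del : J -> A -> A) (m : nat).
Variables (M : J -> 'M[R[i]]_m) (ket : A -> 'cV[R[i]]_m -> st_hilb T).
Hypotheses (dd : lie_derivations del) (ct : clifford_triple del M ket).

Local Notation B := (bop_alg (st_hilb T)).
Local Notation rep := (@st_rep R A T).
Local Notation comm := (@st_comm R A T).
Let kb : bilin ket := ct_bilin ct.
Let Ab := amul_bilin A.
Let delL := ld_linear dd.

Lemma comm_ket a b u :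
  comm a (ket b u) = \sum_j ket (amul (del j a) b) (M j *m u).
Proof.
have [db Db] := ct_D ct b u; rewrite st_commE// (ct_rep ct) Db.
rewrite (lin_sum (@bop_linear _ _ (rep a))) (ct_D ct _ u).2 -sumrB.
apply: eq_bigr => j _.
by rewrite (ct_rep ct) (ld_leibniz dd) (bilinDl _ _ _ kb) addrK.
Qed.

Lemma bop_ket_eq (X Y : B) : (forall b u, bopf X (ket b u) = bopf Y (ket b u)) ->
  X = Y.
Proof.
move=> e; apply: bop_dense_eq (ct_dense ct) _ => _ [s ->].
rewrite !(lin_sum (@bop_linear _ _ _)).
by apply: eq_bigr => p _; apply: e.
Qed.

(* The m summands are orthogonal, and ket (x k) v has squared norm
   q (x k) (x k) for every unit vector v. *)
Let ket_components (x : 'I_m -> A) :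
  \sum_k ket (x k) (delta_mx k 0) = 0 -> forall k v, ket (x k) v = 0.
Proof.
have [q hq] := ct_dot ct.
have delta_dot (k l : 'I_m) :
    \sum_(i < m) ((delta_mx k 0 : 'cV[R[i]]_m) i 0)^*%C *
      (delta_mx l 0 : 'cV[R[i]]_m) i 0 = (k == l)%:R.
  rewrite (bigD1 k)//= big1 ?addr0 => [|i ik].
    by rewrite !mxE !eqxx !andbT conjc1 mul1r.
  by rewrite !mxE (negPf ik) conjc0 mul0r.
have qxx k : q (x k) (x k) = hdot (ket (x k) (delta_mx k 0)) (ket (x k) (delta_mx k 0)).
  by rewrite hq delta_dot eqxx mulr1.
move=> e k v; have : \sum_k q (x k) (x k) = 0.
  pose S := \sum_k ket (x k) (delta_mx k 0).
  transitivity (hdot S S); last by rewrite {2}/S e (lin0 (hdot_linearr S)).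
  rewrite hdot_suml; apply: eq_bigr => i _; rewrite hdot_sumr (bigD1 i)//= big1.
    by rewrite addr0 qxx.
  by move=> j ji; rewrite hq delta_dot eq_sym (negPf ji) mulr0.
move/eqP; rewrite psumr_eq0 => [|i _]; last by rewrite qxx hdot_ge0.
move=> /allP/(_ k (mem_index_enum k)) /eqP qk.
by apply: hdot_eq0; rewrite hq qk mul0r.
Qed.

(** The operator \sum_i c_i (x) N_i. *)
Definition symbol_op (I : finType) (N : I -> 'M[R[i]]_m) (c : I -> A) b u :=
  \sum_i ket (amul (c i) b) (N i *m u).

(** Applied to the vector e_l, the operator has the components
    \sum_p N_p i l c_p. *)
Lemma symbol_op_eq0 (I : finType) (N : I -> 'M[R[i]]_m) (c : I -> A) :
  (forall b u, symbol_op N c b u = 0) ->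
  forall i l, \sum_p N p i l *: c p = 0.
Proof.
move=> h i l; pose x k := \sum_p N p k l *: c p.
have xb b : \sum_k ket (amul (x k) b) (delta_mx k 0) = 0.
  rewrite -[RHS](h b (delta_mx l 0)) /symbol_op.
  under eq_bigr do rewrite (bilin_suml Ab) (bilin_suml kb).
  rewrite exchange_big; apply: eq_bigr => p _ /=.
  rewrite [N p *m _]cV_sum_delta (bilin_sumr kb); apply: eq_bigr => k _.
  rewrite (bilinZl _ _ _ Ab) (bilinZl _ _ _ kb) (bilinZr _ _ _ kb).
  congr (_ *: _); rewrite mxE (bigD1 l)//= !mxE !eqxx mulr1.
  rewrite big1 ?addr0// => j jl.
  by rewrite !mxE (negPf jl) mulr0.
have rep0 : rep (x i) = 0.
  apply: bop_ket_eq => b u; rewrite (ct_rep ct).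
  exact: (ket_components (xb b)).
by apply: (@st_rep_inj R A T); rewrite rep0 (lin0 (@st_rep_linear R A T)).
Qed.

Lemma symbol_opP (I : finType) (N : I -> 'M[R[i]]_m) k c c' b u :
  symbol_op N (fun i => k *: c i + c' i) b u =
  k *: symbol_op N c b u + symbol_op N c' b u.
Proof.
rewrite /symbol_op scaler_sumr -big_split; apply: eq_bigr => i _ /=.
by rewrite (bilinPl _ _ _ _ Ab) (bilinPl _ _ _ _ kb).
Qed.

Definition has_symbol (I : finType) (N : I -> 'M[R[i]]_m) (X : B) (c : I -> A) :=
  forall b u, bopf X (ket b u) = symbol_op N c b u.

Section Symbols.
Variables (I : finType) (N : I -> 'M[R[i]]_m).

Lemma has_symbolP k X Y c d : has_symbol N X c -> has_symbol N Y d ->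
  has_symbol N (k *: X + Y) (fun i => k *: c i + d i).
Proof. by move=> hX hY b u; rewrite symbol_opP -hX -hY. Qed.

Lemma has_symbol0 : has_symbol N 0 (fun=> 0).
Proof.
by move=> b u; rewrite /symbol_op big1// => i _; rewrite (bilin0l Ab) (bilin0l kb).
Qed.

Lemma has_symbol_sum (L : Type) (s : seq L) (X : L -> B) (c : L -> I -> A) :
  (forall l, has_symbol N (X l) (c l)) ->
  has_symbol N (\sum_(l <- s) X l) (fun i => \sum_(l <- s) c l i).
Proof.
move=> h b u; rewrite bopf_sum (eq_bigr _ (fun l _ => h l b u)).
rewrite /symbol_op exchange_big; apply: eq_bigr => i _ /=.
by rewrite (bilin_suml Ab) (bilin_suml kb).
Qed.

Lemma has_symbol_lmul a X c : has_symbol N X c ->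
  has_symbol N (amul (rep a : B) X) (fun i => amul a (c i)).
Proof.
move=> h b u; rewrite -[LHS]/(rep a (bopf X (ket b u))) h.
rewrite (lin_sum (@bop_linear _ _ (rep a))).
by apply: eq_bigr => i _; rewrite (ct_rep ct) amulA.
Qed.

Lemma has_symbol_rmul a X c : has_symbol N X c ->
  has_symbol N (amul X (rep a : B)) (fun i => amul (c i) a).
Proof.
move=> h b u; rewrite -[LHS]/(bopf X (rep a (ket b u))) (ct_rep ct) h.
by apply: eq_bigr => i _; rewrite amulA.
Qed.

End Symbols.

Local Notation has_symbol1 := (has_symbol M).
Local Notation M2 := (fun p : J * J => M p.1 *m M p.2).
Local Notation has_symbol2 := (has_symbol M2).

Lemma symbol1_unique X c c' : has_symbol1 X c -> has_symbol1 X c' -> c = c'.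
Proof.
move=> h h'; apply/funext => j; apply/eqP; rewrite -subr_eq0; apply/eqP.
have [s cM] := ct_anticommuting ct.
apply: (coef1_unique (ct_gt0 ct) cM (c := fun j => c j - c' j)).
apply: symbol_op_eq0 => b u.
have := has_symbolP (-1) h' h b u; rewrite scaleN1r addNr => e.
rewrite [RHS]e; by apply: eq_bigr => i _; rewrite scaleN1r addrC.
Qed.

Lemma symbol2_unique X c c' : has_symbol2 X c -> has_symbol2 X c' ->
  forall j k, c (j, k) - c (k, j) = c' (j, k) - c' (k, j).
Proof.
move=> h h' j k; have [s cM] := ct_anticommuting ct.
suff e : c (j, k) - c' (j, k) = c (k, j) - c' (k, j).
  have -> : c (j, k) = c (k, j) - c' (k, j) + c' (j, k) by rewrite -e subrK.
  by rewrite addrAC [_ - c' _]addrC addrK addrC.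
apply: (coef2_symmetric (ct_gt0 ct) cM (c := fun p => c p - c' p)).
apply: symbol_op_eq0 => b u.
have := has_symbolP (-1) h' h b u; rewrite scaleN1r addNr => e.
by rewrite [RHS]e; apply: eq_bigr => i _; rewrite scaleN1r addrC.
Qed.

Lemma has_symbol_comm a : has_symbol1 (comm a) (fun j => del j a).
Proof. by move=> b u; rewrite comm_ket. Qed.

Lemma has_symbol_mul X Y c d : has_symbol1 X c -> has_symbol1 Y d ->
  has_symbol2 (amul X Y) (fun p => amul (c p.1) (d p.2)).
Proof.
move=> hX hY b u; rewrite -[LHS]/(bopf X (bopf Y (ket b u))) hY.
rewrite (lin_sum (@bop_linear _ _ X)).
under eq_bigr do rewrite hX.
rewrite /symbol_op exchange_big pair_big; apply: eq_bigr => -[j k] _ /=.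
by rewrite mulmxA amulA.
Qed.

(** A symmetric symbol sees only the anticommutators of the M_j, which are
    scalar: the operator lies in A. *)
Lemma symmetric_symbol X c : has_symbol2 X c ->
  (forall j k, c (j, k) = c (k, j)) -> exists a, X = rep a.
Proof.
move=> h sym; have [s [_ sq anti]] := ct_anticommuting ct.
exists (\sum_j s j *: c (j, j)); apply: bop_ket_eq => b u.
rewrite h (ct_rep ct) (bilin_suml Ab) (bilin_suml kb).
have -> : symbol_op M2 c b u =
    \sum_j \sum_k ket (amul (c (j, k)) b) (M j *m M k *m u).
  by rewrite pair_bigA; apply: eq_bigr => -[j k].
apply: (@scalerI _ _ 2%:R); first by rewrite pnatr_eq0.
rewrite !scaler_nat !mulr2n [X in X + _ = _]exchange_big -!big_split /=.
apply: eq_bigr => j _; rewrite -big_split (bigD1 j)//= big1 => [|k kj].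
  rewrite addr0 sq mul_scalar_mx (bilinZr _ _ _ kb).
  by rewrite (bilinZl _ _ _ Ab) (bilinZl _ _ _ kb).
by rewrite sym anti// mulNmx (bilinNr kb) addNr.
Qed.

(** Since M_j0 squares to a scalar, multiplication by an element of A is itself
    of second order, with a symmetric symbol. *)
Lemma has_symbol_rep : exists j0 r, r != 0 /\ forall a,
  has_symbol2 (rep a) (fun p => if p == (j0, j0) then r *: a else 0).
Proof.
have [j0 _] := ld_unitary dd; have [s [s0 sq _]] := ct_anticommuting ct.
exists j0, (s j0)^-1; split=> [|a b u]; first by rewrite invr_eq0.
rewrite (ct_rep ct) /symbol_op (bigD1 (j0, j0))//= eqxx big1 => [|p /negPf ->].
  rewrite addr0 sq mul_scalar_mx (bilinZr _ _ _ kb) (bilinZl _ _ _ Ab).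
  by rewrite (bilinZl _ _ _ kb) scalerA mulfV// scale1r.
by rewrite (bilin0l Ab) (bilin0l kb).
Qed.

Lemma Omega1_symbol (s : seq (A * A)) :
  has_symbol1 (\sum_(p <- s) amul (rep p.1 : B) (comm p.2))
    (fun j => \sum_(p <- s) amul p.1 (del j p.2)).
Proof.
by apply: has_symbol_sum => p; apply: has_symbol_lmul; exact: has_symbol_comm.
Qed.

Lemma piOmega2_symbol (s : seq (A * A * A)) :
  has_symbol2
    (\sum_(p <- s) amul (amul (rep p.1.1 : B) (comm p.1.2)) (comm p.2))
    (fun jk => \sum_(p <- s)
       amul (amul p.1.1 (del jk.1 p.1.2)) (del jk.2 p.2)).
Proof.
apply: has_symbol_sum => p.
exact: (has_symbol_mul (has_symbol_lmul p.1.1 (has_symbol_comm p.1.2))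
  (has_symbol_comm p.2)).
Qed.

(** Differentiating \sum a del_k b = 0 makes the symbol of a junk form
    symmetric up to brackets, which vanish again; conversely the pairs (u, v)
    and (v, u) of inverse eigenvectors exhibit a nonzero scalar as junk. *)
Lemma dJ_predE (X : B) : X \in dJ_pred (rep : A -> B) comm <-> exists a, X = rep a.
Proof.
split=> [/asboolP[s s0 ->]|[a ->]].
  have vanish j : \sum_(p <- s) amul p.1 (del j p.2) = 0.
    have h := Omega1_symbol s; rewrite s0 in h.
    by have /(congr1 (fun f => f j)) := symbol1_unique h (@has_symbol0 _ M).
  apply: (@symmetric_symbol _
      (fun jk => \sum_(p <- s) amul (del jk.1 p.1) (del jk.2 p.2))) => [|j k].
    apply: has_symbol_sum => p.
    exact: (has_symbol_mul (has_symbol_comm p.1) (has_symbol_comm p.2)).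
  have diff i l : \sum_(p <- s) amul (del i p.1) (del l p.2) =
      - \sum_(p <- s) amul p.1 (del i (del l p.2)).
    apply/eqP; rewrite -addr_eq0 -big_split /=; apply/eqP.
    transitivity (del i (\sum_(p <- s) amul p.1 (del l p.2))).
      rewrite (lin_sum (delL i)); apply: eq_bigr => p _.
      by rewrite (ld_leibniz dd).
    by rewrite vanish (lin0 (delL i)).
  apply/eqP; rewrite /= !diff eqr_opp -subr_eq0 -sumrB.
  have [c br] := ld_bracket dd.
  under eq_bigr do rewrite -(bilinNr Ab) -(bilinDr _ _ _ Ab) br (bilin_sumr Ab).
  rewrite exchange_big big1//= => l _.
  under eq_bigr do rewrite (bilinZr _ _ _ Ab).
  by rewrite -scaler_sumr vanish scaler0.
have [j0 [u [v [r [r0 uv vu du dv]]]]] := ld_unitary dd.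
have scalar1 : exists2 k, k != 0 & k *: (rep aone : B) \in dJ_pred (rep : A -> B) comm.
  have [s [s0 sq _]] := ct_anticommuting ct.
  exists (- (r * r *+ 2 * s j0)).
    by rewrite oppr_eq0 mulf_neq0// mulrn_eq0 mulf_neq0.
  apply/asboolP; exists [:: (v, u); (u, v)]; rewrite !big_cons !big_nil !addr0 /=.
    apply: bop_ket_eq => b w.
    have h := Omega1_symbol [:: (v, u); (u, v)].
    rewrite !big_cons !big_nil !addr0 /= in h; rewrite h.
    rewrite /symbol_op big1// => j _.
    rewrite !big_cons !big_nil addr0 /= du dv !(bilinZr _ _ _ Ab) uv vu.
    by rewrite scaleNr addrN (bilin0l Ab) (bilin0l kb).
  apply: bop_ket_eq => b w.
  have h1 := has_symbol_mul (has_symbol_comm v) (has_symbol_comm u).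
  have h2 := has_symbol_mul (has_symbol_comm u) (has_symbol_comm v).
  rewrite -[RHS]/(bopf (amul (comm v : B) (comm u)) (ket b w) +
    bopf (amul (comm u : B) (comm v)) (ket b w)) h1 h2 /symbol_op -big_split.
  rewrite (bigD1 (j0, j0))//= big1 => [|[j k] jk]; last first.
    rewrite /= !du !dv.
    have [ej|ej] := eqVneq j j0; have [ek|ek] := eqVneq k j0.
    - by rewrite ej ek eqxx in jk.
    - by rewrite !(oppr0, scale0r, bilin0r Ab, bilin0l Ab, bilin0l kb) addr0.
    - by rewrite !(oppr0, scale0r, bilin0r Ab, bilin0l Ab, bilin0l kb) addr0.
    - by rewrite !(oppr0, scale0r, bilin0r Ab, bilin0l Ab, bilin0l kb) addr0.
  rewrite !du !dv eqxx addr0 -(bilinDl _ _ _ kb) -(bilinDl _ _ _ Ab).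
  rewrite !(bilinZr _ _ _ Ab, bilinZl _ _ _ Ab) uv vu sq mul_scalar_mx.
  rewrite (bilinZr _ _ _ kb) !scalerA -scalerDl.
  rewrite (bilinZl _ _ _ Ab) amul1a (bilinZl _ _ _ kb) scalerA.
  rewrite -[LHS]/(_ *: rep aone (ket b w)) (ct_rep ct) amul1a.
  by congr (_ *: _); ring.
case: scalar1 => k k0 h.
have stab := dJ_stable
  (@st_rep_linear R A T : linear (rep : A -> B)) (@st_comm_linear R A T)
  (@st_rep_mul R A T) (@st_rep_one R A T) (@st_comm_leibniz R A T).
have {}h : amul (rep (k^-1 *: a) : B) (k *: rep aone) \in
    dJ_pred (rep : A -> B) comm := stab.1 _ _ h.
rewrite (bilinZr _ _ _ (amul_bilin B)) in h.
rewrite (linZ (@st_rep_linear R A T)) (bilinZl _ _ _ (amul_bilin B)) in h.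
rewrite scalerA mulfV// scale1r in h.
by move: h; rewrite (st_rep_one T) (amula1 (a := B)).
Qed.

End CliffordTriple.

(** * Coefficients of one- and two-forms *)

Lemma subsp_valP (K : pzRingType) (V : lmodType K) (S : submodClosed V) :
  linear (@subsp_val K V S).
Proof. by []. Qed.

Section FunctionBimodule.
Variables (K : comPzRingType) (A : algebra K) (I : Type).

Let L (a : A) (f : I -> A) : I -> A := fun i => amul a (f i).
Let R (a : A) (f : I -> A) : I -> A := fun i => amul (f i) a.
Let L_bilin : bilin L.
Proof.
split=> [f|a] k x y; apply/funext => i.
- exact: (bilinPl _ _ _ _ (amul_bilin A)).
- exact: (bilinPr _ _ _ _ (amul_bilin A)).
Qed.
Let R_bilin : bilin R.
Proof.
split=> [f|a] k x y; apply/funext => i.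
- exact: (bilinPr _ _ _ _ (amul_bilin A)).
- exact: (bilinPl _ _ _ _ (amul_bilin A)).
Qed.
Let L1 f : L aone f = f. Proof. by apply/funext => i; exact: amul1a. Qed.
Let R1 f : R aone f = f. Proof. by apply/funext => i; exact: amula1. Qed.
Let LM a b f : L (amul a b) f = L a (L b f).
Proof. by apply/funext => i; rewrite /L amulA. Qed.
Let RM a b f : R (amul a b) f = R b (R a f).
Proof. by apply/funext => i; rewrite /R amulA. Qed.
Let LR a b f : L a (R b f) = R b (L a f).
Proof. by apply/funext => i; rewrite /L /R amulA. Qed.

Definition fun_bimod : bimodule A := Bimodule L_bilin R_bilin L1 R1 LM RM LR.

End FunctionBimodule.
Arguments fun_bimod {K} A I.

Definition bimod_embedding (K : comPzRingType) (A : algebra K)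
    (M W : bimodule A) (f : M -> W) : Prop :=
  [/\ linear f, forall m, f m = 0 -> m = 0,
      forall a m, f (lact a m) = lact a (f m) &
      forall a m, f (ract a m) = ract a (f m)].

Section Coefficients.
Variables (K : fieldType) (A : algebra K) (J : Type) (del : J -> A -> A).

(** The coefficients of a[D, b] and those of a[D, b][D, c], the latter
    antisymmetrised because their symmetric part is junk. *)
Definition form1_coef (p : A * A) : J -> A := fun j => amul p.1 (del j p.2).
Definition form2_coef (p : A * A * A) : J * J -> A := fun jk =>
  amul (amul p.1.1 (del jk.1 p.1.2)) (del jk.2 p.2) -
  amul (amul p.1.1 (del jk.2 p.1.2)) (del jk.1 p.2).

Lemma form2_coefE x y z j k : form2_coef (x, y, z) (j, k) =
  amul (amul x (del j y)) (del k z) - amul (amul x (del k y)) (del j z).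
Proof. by []. Qed.

Let Ab := amul_bilin A.
Hypothesis del_linear : forall j, linear (del j).

Lemma form2_coefD1 x x' y z :
  form2_coef (x + x', y, z) = form2_coef (x, y, z) + form2_coef (x', y, z).
Proof.
apply/funext => -[j k]; rewrite form2_coefE !(bilinDl _ _ _ Ab).
by rewrite opprD addrACA.
Qed.

Lemma form2_coefD2 x y y' z :
  form2_coef (x, y + y', z) = form2_coef (x, y, z) + form2_coef (x, y', z).
Proof.
apply/funext => -[j k]; rewrite form2_coefE !(linD (del_linear _)).
by rewrite !(bilinDr _ _ _ Ab) !(bilinDl _ _ _ Ab) opprD addrACA.
Qed.

Lemma form2_coefD3 x y z z' :
  form2_coef (x, y, z + z') = form2_coef (x, y, z) + form2_coef (x, y, z').
Proof.
apply/funext => -[j k]; rewrite form2_coefE !(linD (del_linear _)).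
by rewrite !(bilinDr _ _ _ Ab) opprD addrACA.
Qed.

End Coefficients.

Section QuotientActions.
Variables (K : comPzRingType) (A : algebra K) (M : bimodule A).
Variables (S : submodClosed M) (stabS : bistable S).

Lemma quotbimod_lactE a m :
  lact a (qproj S m : quotbimod stabS) = qproj S (lact a m).
Proof.
apply/qproj_eq.
rewrite -(bilinNr (lact_bilin M)) -(bilinDr _ _ _ (lact_bilin M)).
by apply: stabS.1; apply/qproj_eq; rewrite /qproj reprK.
Qed.

Lemma quotbimod_ractE a m :
  ract a (qproj S m : quotbimod stabS) = qproj S (ract a m).
Proof.
apply/qproj_eq.
rewrite -(bilinNr (ract_bilin M)) -(bilinDr _ _ _ (ract_bilin M)).
by apply: stabS.2; apply/qproj_eq; rewrite /qproj reprK.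
Qed.

End QuotientActions.

(** f identifies M with the space of functions I -> A spanned by the families
    coef p. *)
Definition coefficient_map (K : comPzRingType) (A : algebra K) (M : bimodule A)
    (I G : Type) (coef : G -> I -> A) (f : M -> fun_bimod A I) : Prop :=
  [/\ bimod_embedding f,
      forall x, exists s : seq G, f x = \sum_(p <- s) coef p &
      forall p, exists x, f x = coef p].

Section CoefficientMaps.
Variables (R : realType) (A : algebra R[i]) (T : spectral_triple A).
Variables (J : finType) (del : J -> A -> A) (m : nat).
Variables (M : J -> 'M[R[i]]_m) (ket : A -> 'cV[R[i]]_m -> st_hilb T).
Hypotheses (dd : lie_derivations del) (ct : clifford_triple del M ket).

Local Notation B := (bop_alg (st_hilb T)).
Local Notation rep := (@st_rep R A T).
Local Notation comm := (@st_comm R A T).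

Lemma Omega1_coefficients : exists f : Omega1_D T -> fun_bimod A J,
  coefficient_map (form1_coef del) f.
Proof.
have total (x : Omega1_D T) : exists c : J -> A,
    has_symbol ket M (subsp_val x) c /\
    exists s, c = \sum_(p <- s) form1_coef del p.
  have /asboolP[s ->] := valP x.
  exists (\sum_(p <- s) form1_coef del p); split; last by exists s.
  have -> : \sum_(p <- s) form1_coef del p =
      (fun j => \sum_(p <- s) amul p.1 (del j p.2)).
    by apply/funext => j; rewrite fct_sumE.
  exact: Omega1_symbol.
have [f fE] := choice total; exists f; split.
- split=> [k x y|x x0|a x|a x].
  + have h := has_symbolP ct k (fE x).1 (fE y).1.
    have := (fE (k *: x + y)).1.
    rewrite [subsp_val _](subsp_valP k x y) => h'.
    exact: (symbol1_unique ct h' h).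
  + apply: val_inj; apply: (bop_ket_eq ct) => b u.
    rewrite (fE x).1 x0; symmetry; exact: (has_symbol0 ct M b u).
  + have h : has_symbol ket M (amul (rep a : B) (subsp_val x)) (f (lact a x)).
      exact: (fE (lact a x)).1.
    exact: (symbol1_unique ct h (has_symbol_lmul ct a (fE x).1)).
  + have h : has_symbol ket M (amul (subsp_val x) (rep a : B)) (f (ract a x)).
      exact: (fE (ract a x)).1.
    exact: (symbol1_unique ct h (has_symbol_rmul ct a (fE x).1)).
- by move=> x; have [_] := fE x.
- move=> p.
  have mem : amul (rep p.1 : B) (comm p.2) \in Omega1_pred (rep : A -> B) comm.
    by apply/asboolP; exists [:: p]; rewrite big_seq1.
  exists (SubSp mem); apply: (symbol1_unique ct (fE _).1).
  exact: (has_symbol_lmul ct p.1 (has_symbol_comm dd ct p.2)).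
Qed.

Local Notation M2 := (fun p : J * J => M p.1 *m M p.2).
Local Notation antisym := (fun (c : J * J -> A) (p : J * J) => c p - c (p.2, p.1)).

(** The class of X is sent to the antisymmetric part of any of its symbols; by
    the description of the junk forms this forgets exactly the junk. *)
Lemma Omega2_coefficients : exists f : Omega2_D T -> fun_bimod A (J * J)%type,
  coefficient_map (form2_coef del) f.
Proof.
pose P2 := piOmega2 (@st_rep_linear R A T : linear (rep : A -> B))
  (@st_rep_mul R A T) (@st_rep_one R A T) (@st_comm_leibniz R A T).
pose cls : P2 -> Omega2_D T := fun X => qproj _ X.
pose rel (x : Omega2_D T) (w : J * J -> A) := exists X c,
  [/\ x = cls X, has_symbol ket M2 (subsp_val X) c & w = antisym c].
have uniq x w w' : rel x w -> rel x w' -> w = w'.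
  move=> [X [c [-> hX ->]]] [Y [d [/qproj_eq XY hY ->]]].
  have [a /= Xa] := (dJ_predE dd ct _).1 XY.
  have [j0 [r [_ hrep]]] := has_symbol_rep dd ct.
  have XE : subsp_val X = 1 *: rep a + subsp_val Y.
    by rewrite scale1r -Xa subrK.
  have hX' := has_symbolP ct 1 (hrep a) hY; rewrite -XE in hX'.
  apply/funext => -[j k] /=; rewrite (symbol2_unique ct hX hX' j k).
  rewrite !scale1r !xpair_eqE [(k == j0) && _]andbC.
  by rewrite opprD addrACA subrr add0r.
have relP k x y w w' : rel x w -> rel y w' -> rel (k *: x + y) (k *: w + w').
  move=> [X [c [-> hX ->]]] [Y [d [-> hY ->]]].
  exists (k *: X + Y), (fun i => k *: c i + d i); split.
  - by rewrite /cls qprojD qprojZ.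
  - exact: (has_symbolP ct k hX hY).
  - by apply/funext => p; rewrite /= opprD addrACA -scalerBr.
have relL a x w : rel x w -> rel (lact a x) (fun p => amul a (w p)).
  move=> [X [c [-> hX ->]]].
  exists (lact a X), (fun i => amul a (c i)); split.
  - exact: quotbimod_lactE.
  - exact: (has_symbol_lmul ct a hX).
  - by apply/funext => p; rewrite (bilinDr _ _ _ (amul_bilin A)) (bilinNr (amul_bilin A)).
have relR a x w : rel x w -> rel (ract a x) (fun p => amul (w p) a).
  move=> [X [c [-> hX ->]]].
  exists (ract a X), (fun i => amul (c i) a); split.
  - exact: quotbimod_ractE.
  - exact: (has_symbol_rmul ct a hX).
  - by apply/funext => p; rewrite (bilinDl _ _ _ (amul_bilin A)) (bilinNl (amul_bilin A)).
have total x : exists w, rel x w /\ exists s, w = \sum_(p <- s) form2_coef del p.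
  have [X ->] := qproj_surj x; have /asboolP[s Xs] := valP X.
  have h := piOmega2_symbol dd ct s; rewrite -Xs in h.
  eexists; split; first by exists X; eexists; split; [|exact: h|].
  exists s; apply/funext => p; rewrite fct_sumE -sumrB.
  by apply: eq_bigr => q _.
have [f fE] := choice total; exists f; split.
- split=> [k x y|x x0|a x|a x].
  + exact: (uniq _ _ _ (fE _).1 (relP k _ _ _ _ (fE x).1 (fE y).1)).
  + have [[X [c [xE hX e]]] _] := fE x.
    rewrite xE -[RHS](qproj0 _); apply/qproj_eq; rewrite subr0.
    apply/(dJ_predE dd ct); apply: (symmetric_symbol ct hX) => j k.
    have /(congr1 (fun g => g (j, k))) /= := e; rewrite x0 => /esym/eqP.
    by rewrite subr_eq0 => /eqP.
  + exact: (uniq _ _ _ (fE _).1 (relL a _ _ (fE x).1)).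
  + exact: (uniq _ _ _ (fE _).1 (relR a _ _ (fE x).1)).
- by move=> x; have [_] := fE x.
- move=> p; pose X := amul (amul (rep p.1.1 : B) (comm p.1.2)) (comm p.2).
  have mem : X \in piOmega2_pred (rep : A -> B) comm.
    by apply/asboolP; exists [:: p]; rewrite big_seq1.
  exists (cls (SubSp mem)); apply: (uniq _ _ _ (fE _).1).
  exists (SubSp mem), (fun jk => amul (amul p.1.1 (del jk.1 p.1.2)) (del jk.2 p.2)).
  split=> //.
  exact: (has_symbol_mul (has_symbol_lmul ct p.1.1 (has_symbol_comm dd ct p.1.2))
    (has_symbol_comm dd ct p.2)).
Qed.

End CoefficientMaps.

(** * Products of triples of Clifford type *)

Section TensorMap.
Variables (K : comPzRingType) (U V U' V' : lmodType K).
Variables (f : U -> U') (g : V -> V').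

Definition tmap : tens U V -> tens U' V' := tlift (fun u v => tpair (f u) (g v)).

Hypotheses (lf : linear f) (lg : linear g).

Lemma tmap_bilin : bilin (fun u v => tpair (f u) (g v)).
Proof.
have tb := tpair_bilin U' V'.
by split=> [v|u] k a b; rewrite ?lf ?lg (bilinPl, bilinPr).
Qed.

Lemma tmap_linear : linear tmap.
Proof. exact: tlift_linear tmap_bilin. Qed.

Lemma tmap_pair u v : tmap (tpair u v) = tpair (f u) (g v).
Proof. by rewrite /tmap tlift_pair//; exact: tmap_bilin. Qed.

End TensorMap.

Lemma lin_id (K : pzRingType) (V : lmodType K) : linear (@id V).
Proof. by []. Qed.

Lemma ld_one (K : fieldType) (A : algebra K) (J : finType) (del : J -> A -> A) :
  lie_derivations del -> forall j, del j aone = 0.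
Proof.
move=> dd j; have := ld_leibniz dd j aone aone.
by rewrite !(amul1a, amula1) -[LHS]addr0 => /addrI/esym.
Qed.

Lemma talg_mul_pair (K : comPzRingType) (A1 A2 : algebra K) a b a' b' :
  amul (tpair a b : talg A1 A2) (tpair a' b') = tpair (amul a a') (amul b b').
Proof. by apply: tact_pair; exact: amul_bilin. Qed.

Section ProductDerivations.
Variables (K : fieldType) (A1 A2 : algebra K) (J1 J2 : finType).
Variables (del1 : J1 -> A1 -> A1) (del2 : J2 -> A2 -> A2).

Definition prod_del (j : J1 + J2) : talg A1 A2 -> talg A1 A2 :=
  match j with inl j => tmap (del1 j) id | inr k => tmap id (del2 k) end.

Hypotheses (dd1 : lie_derivations del1) (dd2 : lie_derivations del2).

Lemma prod_del_pair j a b : prod_del j (tpair a b) =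
  match j with inl j => tpair (del1 j a) b | inr k => tpair a (del2 k b) end.
Proof.
by case: j => j; rewrite [LHS]tmap_pair//;
  first [exact: (ld_linear dd1)|exact: (ld_linear dd2)|exact: lin_id].
Qed.

Lemma prod_del_linear j : linear (prod_del j).
Proof.
by case: j => j; apply: tmap_linear;
  first [exact: (ld_linear dd1)|exact: (ld_linear dd2)|exact: lin_id].
Qed.

Lemma prod_lie_derivations : lie_derivations prod_del.
Proof.
have lin := prod_del_linear; have mb := amul_bilin (talg A1 A2).
have tb := tpair_bilin A1 A2.
split=> //.
- move=> j x y; elim/tens_ind: x => [a b|x x' hx hx']; last first.
    rewrite (bilinDl _ _ _ mb) !(linD (lin j)) hx hx' !(bilinDl _ _ _ mb).
    by rewrite addrACA.
  elim/tens_ind: y => [a' b'|y y' hy hy']; last first.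
    rewrite (bilinDr _ _ _ mb) !(linD (lin j)) hy hy' !(bilinDr _ _ _ mb).
    by rewrite addrACA.
  rewrite talg_mul_pair !prod_del_pair; case: j => j; rewrite !talg_mul_pair.
  + by rewrite (ld_leibniz dd1) (bilinDl _ _ _ tb).
  + by rewrite (ld_leibniz dd2) (bilinDr _ _ _ tb).
- have [c1 br1] := ld_bracket dd1; have [c2 br2] := ld_bracket dd2.
  exists (fun j k l => match j, k, l with
    | inl j, inl k, inl l => c1 j k l
    | inr j, inr k, inr l => c2 j k l
    | _, _, _ => 0 end) => j k x.
  elim/tens_ind: x => [a b|x y hx hy]; last first.
    rewrite !(linD (lin j)) !(linD (lin k)) !(linD (lin j)).
    rewrite opprD addrACA hx hy -big_split; apply: eq_bigr => l _ /=.
    by rewrite (linD (lin l)) scalerDr.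
  rewrite big_sumType; case: j k => j [] k; rewrite !prod_del_pair.
  + rewrite [X in _ = _ + X]big1 ?addr0 => [|l _]; last by rewrite scale0r.
    rewrite -(bilinNl tb) -(bilinDl _ _ _ tb) br1 (bilin_suml tb).
    by apply: eq_bigr => l _; rewrite prod_del_pair (bilinZl _ _ _ tb).
  + by rewrite subrr [X in _ = X + _]big1 ?add0r ?big1// => l _; rewrite scale0r.
  + by rewrite subrr [X in _ = X + _]big1 ?add0r ?big1// => l _; rewrite scale0r.
  + rewrite [X in _ = X + _]big1 ?add0r => [|l _]; last by rewrite scale0r.
    rewrite -(bilinNr tb) -(bilinDr _ _ _ tb) br2 (bilin_sumr tb).
    by apply: eq_bigr => l _; rewrite prod_del_pair (bilinZr _ _ _ tb).
- have [j0 [u [v [r [r0 uv vu du dv]]]]] := ld_unitary dd1.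
  exists (inl j0), (tpair u aone), (tpair v aone), r; split=> //.
  + by rewrite talg_mul_pair uv amul1a.
  + by rewrite talg_mul_pair vu amul1a.
  + case=> j; rewrite prod_del_pair; first by rewrite du (bilinZl _ _ _ tb).
    by rewrite (ld_one dd2) (bilin0r tb) scale0r.
  + case=> j; rewrite prod_del_pair; first by rewrite dv (bilinZl _ _ _ tb).
    by rewrite (ld_one dd2) (bilin0r tb) oppr0 scale0r.
Qed.

End ProductDerivations.

Section Approximation.
Variables (R : realType) (H : hilbert R).

Definition approximable (P : H -> Prop) (x : H) :=
  forall e : R, 0 < e -> exists2 y, P y & hnorm (x - y) < e.

Lemma approximableD (P : H -> Prop) : (forall x y, P x -> P y -> P (x + y)) ->
  forall x y, approximable P x -> approximable P y -> approximable P (x + y).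
Proof.
move=> PD x y hx hy e e0; have e4 : 0 < e / 4 by rewrite divr_gt0.
have [x' Px' xx'] := hx _ e4; have [y' Py' yy'] := hy _ e4.
exists (x' + y'); first exact: PD.
rewrite opprD addrACA (le_lt_trans (Defs.hnormD _ _))//.
have := ltrD xx' yy'; lra.
Qed.

Lemma approximable_trans (P Q : H -> Prop) : (forall y, Q y -> approximable P y) ->
  forall x, approximable Q x -> approximable P x.
Proof.
move=> QP x hx e e0; have e4 : 0 < e / 4 by rewrite divr_gt0.
have [y Qy xy] := hx _ e4; have [z Pz yz] := QP y Qy _ e4.
exists z => //; rewrite -(subrKA y) (le_lt_trans (Defs.hnormD _ _))//.
have := ltrD xy yz; lra.
Qed.

End Approximation.

Lemma hnorm_tensor (R : realType) (H1 H2 H : hilbert R) (t : H1 -> H2 -> H) :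
  (forall u v u' v', hdot (t u v) (t u' v') = hdot u u' * hdot v v') ->
  forall u v, hnorm (t u v) = hnorm u * hnorm v.
Proof.
move=> ht u v; rewrite /hnorm ht -sqrtrM; last first.
  by have := hdot_ge0 u; rewrite lecE => /andP[].
congr Num.sqrt; have := hdot_ge0 u; have := hdot_ge0 v.
case: (hdot u u) => a b; case: (hdot v v) => c d; rewrite !lecE /=.
by move=> /andP[/eqP-> _] /andP[/eqP-> _]; rewrite mulr0 subr0.
Qed.

Lemma st_D_sum (R : realType) (A : algebra R[i]) (T : spectral_triple A)
    (I : Type) (s : seq I) (k : I -> R[i]) (F : I -> st_hilb T) :
  (forall i, st_dom (F i)) ->
  st_dom (\sum_(i <- s) k i *: F i) /\
  st_D (\sum_(i <- s) k i *: F i) = \sum_(i <- s) k i *: st_D (F i).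
Proof.
move=> dF; elim: s => [|i s [d e]].
  rewrite !big_nil; split; first exact: st_dom0.
  have := @st_D_linear R A T (-1) 0 0 (st_dom0 T) (st_dom0 T).
  by rewrite scaler0 addr0 scaleN1r addNr.
by rewrite !big_cons; split; [exact: st_dom_lin|rewrite st_D_linear// e].
Qed.

Section TensorMatrices.
Variables (C : comPzRingType) (m1 m2 : nat).

Lemma tensmxNl (P : 'M[C]_m1) (Q : 'M[C]_m2) : (- P) *t Q = - (P *t Q).
Proof.
apply/matrixP => I I'; case: (mxtens_indexP I) => i k.
by case: (mxtens_indexP I') => i' k'; rewrite tensmxE mxE [RHS]mxE tensmxE mulNr.
Qed.

Lemma tensmxNr (P : 'M[C]_m1) (Q : 'M[C]_m2) : P *t (- Q) = - (P *t Q).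
Proof.
apply/matrixP => I I'; case: (mxtens_indexP I) => i k.
case: (mxtens_indexP I') => i' k'.
by rewrite tensmxE [X in _ * X]mxE [RHS]mxE tensmxE mulrN.
Qed.

Lemma tensmx_scalar (x y : C) :
  (x%:M : 'M[C]_m1) *t (y%:M : 'M[C]_m2) = (x * y)%:M.
Proof.
apply/matrixP => I I'; case: (mxtens_indexP I) => i k.
case: (mxtens_indexP I') => i' k'; rewrite tensmxE !mxE.
rewrite (can_eq (@mxtens_indexK m1 m2)) xpair_eqE.
by case: (i == i'); case: (k == k'); rewrite /= ?mulr1n ?mulr0n ?mulr0 ?mul0r.
Qed.

End TensorMatrices.

Section ProductTriple.
Variables (R : realType) (A1 A2 : algebra R[i]).
Variables (T1 : spectral_triple A1) (T2 : spectral_triple A2).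
Variables (J1 J2 : finType) (m1 m2 : nat).
Variables (del1 : J1 -> A1 -> A1) (del2 : J2 -> A2 -> A2).
Variables (M1 : J1 -> 'M[R[i]]_m1) (M2 : J2 -> 'M[R[i]]_m2).
Variables (ket1 : A1 -> 'cV[R[i]]_m1 -> st_hilb T1).
Variables (ket2 : A2 -> 'cV[R[i]]_m2 -> st_hilb T2).
Hypotheses (ct1 : clifford_triple del1 M1 ket1) (ct2 : clifford_triple del2 M2 ket2).
Hypotheses (dd1 : lie_derivations del1) (dd2 : lie_derivations del2).
Variables (gamma : bop (st_hilb T1)) (Gamma : 'M[R[i]]_m1).
Hypothesis gamma_ket : forall a u, gamma (ket1 a u) = ket1 a (Gamma *m u).
Variables (g : R[i]).
Hypotheses (g_neq0 : g != 0) (Gamma_sq : Gamma *m Gamma = g%:M).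
Hypothesis Gamma_anti : forall j, Gamma *m M1 j = - (M1 j *m Gamma).
Variables (T : spectral_triple (talg A1 A2)).
Variable t : st_hilb T1 -> st_hilb T2 -> st_hilb T.
Hypotheses (tb : bilin t)
  (t_dot : forall u v u' v', hdot (t u v) (t u' v') = hdot u u' * hdot v v')
  (t_dense : hdense (fun x => exists s : seq (st_hilb T1 * st_hilb T2),
        x = \sum_(p <- s) t p.1 p.2))
  (t_rep : forall a b u v, st_rep T (tpair a b) (t u v) =
        t (st_rep T1 a u) (st_rep T2 b v))
  (t_D : forall u v, st_dom u -> st_dom v -> st_dom (t u v) /\
        st_D (t u v) = t (st_D u) v + t (gamma u) (st_D v)).

Let kb1 := ct_bilin ct1.
Let kb2 := ct_bilin ct2.
Let e1 (i : 'I_m1) : 'cV[R[i]]_m1 := delta_mx i 0.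
Let e2 (i : 'I_m2) : 'cV[R[i]]_m2 := delta_mx i 0.
Let fst_idx (I : 'I_(m1 * m2)) : 'I_m1 := (mxtens_unindex I).1.
Let snd_idx (I : 'I_(m1 * m2)) : 'I_m2 := (mxtens_unindex I).2.

Definition prod_matrix (j : J1 + J2) : 'M[R[i]]_(m1 * m2) :=
  match j with inl j => M1 j *t 1%:M | inr k => Gamma *t M2 k end.

Lemma prod_anticommuting : exists s, anticommuting_family prod_matrix s.
Proof.
have [s1 [n1 q1 a1]] := ct_anticommuting ct1.
have [s2 [n2 q2 a2]] := ct_anticommuting ct2.
exists (fun j => match j with inl j => s1 j | inr k => g * s2 k end); split.
- by case=> j; rewrite ?mulf_neq0.
- case=> j; rewrite /= tensmx_mul; first by rewrite q1 mul1mx tensmx_scalar mulr1.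
  by rewrite Gamma_sq q2 tensmx_scalar.
- case=> j [] k jk; rewrite /= !tensmx_mul.
  + by rewrite a1// tensmxNl.
  + by rewrite mul1mx mulmx1 Gamma_anti tensmxNl opprK.
  + by rewrite Gamma_anti tensmxNl mul1mx mulmx1.
  + by rewrite a2// tensmxNr.
Qed.

Let basis_bilin I : bilin (fun a b => t (ket1 a (e1 (fst_idx I))) (ket2 b (e2 (snd_idx I)))).
Proof.
split=> [b|a] k x y.
- by rewrite (bilinPl _ _ _ _ kb1) (bilinPl _ _ _ _ tb).
- by rewrite (bilinPl _ _ _ _ kb2) (bilinPr _ _ _ _ tb).
Qed.

Let basis_ket (I : 'I_(m1 * m2)) : talg A1 A2 -> st_hilb T :=
  tlift (fun a b => t (ket1 a (e1 (fst_idx I))) (ket2 b (e2 (snd_idx I)))).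

Let basis_linear I : linear (basis_ket I).
Proof. exact: tlift_linear (basis_bilin I). Qed.

(** The vector x (x) w, expanded in the basis of C^m1 (x) C^m2, because t is
    only given on pairs of vectors. *)
Definition prod_ket (x : talg A1 A2) (w : 'cV[R[i]]_(m1 * m2)) : st_hilb T :=
  \sum_I w I 0 *: basis_ket I x.

Lemma prod_ket_bilin : bilin prod_ket.
Proof.
split=> [w|x] k a b; rewrite /prod_ket scaler_sumr -big_split; apply: eq_bigr => I _ /=.
- by rewrite basis_linear scalerDr !scalerA mulrC.
- by rewrite !mxE scalerDl scalerA.
Qed.
Let pkb := prod_ket_bilin.

Let prod_ket_pair a b w : prod_ket (tpair a b) w =
  \sum_I w I 0 *: t (ket1 a (e1 (fst_idx I))) (ket2 b (e2 (snd_idx I))).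
Proof.
by apply: eq_bigr => I _; rewrite /basis_ket tlift_pair//; exact: basis_bilin.
Qed.

Let t_ket a b u v : t (ket1 a u) (ket2 b v) =
  \sum_I (u (fst_idx I) 0 * v (snd_idx I) 0) *:
    t (ket1 a (e1 (fst_idx I))) (ket2 b (e2 (snd_idx I))).
Proof.
rewrite {1}[u]cV_sum_delta {1}[v]cV_sum_delta (bilin_sumr kb1) (bilin_sumr kb2).
rewrite (bilin_suml tb); under eq_bigr do rewrite (bilin_sumr tb).
rewrite pair_big (reindex (@mxtens_unindex m1 m2)) /=; last first.
  by exists (@mxtens_index m1 m2) => p _; rewrite (mxtens_indexK, mxtens_unindexK).
apply: eq_bigr => I _.
rewrite (bilinZr _ _ _ kb1) (bilinZr _ _ _ kb2).
by rewrite (bilinZl _ _ _ tb) (bilinZr _ _ _ tb) scalerA.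
Qed.

Let prod_ket_tens a b (P : 'M[R[i]]_m1) (Q : 'M[R[i]]_m2) w :
  prod_ket (tpair a b) (P *t Q *m w) =
  \sum_I w I 0 *: t (ket1 a (P *m e1 (fst_idx I))) (ket2 b (Q *m e2 (snd_idx I))).
Proof.
rewrite prod_ket_pair; under [RHS]eq_bigr do rewrite t_ket scaler_sumr.
rewrite exchange_big; apply: eq_bigr => I _ /=.
rewrite mxE scaler_suml; apply: eq_bigr => I' _; rewrite scalerA; congr (_ *: _).
have colE n (N : 'M[R[i]]_n) i i' : (N *m (delta_mx i 0 : 'cV[R[i]]_n)) i' 0 = N i' i.
  rewrite mxE (bigD1 i)//= big1 ?addr0 => [|j ji]; rewrite mxE.
    by rewrite !eqxx mulr1.
  by rewrite (negPf ji) mulr0.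
by rewrite !colE mulrC /tensmx mxE.
Qed.

Lemma prod_ket_dot : exists q : talg A1 A2 -> talg A1 A2 -> R[i], forall x y u v,
  hdot (prod_ket x u) (prod_ket y v) = q x y * \sum_i (u i 0)^*%C * v i 0.
Proof.
have m_gt0 : (0 < m1 * m2)%N by rewrite muln_gt0 (ct_gt0 ct1) (ct_gt0 ct2).
pose I0 := Ordinal m_gt0.
exists (fun x y => hdot (basis_ket I0 x) (basis_ket I0 y)).
suff basis_dot I I' x y : hdot (basis_ket I x) (basis_ket I' y) =
    hdot (basis_ket I0 x) (basis_ket I0 y) * (I == I')%:R.
  move=> x y u v; rewrite /prod_ket hdot_suml mulr_sumr; apply: eq_bigr => I _.
  rewrite hdotZl hdot_sumr (bigD1 I)//= big1 ?addr0 => [|I' I'I].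
    rewrite (linZ (hdot_linearr _)) basis_dot eqxx mulr1.
    by rewrite -[v I 0 *: _]/(v I 0 * _); ring.
  by rewrite (linZ (hdot_linearr _)) basis_dot eq_sym (negPf I'I) mulr0 scaler0.
elim/tens_ind: x => [a b|x x' hx hx']; last first.
  by rewrite !(linD (@basis_linear _)) !hdotDl hx hx' mulrDl.
elim/tens_ind: y => [a' b'|y y' hy hy']; last first.
  rewrite !(linD (@basis_linear _)) !(linD (hdot_linearr _)) hy hy'.
  by rewrite mulrDl.
rewrite /basis_ket !tlift_pair; try exact: basis_bilin.
rewrite !t_dot; have [q1 hq1] := ct_dot ct1; have [q2 hq2] := ct_dot ct2.
have dotE n (i i' : 'I_n) :
    \sum_(l < n) ((delta_mx i 0 : 'cV[R[i]]_n) l 0)^*%C *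
      (delta_mx i' 0 : 'cV[R[i]]_n) l 0 = (i == i')%:R.
  rewrite (bigD1 i)//= big1 ?addr0 => [|l il].
    by rewrite !mxE !eqxx !andbT conjc1 mul1r.
  by rewrite !mxE (negPf il) conjc0 mul0r.
rewrite !hq1 !hq2 !dotE !eqxx !mulr1 mulrACA; congr (_ * _).
case: (mxtens_indexP I) => i k; case: (mxtens_indexP I') => i' k'.
rewrite (can_eq (@mxtens_indexK m1 m2)) xpair_eqE /fst_idx /snd_idx !mxtens_indexK.
by rewrite -natrM mulnb.
Qed.

Let span : st_hilb T -> Prop := fun x =>
  exists s : seq (talg A1 A2 * 'cV_(m1 * m2)), x = \sum_(p <- s) prod_ket p.1 p.2.

Let spanD x y : span x -> span y -> span (x + y).
Proof. by move=> [s ->] [r ->]; exists (s ++ r); rewrite big_cat. Qed.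

Let span_sum (I : Type) (s : seq I) (F : I -> st_hilb T) :
  (forall i, span (F i)) -> span (\sum_(i <- s) F i).
Proof.
move=> h; elim: s => [|i s ih]; first by rewrite big_nil; exists [::]; rewrite big_nil.
by rewrite big_cons; exact: spanD.
Qed.

(** In t u v, first u and then v is replaced by a sum of kets; the second
    precision depends on the norm of the first approximation. *)
Lemma prod_ket_dense : hdense span.
Proof.
have tN := hnorm_tensor t_dot.
suff tspan u v : approximable span (t u v).
  move=> x; apply: (approximable_trans (P := span) _ (t_dense x)) => _ [s ->].
  elim: s => [|p s ih]; last by rewrite big_cons; exact: approximableD.
  rewrite big_nil => e e0; exists 0; first by exists [::]; rewrite big_nil.
  by rewrite subrr -(scale0r 0) Defs.hnormZ normr0 mul0r.
have small x (e : R) : 0 <= x -> 0 < e -> exists2 d, 0 < d & d * x < e.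
  move=> x0 e0; exists (e / (x + 1)); first by rewrite divr_gt0// ltr_wpDl.
  by rewrite mulrAC ltr_pdivrMr ?ltr_wpDl// ltr_pM2l// ltrDl.
have n0 (H : prehilbert R) (x : H) : 0 <= hnorm x by exact: sqrtr_ge0.
apply: (approximable_trans (Q := fun x => exists s v,
    x = t (\sum_(p <- s) ket1 p.1 p.2) v)) => [_ [s [{}v ->]] e e0|e e0].
  set u' := \sum_(p <- s) _.
  have [d d0 de] := small _ _ (n0 _ u') e0.
  have [_ [r ->] hr] := ct_dense ct2 v d0.
  exists (t u' (\sum_(p <- r) ket2 p.1 p.2)).
    rewrite (bilin_suml tb); apply: span_sum => p.
    rewrite (bilin_sumr tb); apply: span_sum => q.
    exists [:: (tpair p.1 q.1, \col_I (p.2 (fst_idx I) 0 * q.2 (snd_idx I) 0))].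
    rewrite big_seq1 prod_ket_pair t_ket; apply: eq_bigr => I _.
    by rewrite mxE.
  rewrite -(bilinNr tb) -(bilinDr _ _ _ tb) tN mulrC.
  by rewrite (le_lt_trans _ de)// ler_wpM2r// ltW.
have [d d0 de] := small _ _ (n0 _ v) e0.
have [_ [r ->] hr] := ct_dense ct1 u d0.
exists (t (\sum_(p <- r) ket1 p.1 p.2) v); first by exists r, v.
rewrite -(bilinNl tb) -(bilinDl _ _ _ tb) tN.
by rewrite (le_lt_trans _ de)// ler_wpM2r// ltW.
Qed.

Lemma prod_ket_rep x y w : st_rep T x (prod_ket y w) = prod_ket (amul x y) w.
Proof.
have mb := amul_bilin (talg A1 A2).
elim/tens_ind: x => [a b|x x' hx hx']; last first.
  rewrite (linD (@st_rep_linear _ _ T)) (bilinDl _ _ _ mb) (bilinDl _ _ _ pkb).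
  by rewrite -hx -hx'.
elim/tens_ind: y => [a' b'|y y' hy hy']; last first.
  rewrite (bilinDr _ _ _ mb) !(bilinDl _ _ _ pkb) -hy -hy'.
  exact: (linD (@bop_linear _ _ (st_rep T (tpair a b)))).
rewrite talg_mul_pair !prod_ket_pair.
rewrite (lin_sum (@bop_linear _ _ (st_rep T (tpair a b)))); apply: eq_bigr => I _.
rewrite (linZ (@bop_linear _ _ (st_rep T (tpair a b)))) t_rep.
by rewrite (ct_rep ct1) (ct_rep ct2).
Qed.

Lemma prod_ket_D x w : st_dom (prod_ket x w) /\
  st_D (prod_ket x w) = \sum_j prod_ket (prod_del del1 del2 j x) (prod_matrix j *m w).
Proof.
elim/tens_ind: x => [a b|x y [dx hx] [dy hy]]; last first.
  rewrite (bilinDl _ _ _ pkb) -[prod_ket x w]scale1r.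
  split; first exact: st_dom_lin.
  rewrite st_D_linear// !scale1r hx hy -big_split; apply: eq_bigr => j _ /=.
  by rewrite (linD (prod_del_linear dd1 dd2 j)) (bilinDl _ _ _ pkb).
pose F (I : 'I_(m1 * m2)) := t (ket1 a (e1 (fst_idx I))) (ket2 b (e2 (snd_idx I))).
have domF I := t_D (ct_D ct1 a (e1 (fst_idx I))).1 (ct_D ct2 b (e2 (snd_idx I))).1.
have [dS DS] := st_D_sum (index_enum 'I_(m1 * m2)) (fun I => w I 0)
  (fun I => (domF I).1).
rewrite prod_ket_pair; split=> //; rewrite DS.
under eq_bigr => I _.
  rewrite (domF I).2 (ct_D ct1 _ _).2 (ct_D ct2 _ _).2 gamma_ket.
  rewrite (bilin_suml tb) (bilin_sumr tb) scalerDr !scaler_sumr.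
  over.
rewrite big_split big_sumType; congr (_ + _); rewrite exchange_big;
  apply: eq_bigr => j _; rewrite (prod_del_pair dd1 dd2) prod_ket_tens.
  by apply: eq_bigr => I _; rewrite mul1mx.
by apply: eq_bigr.
Qed.

Lemma prod_clifford_triple :
  clifford_triple (prod_del del1 del2) prod_matrix prod_ket.
Proof.
split.
- by rewrite muln_gt0 (ct_gt0 ct1) (ct_gt0 ct2).
- exact: prod_anticommuting.
- exact: prod_ket_bilin.
- exact: prod_ket_dot.
- exact: prod_ket_dense.
- exact: prod_ket_rep.
- exact: prod_ket_D.
Qed.

End ProductTriple.

(** * Two-forms on a product *)

Section TensorBimoduleMap.
Variables (K : comPzRingType) (A B : algebra K).
Variables (M : bimodule A) (N : bimodule B) (f : M -> A) (g : N -> B).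
Hypotheses (lf : linear f) (lg : linear g).

Lemma tmap_lact :
  (forall a m, f (lact a m) = amul a (f m)) ->
  (forall b n, g (lact b n) = amul b (g n)) ->
  forall (x : talg A B) (y : tbimod M N),
    tmap f g (lact x y) = amul x (tmap f g y : talg A B).
Proof.
move=> fL gL x y.
have lb := lact_bilin (tbimod M N); have mb := amul_bilin (talg A B).
have tl := tmap_linear lf lg.
elim/tens_ind: x => [a b|x x' hx hx']; last first.
  by rewrite (bilinDl _ _ _ lb) (linD tl) hx hx' (bilinDl _ _ _ mb).
elim/tens_ind: y => [m n|y y' hy hy']; last first.
  by rewrite (bilinDr _ _ _ lb) !(linD tl) hy hy' (bilinDr _ _ _ mb).
rewrite tmap_pair// talg_mul_pair -fL -gL -tmap_pair//.
congr tmap; apply: tact_pair; exact: lact_bilin.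
Qed.

Lemma tmap_ract :
  (forall a m, f (ract a m) = amul (f m) a) ->
  (forall b n, g (ract b n) = amul (g n) b) ->
  forall (x : talg A B) (y : tbimod M N),
    tmap f g (ract x y) = amul (tmap f g y : talg A B) x.
Proof.
move=> fR gR x y.
have rb := ract_bilin (tbimod M N); have mb := amul_bilin (talg A B).
have tl := tmap_linear lf lg.
elim/tens_ind: x => [a b|x x' hx hx']; last first.
  by rewrite (bilinDl _ _ _ rb) (linD tl) hx hx' (bilinDr _ _ _ mb).
elim/tens_ind: y => [m n|y y' hy hy']; last first.
  by rewrite (bilinDr _ _ _ rb) !(linD tl) hy hy' (bilinDl _ _ _ mb).
rewrite tmap_pair// talg_mul_pair -fR -gR -tmap_pair//.
congr tmap; apply: tact_pair; exact: ract_bilin.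
Qed.

End TensorBimoduleMap.

Section TwoFormsOfProduct.
Variables (K : fieldType) (A1 A2 : algebra K) (J1 J2 : finType).
Variables (del1 : J1 -> A1 -> A1) (del2 : J2 -> A2 -> A2).
Hypotheses (dd1 : lie_derivations del1) (dd2 : lie_derivations del2).
Variables (L : Type) (phi : L -> A1 -> K).
Hypotheses (phi_linear : forall l, linear (phi l : A1 -> K^o))
  (phi_separating : forall a, (forall l, phi l a = 0) -> a = 0).

Local Notation J := (J1 + J2)%type.
Local Notation A := (talg A1 A2).
Local Notation pdel := (prod_del del1 del2).

Variables (P1 Q1 : bimodule A1) (P2 Q2 : bimodule A2) (Q : bimodule A).
Variables (f1 : P1 -> fun_bimod A1 J1) (f2 : P2 -> fun_bimod A2 J2).
Variables (h1 : Q1 -> fun_bimod A1 (J1 * J1)) (h2 : Q2 -> fun_bimod A2 (J2 * J2)).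
Variable h : Q -> fun_bimod A (J * J).
Hypotheses (f1_coef : coefficient_map (form1_coef del1) f1)
  (f2_coef : coefficient_map (form1_coef del2) f2)
  (h1_coef : coefficient_map (form2_coef del1) h1)
  (h2_coef : coefficient_map (form2_coef del2) h2)
  (h_coef : coefficient_map (form2_coef pdel) h).

Let eval_linear (V W : lmodType K) (I : Type) (f : V -> I -> W) i :
  linear f -> linear (fun v => f v i).
Proof. by move=> lf k u v; rewrite lf. Qed.

(** Index pairs inside J1 give the first summand, pairs inside J2 the second,
    and mixed pairs the third; the two mixed blocks are opposite. *)
Lemma two_forms_of_product :
  bimodule_iso Q
    (sbimod (sbimod (tbimod Q1 (rbimod A2)) (tbimod (rbimod A1) Q2))
            (tbimod P1 P2)).
Proof.
set N := sbimod _ _.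
have [[f1l f1i f1L f1R] f1s f1g] := f1_coef.
have [[f2l f2i f2L f2R] f2s f2g] := f2_coef.
have [[h1l h1i h1L h1R] h1s h1g] := h1_coef.
have [[h2l h2i h2L h2R] h2s h2g] := h2_coef.
have [[hl hi hL hR] hs hg] := h_coef.
pose B11 (jk : J1 * J1) (x : tens Q1 A2) : A := tmap (fun u => h1 u jk) id x.
pose B22 (jk : J2 * J2) (x : tens A1 Q2) : A := tmap id (fun u => h2 u jk) x.
pose B12 j k (x : tens P1 P2) : A :=
  tmap (fun u => f1 u j) (fun u => f2 u k) x.
pose F (r : N) : fun_bimod A (J * J) := fun jk => match jk with
  | (inl j, inl k) => B11 (j, k) r.1.1
  | (inr j, inr k) => B22 (j, k) r.1.2
  | (inl j, inr k) => B12 j k r.2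
  | (inr j, inl k) => - B12 k j r.2 end.
have B11l jk : linear (B11 jk).
  exact: tmap_linear (eval_linear jk h1l) (@lin_id _ _).
have B22l jk : linear (B22 jk).
  exact: tmap_linear (@lin_id _ _) (eval_linear jk h2l).
have B12l j k : linear (B12 j k).
  exact: tmap_linear (eval_linear j f1l) (eval_linear k f2l).
have Ab := amul_bilin A.
have FE11 x y z j k : F (x, y, z) (inl j, inl k) = B11 (j, k) x by [].
have FE22 x y z j k : F (x, y, z) (inr j, inr k) = B22 (j, k) y by [].
have FE12 x y z j k : F (x, y, z) (inl j, inr k) = B12 j k z by [].
have FE21 x y z j k : F (x, y, z) (inr j, inl k) = - B12 k j z by [].
have Fl : linear F.
  move=> k x y; apply/funext => -[[j|j] [l|l]]; rewrite /F.
  - exact: B11l.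
  - exact: B12l.
  - by rewrite -[X in - X]/(B12 l j (k *: x.2 + y.2)) B12l opprD -scalerN.
  - exact: B22l.
apply: (bimodule_iso_of_image hl Fl hi _ hL hR).
- move=> [[x y] z] F0.
  have Fjk jk : F (x, y, z) jk = 0 by rewrite F0.
  have -> : x = 0.
    apply: (tens_map_injective (I := (J1 * J1)%type) (J := unit)
      (f := fun jk u => h1 u jk) (g := fun=> id) (phi := phi)) => //.
    + by move=> jk; exact: eval_linear.
    + by move=> u u0; apply: h1i; apply/funext => jk; exact: u0.
    + by move=> v v0; exact: (v0 tt).
    + by move=> [j k] _; exact: (Fjk (inl j, inl k)).
  have -> : y = 0.
    apply: (tens_map_injective (I := unit) (J := (J2 * J2)%type)
      (f := fun=> id) (g := fun jk u => h2 u jk) (phi := phi)) => //.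
    + by move=> jk; exact: eval_linear.
    + by move=> v v0; exact: (v0 tt).
    + by move=> u u0; apply: h2i; apply/funext => jk; exact: u0.
    + by move=> _ [j k]; exact: (Fjk (inr j, inr k)).
  have -> // : z = 0.
  apply: (tens_map_injective (I := J1) (J := J2)
    (f := fun j u => f1 u j) (g := fun j u => f2 u j) (phi := phi)) => //.
  + by move=> j; exact: eval_linear.
  + by move=> j; exact: eval_linear.
  + by move=> u u0; apply: f1i; apply/funext => j; exact: u0.
  + by move=> u u0; apply: f2i; apply/funext => j; exact: u0.
  + by move=> j k; exact: (Fjk (inl j, inr k)).
- move=> a r; apply/funext => -[[j|j] [l|l]]; rewrite /F.
  + apply: (tmap_lact (M := Q1) (N := rbimod A2)) => //; first exact: eval_linear.
    by move=> b u; rewrite h1L.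
  + apply: (tmap_lact (M := P1) (N := P2)); try exact: eval_linear.
      by move=> b u; rewrite f1L.
    by move=> b u; rewrite f2L.
  + apply: etrans (esym (bilinNr Ab _ _)); congr (- _).
    apply: (tmap_lact (M := P1) (N := P2)); try exact: eval_linear.
      by move=> b u; rewrite f1L.
    by move=> b u; rewrite f2L.
  + apply: (tmap_lact (M := rbimod A1) (N := Q2)) => //; first exact: eval_linear.
    by move=> b u; rewrite h2L.
- move=> a r; apply/funext => -[[j|j] [l|l]]; rewrite /F.
  + apply: (tmap_ract (M := Q1) (N := rbimod A2)) => //; first exact: eval_linear.
    by move=> b u; rewrite h1R.
  + apply: (tmap_ract (M := P1) (N := P2)); try exact: eval_linear.
      by move=> b u; rewrite f1R.
    by move=> b u; rewrite f2R.
  + apply: etrans (esym (bilinNl Ab _ _)); congr (- _).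
    apply: (tmap_ract (M := P1) (N := P2)); try exact: eval_linear.
      by move=> b u; rewrite f1R.
    by move=> b u; rewrite f2R.
  + apply: (tmap_ract (M := rbimod A1) (N := Q2)) => //; first exact: eval_linear.
    by move=> b u; rewrite h2R.
- pose imF w := exists r, F r = w.
  have imFD w w' : imF w -> imF w' -> imF (w + w').
    by move=> [r <-] [r' <-]; exists (r + r'); rewrite (linD Fl).
  have imF_sum (s : seq (A * A * A)) : (forall p, imF (form2_coef pdel p)) ->
      imF (\sum_(p <- s) form2_coef pdel p).
    move=> hp; elim: s => [|p s ih]; last by rewrite big_cons; exact: imFD.
    by rewrite big_nil; exists 0; rewrite (lin0 Fl).
  move=> x; have [s ->] := hs x; apply: imF_sum => {x s} -[[x y] z].
  have dl := prod_del_linear dd1 dd2.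
  elim/tens_ind: x => [a a'|x x' hx hx']; last first.
    rewrite form2_coefD1; exact: imFD.
  elim/tens_ind: y => [b b'|y y' hy hy']; last first.
    rewrite (form2_coefD2 dl); exact: imFD.
  elim/tens_ind: z => [c c'|z z' hz hz']; last first.
    rewrite (form2_coefD3 dl); exact: imFD.
  (* On mixed indices, antisymmetrising a product of three pure tensors leaves
     the difference of two products of one-forms. *)
  have [u uE] := h1g (a, b, c); have [u' uE'] := h2g (a', b', c').
  have [v vE] := f1g (a, b); have [v' vE'] := f2g (amul a' b', c').
  have [w wE] := f1g (amul a b, c); have [w' wE'] := f2g (a', b').
  exists ((tpair u (amul (amul a' b') c'), tpair (amul (amul a b) c) u'),
    tpair (ract c v : P1) v' - tpair w (ract c' w' : P2)).
  have B12E j k : B12 j k (tpair (ract c v : P1) v' -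
      tpair w (ract c' w' : P2)) =
      tpair (amul (amul a (del1 j b)) c) (amul (amul a' b') (del2 k c')) -
      tpair (amul (amul a b) (del1 j c)) (amul (amul a' (del2 k b')) c').
    rewrite (linD (B12l j k)) (linN (B12l j k)) /B12.
    rewrite !tmap_pair; try exact: eval_linear.
    by rewrite f1R f2R vE vE' wE wE'.
  apply/funext => -[[j|j] [k|k]]; rewrite form2_coefE ?(FE11, FE12, FE21, FE22).
  + rewrite /B11 tmap_pair//; last exact: eval_linear.
    rewrite uE form2_coefE !(prod_del_pair dd1 dd2) !talg_mul_pair.
    by rewrite (bilinDl _ _ _ (tpair_bilin _ _)) (bilinNl (tpair_bilin _ _)).
  + by rewrite B12E !(prod_del_pair dd1 dd2) !talg_mul_pair.
  + by rewrite B12E opprB !(prod_del_pair dd1 dd2) !talg_mul_pair.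
  + rewrite /B22 tmap_pair//; last exact: eval_linear.
    rewrite uE' form2_coefE !(prod_del_pair dd1 dd2) !talg_mul_pair.
    by rewrite (bilinDr _ _ _ (tpair_bilin _ _)) (bilinNr (tpair_bilin _ _)).
(* When each differentiated entry is b (x) 1 or 1 (x) b, the coefficients are
   confined to one summand, since derivations kill the unit. *)
- pose imh w := exists x, h x = w.
  have imhD w w' : imh w -> imh w' -> imh (w + w').
    by move=> [x <-] [x' <-]; exists (x + x'); rewrite (linD hl).
  have imh_sum (I : Type) (s : seq I) (G : I -> J * J -> A) :
      (forall p, imh (G p)) -> imh (\sum_(p <- s) G p).
    move=> hp; elim: s => [|p s ih]; last by rewrite big_cons; exact: imhD.
    by rewrite big_nil; exists 0; rewrite (lin0 hl).
  have d1 j : del1 j aone = 0 := ld_one dd1 j.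
  have d2 j : del2 j aone = 0 := ld_one dd2 j.
  have tb := tpair_bilin A1 A2.
  have ab1 := amul_bilin A1; have ab2 := amul_bilin A2.
  move=> [[x y] z]; have -> : F (x, y, z) = F (x, 0, 0) + F (0, y, 0) + F (0, 0, z).
    rewrite -!(linD Fl) -[X in _ = F X]/(x + 0 + 0, 0 + y + 0, 0 + 0 + z).
    by rewrite !addr0 !add0r.
  have F0 : F 0 = 0 := lin0 Fl.
  apply: (imhD _ _); first apply: (imhD _ _).
  + elim/tens_ind: x => [u a'|x x' hx hx']; last first.
      have -> : F (x + x', 0, 0) = F (x, 0, 0) + F (x', 0, 0).
        by rewrite -(linD Fl) -[X in _ = F X]/(x + x', 0 + 0, 0 + 0) !addr0.
      exact: imhD.
    have [s us] := h1s u.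
    have -> : F (tpair u a', 0, 0) = \sum_(p <- s)
        form2_coef pdel (tpair p.1.1 a', tpair p.1.2 aone, tpair p.2 aone).
      apply/funext => -[[j|j] [k|k]]; rewrite fct_sumE ?(FE11, FE12, FE21, FE22);
        under [RHS]eq_bigr do rewrite form2_coefE.
      * rewrite /B11 tmap_pair//; last exact: eval_linear.
        rewrite us fct_sumE (bilin_suml tb); apply: eq_bigr => p _.
        rewrite !(prod_del_pair dd1 dd2) !talg_mul_pair !amula1.
        by rewrite (bilinDl _ _ _ tb) (bilinNl tb).
      * rewrite (lin0 (B12l j k)) big1// => p _.
        rewrite !(prod_del_pair dd1 dd2) !talg_mul_pair d2.
        by rewrite !(bilin0r ab2, bilin0l ab2, bilin0r tb) subr0.
      * rewrite (lin0 (B12l k j)) oppr0 big1// => p _.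
        rewrite !(prod_del_pair dd1 dd2) !talg_mul_pair d2.
        by rewrite !(bilin0r ab2, bilin0l ab2, bilin0r tb) subr0.
      * rewrite (lin0 (B22l (j, k))) big1// => p _.
        rewrite !(prod_del_pair dd1 dd2) !talg_mul_pair !d2.
        by rewrite !(bilin0r ab2, bilin0l ab2, bilin0r tb) subr0.
    by apply: imh_sum => p; exact: hg.
  + elim/tens_ind: y => [a u|y y' hy hy']; last first.
      have -> : F (0, y + y', 0) = F (0, y, 0) + F (0, y', 0).
        by rewrite -(linD Fl) -[X in _ = F X]/(0 + 0, y + y', 0 + 0) !addr0.
      exact: imhD.
    have [s us] := h2s u.
    have -> : F (0, tpair a u, 0) = \sum_(p <- s)
        form2_coef pdel (tpair a p.1.1, tpair aone p.1.2, tpair aone p.2).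
      apply/funext => -[[j|j] [k|k]]; rewrite fct_sumE ?(FE11, FE12, FE21, FE22);
        under [RHS]eq_bigr do rewrite form2_coefE.
      * rewrite (lin0 (B11l (j, k))) big1// => p _.
        rewrite !(prod_del_pair dd1 dd2) !talg_mul_pair !d1.
        by rewrite !(bilin0r ab1, bilin0l ab1, bilin0l tb) subr0.
      * rewrite (lin0 (B12l j k)) big1// => p _.
        rewrite !(prod_del_pair dd1 dd2) !talg_mul_pair d1.
        by rewrite !(bilin0r ab1, bilin0l ab1, bilin0l tb) subr0.
      * rewrite (lin0 (B12l k j)) oppr0 big1// => p _.
        rewrite !(prod_del_pair dd1 dd2) !talg_mul_pair d1.
        by rewrite !(bilin0r ab1, bilin0l ab1, bilin0l tb) subr0.
      * rewrite /B22 tmap_pair//; last exact: eval_linear.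
        rewrite us fct_sumE (bilin_sumr tb); apply: eq_bigr => p _.
        rewrite !(prod_del_pair dd1 dd2) !talg_mul_pair !amula1.
        by rewrite (bilinDr _ _ _ tb) (bilinNr tb).
    by apply: imh_sum => p; exact: hg.
  + elim/tens_ind: z => [u v|z z' hz hz']; last first.
      have -> : F (0, 0, z + z') = F (0, 0, z) + F (0, 0, z').
        by rewrite -(linD Fl) -[X in _ = F X]/(0 + 0, 0 + 0, z + z') !addr0.
      exact: imhD.
    have [s us] := f1s u; have [r vr] := f2s v.
    have -> : F (0, 0, tpair u v) = \sum_(p <- s) \sum_(q <- r)
        form2_coef pdel (tpair p.1 q.1, tpair p.2 aone, tpair aone q.2).
      apply/funext => -[[j|j] [k|k]]; rewrite fct_sumE ?(FE11, FE12, FE21, FE22);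
        under [RHS]eq_bigr do (rewrite fct_sumE; under eq_bigr do rewrite form2_coefE).
      * rewrite (lin0 (B11l (j, k))) big1// => p _; rewrite big1// => q _.
        rewrite !(prod_del_pair dd1 dd2) !talg_mul_pair !d1.
        by rewrite !(bilin0r ab1, bilin0l ab1, bilin0l tb) subr0.
      * rewrite /B12 tmap_pair; try exact: eval_linear.
        rewrite us vr !fct_sumE (bilin_suml tb); apply: eq_bigr => p _.
        rewrite (bilin_sumr tb); apply: eq_bigr => q _.
        rewrite !(prod_del_pair dd1 dd2) !talg_mul_pair !amula1 d2.
        by rewrite !(bilin0r ab2, bilin0l ab2, bilin0r tb) subr0.
      * rewrite /B12 tmap_pair; try exact: eval_linear.
        rewrite us vr !fct_sumE (bilin_suml tb) -sumrN; apply: eq_bigr => p _.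
        rewrite (bilin_sumr tb) -sumrN; apply: eq_bigr => q _.
        rewrite !(prod_del_pair dd1 dd2) !talg_mul_pair !amula1 d2.
        by rewrite !(bilin0r ab2, bilin0l ab2, bilin0r tb) sub0r.
      * rewrite (lin0 (B22l (j, k))) big1// => p _; rewrite big1// => q _.
        rewrite !(prod_del_pair dd1 dd2) !talg_mul_pair !d2.
        by rewrite !(bilin0r ab2, bilin0l ab2, bilin0r tb) subr0.
    by apply: (imh_sum _ _ _ _) => p; apply: (imh_sum _ _ _ _) => q; exact: hg.
Qed.

End TwoFormsOfProduct.

(** * Unconditional sums *)

Section HasSum.
Variables (R : realType) (I : choiceType).
Implicit Types (f g : I -> R[i]) (s r : R[i]) (e : R).

Definition cnorm (z : R[i]) : R := complex.Re `|z|.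

Lemma cnormE z : `|z| = (cnorm z)%:C%C.
Proof. by rewrite /cnorm normc_def. Qed.

Lemma cnorm_ge0 z : 0 <= cnorm z.
Proof. by rewrite /cnorm normc_def sqrtr_ge0. Qed.

Lemma has_sumD f g s r : has_sum f s -> has_sum g r ->
  has_sum (fun i => f i + g i) (s + r).
Proof.
move=> hf hg e e0; have e2 : 0 < e / 2 by rewrite divr_gt0.
have [F hF] := hf _ e2; have [G hG] := hg _ e2.
exists (F `|` G)%fset => H FGH; rewrite big_split opprD addrACA.
rewrite (le_lt_trans (ler_normD _ _))// [e]splitr rmorphD ltrD//.
- by apply: hF; apply: fsubset_trans FGH; exact: fsubsetUl.
- by apply: hG; apply: fsubset_trans FGH; exact: fsubsetUr.
Qed.

Lemma has_sumZ k f s : has_sum f s -> has_sum (fun i => k * f i) (k * s).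
Proof.
move=> hf e e0; have k1 : 0 < cnorm k + 1 by rewrite ltr_wpDl// cnorm_ge0.
have [F hF] := hf _ (divr_gt0 e0 k1).
exists F => G FG; rewrite -mulr_sumr -mulrBr normrM.
have := hF G FG; rewrite !cnormE -rmorphM !ltcR => h.
apply: (@le_lt_trans _ _ ((cnorm k + 1) * cnorm (\sum_(i <- G) f i - s))).
  by rewrite ler_wpM2r ?cnorm_ge0// lerDl.
by rewrite mulrC -ltr_pdivlMr.
Qed.

Lemma has_sum_le f s (b : R) : has_sum f s ->
  (forall G : {fset I}, `|\sum_(i <- G) f i| <= b%:C%C) -> `|s| <= b%:C%C.
Proof.
move=> hf hb; rewrite cnormE lecR; apply/ler_addgt0Pl => e e0.
have [F hF] := hf _ e0; rewrite -lecR -cnormE rmorphD.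
rewrite -[s](subrK (\sum_(i <- F) f i)) (le_trans (ler_normD _ _))// lerD//.
by rewrite distrC ltW// hF.
Qed.

Lemma has_sum_unique f s r : has_sum f s -> has_sum f r -> s = r.
Proof.
move=> hs hr; apply/eqP; rewrite -subr_eq0 -normr_le0.
have h := has_sumD hs (has_sumZ (-1) hr); rewrite mulN1r in h.
apply: (has_sum_le h (b := 0)) => G; rewrite big1 ?normr0// => i _.
by rewrite mulN1r subrr.
Qed.

Lemma has_sum_ext f g s : f =1 g -> has_sum f s -> has_sum g s.
Proof. by move=> /funext ->. Qed.

Lemma has_sum_single f s i0 : (forall i, i != i0 -> f i = 0) ->
  has_sum f s -> s = f i0.
Proof.
move=> f0 hs; apply: (has_sum_unique hs) => e e0; exists [fset i0]%fset => G.
rewrite fsub1set => i0G.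
rewrite (bigD1_seq i0)//= big1 ?addr0; last by move=> i /f0.
by rewrite subrr normr0 ltcR.
Qed.

End HasSum.

Lemma expi0 (R : realType) : expi (0 : R) = 1.
Proof. by rewrite /expi mulr0 cos0 sin0. Qed.

(** * Noncommutative tori *)

Section TorusDerivations.
Variables (R : realType) (n : nat) (Theta : 'M[R]_n) (A : nctorus Theta).
Variable del : 'I_n -> A -> A.
Hypotheses (n_gt0 : (0 < n)%N) (hdel : is_nct_derivations del).

Let lc := @nct_coef_linear R n Theta A.

Lemma nct_coef_ext (a b : A) : (forall r, nct_coef a r = nct_coef b r) -> a = b.
Proof. by move=> h; apply: nct_coef_inj; apply/funext. Qed.

Let freq (j : 'I_n) (r : 'rV[int]_n) : R[i] := (2 * pi * (r 0 j)%:~R)%:C%C * 'i%C.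

Let freqD j r s : freq j (r + s) = freq j r + freq j s.
Proof. by rewrite /freq mxE intrD mulrDr rmorphD mulrDl. Qed.

Let basis_exists (e : 'rV[int]_n) :
  exists a : A, nct_coef a = fun r => (r == e)%:R.
Proof.
apply/(@nct_coef_range R n Theta A) => k.
exists ((1 + \sum_j absz (e ord0 j))%:R ^+ k) => r.
have [->|_] := eqVneq r e; first by rewrite normr1 mulr1 rmorphXn rmorph_nat.
by rewrite normr0 mulr0 lecR exprn_ge0.
Qed.

(* The phase couples pairs of distinct coordinates only. *)
Let phase_opp (j : 'I_n) (r s : 'rV[int]_n) :
  (forall i, i != j -> r 0 i = 0) -> (forall i, i != j -> s 0 i = 0) ->
  nct_phase Theta r s = 1.
Proof.
move=> hr hs; rewrite /nct_phase !big1 ?expi0// => k _; rewrite big1// => l lk.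
have [kj|kj] := eqVneq k j; last by rewrite hr// mulr0 mul0r.
by rewrite hs ?mulr0// -kj neq_ltn lk.
Qed.

Lemma nct_lie_derivations : lie_derivations del.
Proof.
split.
- move=> j k a b; apply: nct_coef_ext => r; rewrite hdel !lc.
  rewrite -![(_ + _) r]/(k *: nct_coef _ r + nct_coef _ r) !hdel.
  by rewrite mulrDr; congr (_ + _); rewrite -![_ *: _]/(_ * _) mulrCA.
- move=> j a b; apply: nct_coef_ext => r.
  rewrite hdel (linD lc) -[RHS]/(nct_coef _ r + nct_coef _ r).
  have h := has_sumD (nct_coefM (del j a) b r) (nct_coefM a (del j b) r).
  apply: has_sum_unique h; rewrite -/(freq j r).
  apply: has_sum_ext (has_sumZ (freq j r) (nct_coefM a b r)) => s.
  rewrite !hdel -/(freq j s) -/(freq j (r - s)).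
  have -> : freq j r = freq j s + freq j (r - s) by rewrite -freqD addrC subrK.
  by ring.
- exists (fun _ _ _ => 0) => j k a; rewrite big1 => [|l _]; last by rewrite scale0r.
  apply/eqP; rewrite subr_eq0; apply/eqP/nct_coef_ext => r.
  by rewrite !hdel mulrCA.
- pose j0 := Ordinal n_gt0; pose e : 'rV[int]_n := delta_mx 0 j0.
  have [u uE] := basis_exists e; have [v vE] := basis_exists (- e).
  have e0 i : i != j0 -> e 0 i = 0 by move=> ij; rewrite mxE (negPf ij).
  have Ne0 i : i != j0 -> (- e) 0 i = 0 by move=> ij; rewrite mxE e0 ?oppr0.
  have prod1 (x y : A) (p q : 'rV[int]_n) : p + q = 0 ->
      nct_coef x = (fun r => (r == p)%:R) -> nct_coef y = (fun r => (r == q)%:R) ->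
      nct_phase Theta p q = 1 -> amul x y = aone.
    move=> pq xE yE ph; apply: nct_coef_ext => r.
    rewrite (has_sum_single (i0 := p) _ (nct_coefM x y r)) => [|s sp]; last first.
      by rewrite xE (negPf sp) !mul0r.
    have rp : (r - p == q) = (r == 0) by rewrite subr_eq addrC pq.
    rewrite xE yE eqxx mul1r nct_coef1 rp; have [r0|] := eqVneq r 0.
      by rewrite r0 sub0r (_ : - p = q) ?ph ?mulr1//; apply/eqP; rewrite eq_sym -addr_eq0 addrC pq.
    by rewrite mul0r.
  have eig (x : A) (p : 'rV[int]_n) j : nct_coef x = (fun r => (r == p)%:R) ->
      del j x = freq j p *: x.
    move=> xE; apply: nct_coef_ext => r; rewrite hdel -/(freq j r) (linZ lc).
    rewrite -[RHS]/(_ * nct_coef x r) xE.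
    by have [->//|] := eqVneq r p; rewrite !mulr0.
  have freqe j : freq j e = if j == j0 then (2 * pi)%:C%C * 'i%C else 0.
    rewrite /freq mxE eqxx /= ; case: (j == j0); first by rewrite mulr1.
    by rewrite mulr0 mul0r.
  exists j0, u, v, ((2 * pi)%:C%C * 'i%C); split.
  + rewrite mulf_neq0//; last by rewrite eq_complex /= oner_eq0 andbF.
    by rewrite eq_complex /= eqxx andbT mulf_neq0// gt_eqF// pi_gt0.
  + exact: (prod1 u v e (- e) (subrr e) uE vE (phase_opp e0 Ne0)).
  + exact: (prod1 v u (- e) e (addNr e) vE uE (phase_opp Ne0 e0)).
  + by move=> j; rewrite (eig u e j uE) freqe.
  + move=> j; rewrite (eig v (- e) j vE) -freqe; congr (_ *: _).
    by apply/eqP; rewrite -addr_eq0 -freqD addNr /freq mxE mulr0 mul0r.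
Qed.

Lemma nct_coef_functional (r : 'rV[int]_n) :
  linear ((fun a : A => nct_coef a r) : A -> R[i]^o).
Proof. by move=> k a b; rewrite lc. Qed.

End TorusDerivations.

(** * The Clifford matrices of the two triples *)

Lemma gns_clifford_triple (R : realType) (A : algebra R[i]) (tau : A -> R[i])
    (star : A -> A) (k m : nat) (del : 'I_k -> A -> A) (M : 'I_k -> 'M[R[i]]_m)
    (T : spectral_triple A) (ket : A -> 'cV[R[i]]_m -> st_hilb T) :
  (0 < m)%N -> (exists s, anticommuting_family M s) ->
  is_gns_triple tau star del M ket -> clifford_triple del M ket.
Proof.
move=> m_gt0 cM [kb kdot kdense krep kD]; split=> //.
by exists (fun a b => tau (amul (star a) b)).
Qed.

Section Matrices22.
Variable R : realType.
Implicit Types a b c d : R[i].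

Lemma mx22E a b c d (i j : 'I_2) : mx22 a b c d i j =
  if (i == 0) && (j == 0) then a else if i == 0 then b
  else if j == 0 then c else d.
Proof. by rewrite mxE. Qed.

Lemma mulmx22 a b c d a' b' c' d' : mx22 a b c d *m mx22 a' b' c' d' =
  mx22 (a * a' + b * c') (a * b' + b * d') (c * a' + d * c') (c * b' + d * d').
Proof.
apply/matrixP => i j; rewrite mxE !big_ord_recl big_ord0 addr0 !mx22E /=.
by case: (i == 0); case: (j == 0).
Qed.

Lemma oppmx22 a b c d : - mx22 a b c d = mx22 (- a) (- b) (- c) (- d).
Proof.
by apply/matrixP => i j; rewrite mxE !mx22E; case: (i == 0); case: (j == 0).
Qed.

Lemma scalar_mx22 a : a%:M = mx22 a 0 0 a.
Proof.
apply/matrixP => i j; rewrite mxE mx22E.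
by case: i j => [[|[|//]] hi] [[|[|//]] hj].
Qed.

Lemma scale_mx22 k a b c d : k *: mx22 a b c d = mx22 (k * a) (k * b) (k * c) (k * d).
Proof.
by apply/matrixP => i j; rewrite mxE !mx22E; case: (i == 0); case: (j == 0).
Qed.

Lemma sqr_im : 'i%C * 'i%C = -1 :> R[i].
Proof. by rewrite -expr2 sqr_i. Qed.

Lemma pauli_sq k : pauli R k *m pauli R k = 1%:M.
Proof.
rewrite scalar_mx22; case: k => [[|[|[|//]]] hk]; rewrite /pauli /= mulmx22;
  by congr mx22; rewrite ?mulNr ?mulrN ?sqr_im; ring.
Qed.

Lemma pauli_anticommute k l : k != l ->
  pauli R k *m pauli R l = - (pauli R l *m pauli R k).
Proof.
case: k l => [[|[|[|//]]] hk] [[|[|[|//]]] hl]; rewrite -val_eqE //= => _;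
  by rewrite /pauli /= !mulmx22 oppmx22; congr mx22; ring.
Qed.

Lemma qhm_anticommuting : exists s,
  anticommuting_family (fun j => 'i%C *: qhm_sigma R j) s.
Proof.
exists (fun=> -1); split.
- by move=> _; rewrite oppr_eq0 oner_eq0.
- move=> j; rewrite -scalemxAl -scalemxAr scalerA sqr_im scalar_mx22.
  case: j => [[|[|[|//]]] hj]; rewrite /qhm_sigma /= mulmx22 scale_mx22;
    by congr mx22; rewrite ?mulNr ?mulrN ?sqr_im; ring.
- move=> j k jk; rewrite -!scalemxAl -!scalemxAr -!scalerN; congr (_ *: (_ *: _)).
  case: j k jk => [[|[|[|//]]] hj] [[|[|[|//]]] hk]; rewrite -val_eqE //= => _;
    by rewrite /qhm_sigma /= !mulmx22 oppmx22; congr mx22; ring.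
Qed.

End Matrices22.

Section Grading.
Variables (R : realType) (n N : nat) (g : 'I_n -> 'M[R[i]]_N).
Hypothesis cg : clifford g.

Lemma clifford_sq r : g r *m g r = 1%:M.
Proof.
have [_ h] := cg; have /= := h r r; rewrite eqxx mulr1 -mulr2n => e.
apply: (@scalerI _ _ 2%:R); first by rewrite pnatr_eq0.
by rewrite scaler_nat e scale_scalar_mx mulr1.
Qed.

Lemma clifford_anticommute r s : r != s -> g r *m g s = - (g s *m g r).
Proof.
move=> rs; have [_ h] := cg; have := h r s; rewrite (negPf rs) mulr0.
by rewrite raddf0 => /eqP; rewrite addr_eq0 => /eqP.
Qed.

Let prod (s : seq 'I_n) := \big[mulmx/1%:M]_(j <- s) g j.

Let prod_comm s j : uniq s ->
  g j *m prod s = (-1) ^+ (size s + (j \in s)) *: (prod s *m g j).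
Proof.
elim: s => [_|x s ih /= /andP[xs us]].
  by rewrite /prod big_nil mulmx1 mul1mx scale1r.
rewrite /prod big_cons -/(prod s) in_cons.
have [jx|jx] /= := eqVneq j x.
  subst j; have e := ih us; rewrite (negPf xs) addn0 in e.
  by rewrite [X in _ *m X = _]e -scalemxAr mulmxA addn1 !exprS !mulN1r opprK.
rewrite mulmxA (clifford_anticommute jx) mulNmx -(mulmxA (g x) (g j)) ih// -scalemxAr mulmxA.
by rewrite addSn exprS mulN1r scaleNr.
Qed.

Let prod_sq s : uniq s -> exists e : R[i], e != 0 /\ prod s *m prod s = e%:M.
Proof.
elim: s => [_|x s ih /= /andP[xs us]].
  by exists 1; rewrite /prod big_nil mulmx1 oner_eq0.
have [e [e0 pe]] := ih us; exists ((-1) ^+ size s * e).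
rewrite mulf_neq0// ?signr_eq0//; split=> //.
rewrite /prod big_cons -/(prod s) -mulmxA (mulmxA (prod s)).
have := prod_comm x us; rewrite (negPf xs) addn0.
move=> /(congr1 (fun X => (-1) ^+ size s *: X)); rewrite scalerA.
rewrite -expr2 sqrr_sign scale1r => <-.
rewrite -scalemxAl -scalemxAr -mulmxA pe mulmxA clifford_sq mul1mx.
by rewrite scale_scalar_mx.
Qed.

(** Moving g_j through the product changes the sign once for each of the other
    n - 1 factors. *)
Lemma grading_anticommute j : ~~ odd n ->
  clifford_grading g *m g j = - (g j *m clifford_grading g).
Proof.
move=> n_even; have := prod_comm j (index_enum_uniq 'I_n).
have -> : size (index_enum 'I_n) = n.
  by rewrite /index_enum unlock -enumT size_enum_ord.
rewrite mem_index_enum addn1 exprS mulN1r -signr_odd.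
rewrite (negPf n_even) expr0 scaleN1r /prod => h.
by rewrite /clifford_grading -scalemxAl -scalemxAr h scalerN opprK.
Qed.

Lemma grading_sq : exists e, e != 0 /\
  clifford_grading g *m clifford_grading g = e%:M.
Proof.
have [e [e0 pe]] := prod_sq (index_enum_uniq 'I_n).
exists ('i%C ^+ n./2 * 'i%C ^+ n./2 * e).
have i0 : 'i%C ^+ n./2 != 0 :> R[i].
  by rewrite expf_neq0// eq_complex /= oner_eq0 andbF.
split; first by rewrite !mulf_neq0.
rewrite /clifford_grading -scalemxAl -scalemxAr scalerA.
by rewrite -[X in _ *: X]/(prod _ *m prod _) pe scale_scalar_mx.
Qed.

End Grading.

(** For n even the grading of the Clifford representation anticommutes with
    the Clifford matrices; for n odd the second Pauli matrix does so with their
    doubles by the first. *)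
Lemma nct_clifford_triple (R : realType) (n : nat) (n_gt0 : (0 < n)%N)
    (Theta : 'M[R]_n) (A : nctorus Theta) (T : spectral_triple A)
    (gamma : bop (st_hilb T)) : is_nct_triple T gamma ->
  exists m (del : 'I_n -> A -> A) (M : 'I_n -> 'M[R[i]]_m)
    (ket : A -> 'cV[R[i]]_m -> st_hilb T) (Gamma : 'M[R[i]]_m) (e : R[i]),
  [/\ is_nct_derivations del, clifford_triple del M ket,
      forall a u, gamma (ket a u) = ket a (Gamma *m u),
      e != 0 /\ Gamma *m Gamma = e%:M &
      forall j, Gamma *m M j = - (M j *m Gamma)].
Proof.
have scaled m (G : 'I_n -> 'M[R[i]]_m) : (forall j, G j *m G j = 1%:M) ->
    (forall j k, j != k -> G j *m G k = - (G k *m G j)) ->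
    exists s, anticommuting_family (fun j => - 'i%C *: G j) s.
  move=> sq anti; exists (fun=> -1); split.
  - by move=> _; rewrite oppr_eq0 oner_eq0.
  - move=> j; rewrite -scalemxAl -scalemxAr scalerA mulrNN sqr_im sq.
    by rewrite scale_scalar_mx mulr1.
  - by move=> j k jk; rewrite -!scalemxAl -!scalemxAr anti// !scalerN.
have gradedM m (Gamma : 'M[R[i]]_m) (G : 'I_n -> 'M[R[i]]_m) :
    (forall j, Gamma *m G j = - (G j *m Gamma)) ->
    forall j, Gamma *m (- 'i%C *: G j) = - ((- 'i%C *: G j) *m Gamma).
  by move=> h j; rewrite -scalemxAl -scalemxAr h scalerN.
case=> g cg; have [n_odd|n_even] := boolP (odd n).
- move=> [k [l [kl [del [ket [ders gns gket]]]]]].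
  have m_gt0 : (0 < 2 ^ n./2 * 2)%N by rewrite muln_gt0 expn_gt0.
  exists (2 ^ n./2 * 2)%N, del, (fun j => - 'i%C *: (g j *t pauli R k)), ket,
    (1%:M *t pauli R l), 1; split=> //.
  + apply: gns_clifford_triple gns => //; apply: scaled => [j|i j ij].
      by rewrite tensmx_mul (clifford_sq cg) pauli_sq tensmx_scalar mulr1.
    by rewrite !tensmx_mul (clifford_anticommute cg ij) tensmxNl.
  + rewrite oner_eq0; split=> //.
    by rewrite tensmx_mul pauli_sq mul1mx tensmx_scalar mulr1.
  + apply: gradedM => j; rewrite !tensmx_mul mul1mx mulmx1.
    by rewrite pauli_anticommute 1?eq_sym// tensmxNr.
- move=> [del [ket [ders gns gket]]]; have [e [e0 ee]] := grading_sq cg.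
  exists (2 ^ n./2)%N, del, (fun j => - 'i%C *: g j), ket, (clifford_grading g), e.
  split=> //.
  + apply: gns_clifford_triple gns; first by rewrite expn_gt0.
    apply: scaled; [exact: clifford_sq|exact: clifford_anticommute].
  + by apply: gradedM => j; exact: grading_anticommute.
Qed.

(** * Differentiable functions of a real variable with complex values *)

Section ComplexDerivative.
Variable R : realType.
Implicit Types (f g : R -> R[i]) (x t : R) (l : R[i]).

Definition is_cderive f x l : Prop :=
  is_derive x 1 (fun t => complex.Re (f t)) (complex.Re l) /\
  is_derive x 1 (fun t => complex.Im (f t)) (complex.Im l).

Lemma cderivableP f x : cderivable f x -> is_cderive f x (cderive f x).
Proof.
move=> [dr di]; split; rewrite /= derive1E.
  exact: derivableP dr.
exact: derivableP di.
Qed.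

Lemma is_cderiveE f x l : is_cderive f x l -> cderive f x = l.
Proof.
move=> [dr di]; rewrite /cderive !derive1E (@derive_val _ _ _ _ _ _ _ dr).
by rewrite (@derive_val _ _ _ _ _ _ _ di); case: l {dr di}.
Qed.

Lemma is_cderive_eq f x l l' : is_cderive f x l -> l = l' -> is_cderive f x l'.
Proof. by move=> h <-. Qed.

Lemma ReM (a b : R[i]) : complex.Re (a * b) =
  complex.Re a * complex.Re b - complex.Im a * complex.Im b.
Proof. by case: a b => [? ?] [? ?]. Qed.

Lemma ImM (a b : R[i]) : complex.Im (a * b) =
  complex.Re a * complex.Im b + complex.Im a * complex.Re b.
Proof. by case: a b => [? ?] [? ?]. Qed.

Lemma ReD (a b : R[i]) : complex.Re (a + b) = complex.Re a + complex.Re b.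
Proof. by case: a b => [? ?] [? ?]. Qed.

Lemma ImD (a b : R[i]) : complex.Im (a + b) = complex.Im a + complex.Im b.
Proof. by case: a b => [? ?] [? ?]. Qed.

Lemma ReN (a : R[i]) : complex.Re (- a) = - complex.Re a.
Proof. by case: a. Qed.

Lemma ImN (a : R[i]) : complex.Im (- a) = - complex.Im a.
Proof. by case: a. Qed.

Lemma is_cderiveM f g x a b : is_cderive f x a -> is_cderive g x b ->
  is_cderive (fun t => f t * g t) x (a * g x + f x * b).
Proof.
move=> [fr fi] [gr gi]; split.
- rewrite (_ : (fun t => _) = (fun t => complex.Re (f t)) * (fun t => complex.Re (g t))
    - (fun t => complex.Im (f t)) * (fun t => complex.Im (g t))); last first.
    by apply/funext => t; rewrite ReM.
  apply: is_derive_eq (is_deriveB (is_deriveM fr gr) (is_deriveM fi gi)) _.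
  by rewrite ReD !ReM -![_ *: _]/(_ * _); ring.
- rewrite (_ : (fun t => _) = (fun t => complex.Re (f t)) * (fun t => complex.Im (g t))
    + (fun t => complex.Im (f t)) * (fun t => complex.Re (g t))); last first.
    by apply/funext => t; rewrite ImM.
  apply: is_derive_eq (is_deriveD (is_deriveM fr gi) (is_deriveM fi gr)) _.
  by rewrite ImD !ImM -![_ *: _]/(_ * _); ring.
Qed.

Lemma is_cderiveD f g x a b : is_cderive f x a -> is_cderive g x b ->
  is_cderive (fun t => f t + g t) x (a + b).
Proof.
move=> [fr fi] [gr gi]; split.
- rewrite (_ : (fun t => _) = (fun t => complex.Re (f t)) + (fun t => complex.Re (g t))).
    by rewrite ReD; exact: is_deriveD fr gr.
  by apply/funext => t; rewrite ReD.
- rewrite (_ : (fun t => _) = (fun t => complex.Im (f t)) + (fun t => complex.Im (g t))).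
    by rewrite ImD; exact: is_deriveD fi gi.
  by apply/funext => t; rewrite ImD.
Qed.

Lemma is_cderive_cst (k : R[i]) x : is_cderive (fun=> k) x 0.
Proof. by split; exact: is_derive_cst. Qed.

Lemma is_cderiveZ k f x a : is_cderive f x a ->
  is_cderive (fun t => k * f t) x (k * a).
Proof.
move=> df; apply: is_cderive_eq (is_cderiveM (is_cderive_cst k x) df) _.
by rewrite mul0r add0r.
Qed.

Lemma is_cderiveN f x a : is_cderive f x a -> is_cderive (fun t => - f t) x (- a).
Proof.
move=> /(is_cderiveZ (-1)); rewrite mulN1r.
by rewrite (_ : (fun t => -1 * f t) = (fun t => - f t))//; apply/funext => t;
  rewrite mulN1r.
Qed.

Lemma is_cderive_shift f y x l : is_cderive f (x + y) l ->
  is_cderive (fun t => f (x + t)) y l.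
Proof.
have sh : is_derive y 1 (fun t => x + t) 1.
  rewrite (_ : (fun t => _) = cst x + id)//.
  by apply: is_derive_eq; rewrite add0r.
move=> [dr di]; split.
- rewrite -[complex.Re l]mulr1.
  exact: (is_derive1_comp (f := fun t => complex.Re (f t)) (g := fun t => x + t)).
- rewrite -[complex.Im l]mulr1.
  exact: (is_derive1_comp (f := fun t => complex.Im (f t)) (g := fun t => x + t)).
Qed.

Lemma is_cderive_expi k x : is_cderive (fun t => expi (k * t)) x
  ((2 * pi * k)%:C%C * 'i%C * expi (k * x)).
Proof.
have lin : is_derive x 1 (fun t : R => 2 * pi * (k * t)) (2 * pi * k).
  rewrite (_ : (fun t => _) = (2 * pi * k) \*: id); last first.
    by apply/funext => t; rewrite /= mulrA.
  by apply: is_derive_eq; rewrite -[_ *: _]/(_ * _) mulr1.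
have dc := is_derive1_comp (g := fun t => 2 * pi * (k * t)) (is_derive_cos _) lin.
have ds := is_derive1_comp (g := fun t => 2 * pi * (k * t)) (is_derive_sin _) lin.
split; rewrite /expi /=.
- by apply: is_derive_eq dc _; ring.
- by apply: is_derive_eq ds _; ring.
Qed.

Lemma mean_value (phi phi' : R -> R) (a b : R) :
  (forall t, is_derive t 1 phi (phi' t)) ->
  exists2 c, `|c - a| <= `|b - a| & phi b - phi a = phi' c * (b - a).
Proof.
move=> d.
have cont u v : {within `[u, v], continuous phi}%classic.
  apply: derivable_within_continuous => t _.
  by have [] := d t.
have [ab|ba] := leP a b.
- have [c /[!in_itv]/= /andP[ac cb] e] := MVT_segment ab (fun t _ => d t) (cont a b).
  exists c => //; rewrite !ger0_norm ?subr_ge0//.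
  by rewrite lerD2r.
- have [c /[!in_itv]/= /andP[bc ca] e] := MVT_segment (ltW ba) (fun t _ => d t) (cont b a).
  exists c; last by rewrite -opprB e -mulrN opprB.
  rewrite distrC (distrC b) !ger0_norm ?subr_ge0 ?(ltW ba)//.
  by rewrite lerD2l lerN2.
Qed.

Lemma taylor_bound_real (phi phi1 phi2 : R -> R) (C : R) :
  (forall t, is_derive t 1 phi (phi1 t)) ->
  (forall t, is_derive t 1 phi1 (phi2 t)) ->
  (forall t, `|phi2 t| <= C) ->
  forall t, `|phi t - phi 0 - t * phi1 0| <= C * t ^+ 2.
Proof.
move=> d1 d2 b t; have [c ct e] := mean_value 0 t d1.
have [c' _ e'] := mean_value 0 c d2; rewrite !subr0 in ct e e'.
rewrite e (mulrC t) -mulrBl e' !normrM -(real_normK (num_real t)) expr2 mulrA.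
by rewrite ler_wpM2r//; exact: ler_pM.
Qed.

Lemma normc_Re (z : R[i]) (C : R) : `|z| <= C%:C%C -> `|complex.Re z| <= C.
Proof.
by rewrite -lecR; apply: le_trans; case: z => a b; exact: normc_ge_Re.
Qed.

Lemma normc_Im (z : R[i]) (C : R) : `|z| <= C%:C%C -> `|complex.Im z| <= C.
Proof.
rewrite -lecR; apply: le_trans; case: z => a b /=.
by rewrite normc_def /= lecR -sqrtr_sqr ler_wsqrtr// lerDr sqr_ge0.
Qed.

Lemma normc_le_ReIm (z : R[i]) (C D : R) : `|complex.Re z| <= C ->
  `|complex.Im z| <= D -> `|z| <= (C + D)%:C%C.
Proof.
case: z => a b /= ha hb; rewrite (complexE (a +i* b)%C) /=.
rewrite (le_trans (ler_normD _ _))// rmorphD; apply: lerD.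
  by rewrite normc_def /= expr0n addr0 sqrtr_sqr lecR.
by rewrite normrM !normc_def /= !expr0n /= !addr0 add0r expr1n sqrtr1 mul1r
  sqrtr_sqr lecR.
Qed.

(** The real and imaginary parts meet their mean values at different points,
    which costs the factor 2. *)
Lemma taylor_bound f f1 f2 (C : R) :
  (forall t, is_cderive f t (f1 t)) -> (forall t, is_cderive f1 t (f2 t)) ->
  (forall t, `|f2 t| <= C%:C%C) ->
  forall t, `|f t - f 0 - t%:C%C * f1 0| <= (2 * C * t ^+ 2)%:C%C.
Proof.
move=> d1 d2 b t.
have -> : 2 * C * t ^+ 2 = C * t ^+ 2 + C * t ^+ 2 by ring.
have := taylor_bound_real (fun t => (d1 t).1) (fun t => (d2 t).1)
  (fun t => normc_Re (b t)) t.
have := taylor_bound_real (fun t => (d1 t).2) (fun t => (d2 t).2)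
  (fun t => normc_Im (b t)) t.
move=> hi hr; apply: normc_le_ReIm.
- by rewrite !(ReD, ReN) ReM /= mul0r subr0.
- by rewrite !(ImD, ImN) ImM /= mul0r addr0.
Qed.

(** Differentiation term by term, with both sides known to be twice
    differentiable: the two derivatives agree up to C |t| for every t. *)
Lemma derive_has_sum (I : choiceType) (h h1 h2 : I -> R -> R[i])
    (H H1 H2 : R -> R[i]) (l : R[i]) (w : I -> R) (C S : R) :
  (forall i t, is_cderive (h i) t (h1 i t)) ->
  (forall i t, is_cderive (h1 i) t (h2 i t)) ->
  (forall i t, `|h2 i t| <= (w i)%:C%C) ->
  (forall G : {fset I}, \sum_(i <- G) w i <= S) ->
  (forall t, is_cderive H t (H1 t)) -> (forall t, is_cderive H1 t (H2 t)) ->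
  (forall t, `|H2 t| <= C%:C%C) ->
  (forall t, has_sum (h^~ t) (H t)) -> has_sum (h1^~ 0) l ->
  H1 0 = l.
Proof.
move=> dh dh1 bh bw dH dH1 bH sH sl.
have close t : `|H t - H 0 - t%:C%C * l| <= (2 * S * t ^+ 2)%:C%C.
  have sm := has_sumD (has_sumD (sH t) (has_sumZ (-1) (sH 0))) (has_sumZ (- t%:C%C) sl).
  rewrite mulN1r mulNr in sm; apply: (has_sum_le sm) => G.
  apply: le_trans (ler_norm_sum _ _ _) _.
  apply: (@le_trans _ _ (\sum_(i <- G) (2 * w i * t ^+ 2)%:C%C)).
    apply: ler_sum => i _; rewrite mulN1r mulNr.
    exact: taylor_bound (dh i) (dh1 i) (bh i) t.
  rewrite -rmorph_sum lecR -mulr_suml -mulr_sumr ler_wpM2r ?sqr_ge0//.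
  by rewrite ler_wpM2l.
have H1l t : 0 < t -> `|H1 0 - l| <= ((2 * S + 2 * C) * t)%:C%C.
  move=> t0; have hb : `|t%:C%C * (H1 0 - l)| <= ((2 * S + 2 * C) * t ^+ 2)%:C%C.
    have -> : t%:C%C * (H1 0 - l) = (H t - H 0 - t%:C%C * l) - (H t - H 0 - t%:C%C * H1 0).
      by ring.
    rewrite (le_trans (ler_normB _ _))// mulrDl rmorphD lerD//.
    exact: taylor_bound dH dH1 bH t.
  move: hb; rewrite normrM !cnormE -rmorphM !lecR.
  have -> : cnorm t%:C%C = t by rewrite /cnorm normc_def /= expr0n addr0 sqrtr_sqr ger0_norm ?ltW.
  by rewrite expr2 mulrA (mulrC t) ler_pM2r.
apply/eqP; rewrite -subr_eq0 -normr_le0 cnormE lecR.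
have [n0|n0] := leP (cnorm (H1 0 - l)) 0; first by [].
have SC : 0 < 2 * S + 2 * C.
  have := H1l 1 ltr01; rewrite mulr1 cnormE lecR; exact: lt_le_trans.
have := H1l (cnorm (H1 0 - l) / (2 * S + 2 * C) / 2); rewrite !divr_gt0// => /(_ isT).
rewrite cnormE lecR mulrA mulrCA mulfV ?gt_eqF// mulr1; lra.
Qed.

End ComplexDerivative.

(** * Mixed partial derivatives *)

Section Clairaut.
Variable R : realType.

(** Both mixed derivatives are values near (x, y) of one second difference
    quotient of f. *)
Lemma mixed_derivatives (f fx fy fxy fyx : R -> R -> R) (x y : R) :
  (forall s t : R, is_derive s 1 (f^~ t) (fx s t)) ->
  (forall s t : R, is_derive t 1 (f s) (fy s t)) ->
  (forall s t : R, is_derive s 1 (fy^~ t) (fxy s t)) ->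
  (forall s t : R, is_derive t 1 (fx s) (fyx s t)) ->
  continuous (fun z : R * R => fxy z.1 z.2) ->
  continuous (fun z : R * R => fyx z.1 z.2) ->
  fxy x y = fyx x y.
Proof.
move=> dx dy dxy dyx cxy cyx.
have diff (g : R -> R) (g' : R -> R) (k : R -> R) (k' : R -> R) :
    (forall t : R, is_derive t 1 g (g' t)) ->
    (forall t : R, is_derive t 1 k (k' t)) ->
    forall t : R, is_derive t 1 (fun t => g t - k t) (g' t - k' t).
  by move=> dg dk t; exact: is_deriveB.
have meet (h : R) : 0 < h -> exists s t s' t', [/\ `|s - x| <= h, `|t - y| <= h,
    `|s' - x| <= h, `|t' - y| <= h & fxy s t = fyx s' t'].
  move=> h0.
  have [s' s'h e'] := mean_value x (x + h)
    (diff (f^~ (y + h)) _ (f^~ y) _ (dx^~ (y + h)) (dx^~ y)).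
  have [t' t'h e''] := mean_value y (y + h) (dyx s').
  have [t th e] := mean_value y (y + h)
    (diff (f (x + h)) _ (f x) _ (dy (x + h)) (dy x)).
  have [s sh e'''] := mean_value x (x + h) (dxy^~ t).
  have ch a : a + h - a = h by rewrite addrC addKr.
  have nh : `|h| = h by rewrite ger0_norm// ltW.
  rewrite !ch ?nh in s'h t'h th sh e e' e'' e'''.
  exists s, t, s', t'; split => //.
  have hh : h * h != 0 by rewrite mulf_neq0 ?gt_eqF.
  apply: (mulIf hh).
  by rewrite !mulrA -e''' -e'' -e -e'; ring.
apply/eqP; rewrite -subr_eq0 -normr_le0; apply/ler_addgt0Pl => e e0.
rewrite addr0; have e2 : 0 < e / 2 by rewrite divr_gt0.
have near (g : R -> R -> R) : continuous (fun z : R * R => g z.1 z.2) ->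
    exists2 d, 0 < d & forall s t, `|s - x| < d -> `|t - y| < d ->
      `|g x y - g s t| < e / 2.
  move=> cg; have /cvgrPdist_lt/(_ _ e2)/nbhs_ballP[d /= d0 hd] := cg (x, y).
  exists d => // s t sx ty; apply: (hd (s, t)).
  by split; rewrite /ball /= distrC.
have [d1 d10 h1] := near _ cxy; have [d2 d20 h2] := near _ cyx.
have m0 : 0 < Num.min d1 d2 / 2 by rewrite divr_gt0// lt_min d10.
have [s [t [s' [t' [sx ty s'x t'y st]]]]] := meet _ m0.
have lt1 (z : R) : z <= Num.min d1 d2 / 2 -> z < d1 /\ z < d2.
  move=> zm; have : z < Num.min d1 d2.
    by apply: le_lt_trans zm _; rewrite ltr_pdivrMr// ltr_pMr ?ltr1n// lt_min d10.
  by rewrite lt_min => /andP.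
have := h1 s t (lt1 _ sx).1 (lt1 _ ty).1; have := h2 s' t' (lt1 _ s'x).2 (lt1 _ t'y).2.
rewrite -st => a b.
rewrite -(subrKA (fxy s t)) (le_trans (ler_normD _ _))// [e]splitr ltW// ltrD//.
by rewrite distrC.
Qed.

End Clairaut.

Section IntegerWeight.
Variable R : realType.

(** A summable rate of decay: the elements of S^c decay in p faster than any
    power. *)
Definition weight (q : int) : R := (1 + q%:~R ^+ 2)^-1.

Lemma weight_gt0 q : 0 < weight q.
Proof. by rewrite invr_gt0 ltr_wpDr// sqr_ge0. Qed.

(* Telescoping: 1 / (1 + m^2) <= 2 / m - 2 / (m + 1). *)
Let sum_nat (N : nat) : \sum_(0 <= n < N.+1) weight n <= 3 - 2 / N.+1%:R.
Proof.
elim: N => [|N ih].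
  by rewrite big_nat1 /weight mulr0z expr0n addr0 invr1; lra.
rewrite big_nat_recr//= (le_trans (lerD ih (lexx _)))// /weight.
have m0 : 0 < N.+1%:R :> R by rewrite ltr0n.
have -> : (Posz N.+1)%:~R = N.+1%:R :> R by [].
rewrite -[N.+2%:R]natr1; move: (N.+1%:R) m0 => m m0.
rewrite -addrA lerD2l -subr_ge0.
have -> : - (2 / (m + 1)) - (- (2 / m) + (1 + m ^+ 2)^-1) =
    ((m - 1) ^+ 2 + m + 1) / (m * (m + 1) * (1 + m ^+ 2)).
  by field; rewrite !gt_eqF//; nra.
rewrite divr_ge0 ?mulr_ge0 ?addr_ge0 ?sqr_ge0//; exact: ltW.
Qed.

Lemma weight_sum (G : {fset int}) : \sum_(q <- G) weight q <= 6.
Proof.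
pose N := \max_(q <- G) absz q.
pose s : seq int := [seq Posz n | n <- index_iota 0 N.+1] ++ [seq Negz n | n <- index_iota 0 N.+1].
have us : uniq s.
  rewrite cat_uniq !map_inj_uniq ?iota_uniq//; try by move=> ? ? [].
  by rewrite andbT; apply/hasPn => _ /mapP[n _ ->]; apply/negP => /mapP[].
have Gs : perm_eq G [seq q <- s | q \in G].
  apply: uniq_perm; rewrite ?filter_uniq// => q; rewrite mem_filter.
  have [qG|//] := boolP (q \in G); rewrite andTb mem_cat.
  have qN : (absz q <= N)%N.
    by apply: (@leq_bigmax_seq _ _ xpredT (fun q => absz q)).
  case: q {qG} qN => n nN; apply/esym/orP; [left|right];
    rewrite map_f// mem_index_iota ltnS.
    exact: nN.
  exact: (ltnW nN).
rewrite (perm_big _ Gs) big_filter.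
apply: (@le_trans _ _ (\sum_(q <- s) weight q)).
  rewrite big_mkcond; apply: ler_sum => q _; case: ifP => // _.
  exact/ltW/weight_gt0.
rewrite big_cat !big_map.
have le3 : \sum_(0 <= n < N.+1) weight n <= 3.
  by rewrite (le_trans (sum_nat N))// gerBl divr_ge0// ler0n.
have -> : 6 = 3 + 3 :> R by ring.
apply: lerD => //; apply: le_trans le3; apply: ler_sum => n _.
rewrite /weight lef_pV2 ?posrE ?ltr_wpDr ?sqr_ge0// lerD2l.
rewrite NegzE mulrNz sqrrN lerXn2r ?nnegrE// ?ler_int//.
exact: leqnSn.
Qed.

End IntegerWeight.

(** * Quantum Heisenberg manifolds *)

Section Expi.
Variable R : realType.

Lemma expiD (x y : R) : expi (x + y) = expi x * expi y.
Proof.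
rewrite /expi mulrDr cosD sinD; apply/eqP.
by rewrite eq_complex /= [X in _ && (_ == X)]addrC; apply/andP; split; rewrite eqxx.
Qed.

Lemma norm_expi (x : R) : `|expi x| = 1.
Proof. by rewrite normc_def /= cos2Dsin2 sqrtr1. Qed.

Lemma expi1 : expi (1 : R) = 1.
Proof.
by rewrite /expi mulr1 mulr_natl cos2pi -[_ *+ 2]add0r sinD2pi sin0.
Qed.

Lemma expiN1 : expi (- 1 : R) = 1.
Proof.
have := expiD (1 : R) (- 1); rewrite subrr expi0 expi1 mul1r.
by move=> <-.
Qed.

End Expi.

Section QuantumHeisenbergDerivations.
Variables (R : realType) (c : nat) (hbar mu nu alpha : R).
Variable A : qheisenberg c hbar mu nu.
Variable del : 'I_3 -> A -> A.
Hypothesis del_fun : forall j a, qhm_fun (del j a) = qhm_delta c alpha j (qhm_fun a).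

Local Notation fn := (@qhm_fun R c hbar mu nu A).
Let fl := @qhm_fun_linear R c hbar mu nu A.

Lemma qhm_Sc a : Sc c (fn a).
Proof. by apply/(qhm_fun_range A); exists a. Qed.

Lemma qhm_fun_ext a b : (forall x y p, fn a x y p = fn b x y p) -> a = b.
Proof.
move=> h; apply: qhm_fun_inj; apply/funext => x; apply/funext => y.
by apply/funext => p; exact: h.
Qed.

Lemma fn_linear k a b x y p : fn (k *: a + b) x y p = k * fn a x y p + fn b x y p.
Proof. by rewrite fl. Qed.

Lemma fn_dx a x y p : is_cderive (fun t => fn a t y p) x (ddx (fn a) x y p).
Proof.
by apply: cderivableP; case: (qhm_Sc a) => /(_ [::] p)[h _ _ _] _ _ _; exact: h.
Qed.

Lemma fn_dy a x y p : is_cderive (fun t => fn a x t p) y (ddy (fn a) x y p).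
Proof.
by apply: cderivableP; case: (qhm_Sc a) => /(_ [::] p)[_ h _ _] _ _ _; exact: h.
Qed.

(** In |f| the quasi-periodicity factors disappear, so that the bounds on
    compact sets hold everywhere. *)
Lemma fn_bound a : exists C : R, 0 <= C /\
  forall x y p, `|fn a x y p| <= (C * weight R p)%:C%C.
Proof.
have [_ pery perx bnd] := qhm_Sc a.
have cK : compact (`[0%R, 1%R] `*` `[0%R, 1%R] : set (R * R))%classic.
  by apply: compact_setX; exact: segment_compact.
have [C hC] := bnd (1 + 'X^2)%R 0%N 0%N _ cK.
have pernat y p x (n : nat) : fn a x (y + n%:R) p = fn a x y p.
  elim: n => [|n ih]; first by rewrite addr0.
  by rewrite -natr1 addrA pery.
have perint y p x (n : int) : fn a x (y + n%:~R) p = fn a x y p.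
  case: n => n; first exact: pernat.
  rewrite NegzE mulrNz; have := pernat (y - n.+1%:R) p x n.+1.
  by rewrite subrK => <-.
have bound x y p : `|fn a x y p| <= (C * weight R p)%:C%C.
  have xE : x = (x - (Num.floor x)%:~R) + (Num.floor x)%:~R by rewrite subrK.
  have yE : y = (y - (Num.floor y)%:~R) + (Num.floor y)%:~R by rewrite subrK.
  rewrite yE perint xE perx normrM norm_expi mul1r.
  have frac (z : R) : z - (Num.floor z)%:~R \in `[0, 1].
    have /andP[z1 z2] := floor_itv z; rewrite intrD in z2.
    by rewrite in_itv /= subr_ge0 z1 lerBlDl ltW.
  have K : (`[0%R, 1%R] `*` `[0%R, 1%R] : set (R * R))%classic
      (x - (Num.floor x)%:~R, y - (Num.floor y)%:~R).
    by split; exact: frac.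
  have := hC _ _ p K; rewrite /= hornerD hornerXn hornerC normrM.
  have -> : 1 + p%:~R ^+ 2 = (1 + p%:~R ^+ 2 : R)%:C%C.
    by rewrite rmorphD rmorph1 rmorphXn rmorph_int.
  rewrite !cnormE -rmorphM !lecR.
  have p0 : 0 < 1 + p%:~R ^+ 2 :> R by rewrite ltr_wpDr ?sqr_ge0.
  have -> : cnorm (1 + p%:~R ^+ 2 : R)%:C%C = 1 + p%:~R ^+ 2.
    by rewrite /cnorm normc_def /= [0 ^+ 2]expr0n addr0 sqrtr_sqr gtr0_norm.
  by rewrite /weight ler_pdivlMr// mulrC.
exists C; split=> //; have := le_trans (normr_ge0 _) (bound 0 0 0).
by rewrite lecR pmulr_lge0// weight_gt0.
Qed.

(** The one-parameter automorphism groups generated by the -del_j. *)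
Definition flow (j : 'I_3) (F : R -> R -> int -> R[i]) x y p (t : R) : R[i] :=
  match val j with
  | 0 => F (x + t) y p
  | 1 => expi (- (c%:R * p%:~R * x) * t) * F x (y + t) p
  | _ => expi (- (p%:~R * c%:R * alpha) * t) * F x y p
  end.

Lemma flow0 j F x y p : flow j F x y p 0 = F x y p.
Proof.
by case: j => [[|[|[|//]]] hj]; rewrite /flow /= ?addr0 ?mulr0 ?expi0 ?mul1r.
Qed.

Lemma flow_bound j a : exists C : R, 0 <= C /\
  forall x y p t, `|flow j (fn a) x y p t| <= (C * weight R p)%:C%C.
Proof.
have [C [C0 hC]] := fn_bound a; exists C; split=> // x y p t.
by case: j => [[|[|[|//]]] hj]; rewrite /flow /= ?normrM ?norm_expi ?mul1r.
Qed.

Lemma flow_derive j a x y p t :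
  is_cderive (flow j (fn a) x y p) t (- flow j (fn (del j a)) x y p t).
Proof.
rewrite del_fun; case: j => [[|[|[|//]]] hj]; rewrite /flow /qhm_delta /=.
- rewrite opprK.
  exact: (is_cderive_shift (f := fun s => fn a s y p) (fn_dx a (x + t) y p)).
- apply: is_cderive_eq (is_cderiveM (is_cderive_expi _ t)
    (is_cderive_shift (f := fun t => fn a x t p) (fn_dy a x (y + t) p))) _.
  have -> : 2 * pi * - (c%:R * p%:~R * x) = - (2 * pi * c%:R * p%:~R * x) by ring.
  by rewrite rmorphN /=; ring.
- apply: is_cderive_eq (is_cderiveM (is_cderive_expi _ t) (is_cderive_cst _ t)) _.
  have -> : 2 * pi * - (p%:~R * c%:R * alpha) = - (2 * pi * p%:~R * c%:R * alpha) by ring.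
  by rewrite rmorphN /=; ring.
Qed.

(** For del_1 the phases of the factors combine because
    q (x - hbar (q - p) mu) + (p - q) (x - hbar q mu) = p x. *)
Lemma flow_mul j a b x y p t :
  has_sum (fun q : int =>
    flow j (fn a) (x - hbar * (q - p)%:~R * mu) (y - hbar * (q - p)%:~R * nu) q t *
    flow j (fn b) (x - hbar * q%:~R * mu) (y - hbar * q%:~R * nu) (p - q) t)
    (flow j (fn (amul a b)) x y p t).
Proof.
case: j => [[|[|[|//]]] hj]; rewrite /flow /=.
- apply: has_sum_ext (qhm_funM a b (x + t) y p) => q.
  by rewrite ![x + t - _]addrAC.
- apply: has_sum_ext (has_sumZ _ (qhm_funM a b x (y + t) p)) => q.
  rewrite ![y + t - _]addrAC mulrACA -expiD; congr (expi _ * _).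
  by rewrite !intrD !mulrNz; ring.
- apply: has_sum_ext (has_sumZ _ (qhm_funM a b x y p)) => q.
  rewrite mulrACA -expiD; congr (expi _ * _).
  by rewrite !intrD !mulrNz; ring.
Qed.

(** The derivative at t = 0 of the multiplicativity of the flow, taken term by
    term in the series of the product. *)
Lemma qhm_leibniz j a b :
  del j (amul a b) = amul (del j a) b + amul a (del j b).
Proof.
apply: qhm_fun_ext => x y p.
pose X (q : int) := x - hbar * (q - p)%:~R * mu.
pose Y (q : int) := y - hbar * (q - p)%:~R * nu.
pose X' (q : int) := x - hbar * q%:~R * mu.
pose Y' (q : int) := y - hbar * q%:~R * nu.
pose L e q t := flow j (fn e) (X q) (Y q) q t.
pose Q e q t := flow j (fn e) (X' q) (Y' q) (p - q) t.
have dL e q t : is_cderive (L e q) t (- L (del j e) q t) by exact: flow_derive.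
have dQ e q t : is_cderive (Q e q) t (- Q (del j e) q t) by exact: flow_derive.
have dprod e e' q t : is_cderive (fun t => L e q t * Q e' q t) t
    (- (L (del j e) q t * Q e' q t + L e q t * Q (del j e') q t)).
  by apply: is_cderive_eq (is_cderiveM (dL e q t) (dQ e' q t)) _; ring.
have bprod e e' : exists C : R, forall q t, `|L e q t * Q e' q t| <= (C * weight R q)%:C%C.
  have [C [C0 hC]] := flow_bound j e; have [D [D0 hD]] := flow_bound j e'.
  exists (C * D) => q t; rewrite normrM mulrAC rmorphM.
  apply: ler_pM => //; first exact: hC.
  apply: le_trans (hD _ _ _ _) _; rewrite lecR ler_piMr// /weight.
  by rewrite invf_le1 ?ltr_wpDr ?sqr_ge0// lerDl sqr_ge0.
set e := del j (amul a b); set l := fn (amul (del j a) b + _) x y p.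
have [C0 h0] := bprod (del j (del j a)) b.
have [C1 h1] := bprod (del j a) (del j b).
have [C2 h2] := bprod a (del j (del j b)).
have [C [Cp hC]] := flow_bound j (del j e).
have -> : l = - - l by rewrite opprK.
rewrite -[fn e x y p]opprK; congr (- _).
rewrite -(flow0 j (fn e) x y p).
apply: (derive_has_sum (h := fun q t => L a q t * Q b q t)
  (h1 := fun q t => - (L (del j a) q t * Q b q t + L a q t * Q (del j b) q t))
  (h2 := fun q t => L (del j (del j a)) q t * Q b q t +
     2 * (L (del j a) q t * Q (del j b) q t) + L a q t * Q (del j (del j b)) q t)
  (H := flow j (fn (amul a b)) x y p)
  (H1 := fun t => - flow j (fn e) x y p t)
  (H2 := flow j (fn (del j e)) x y p)
  (w := fun q => (C0 + 2 * C1 + C2) * weight R q)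
  (C := C * weight R p) (S := (C0 + 2 * C1 + C2) * 6)).
- by move=> q t; exact: dprod.
- move=> q t.
  apply: is_cderive_eq (is_cderiveN (is_cderiveD (dprod (del j a) b q t)
    (dprod a (del j b) q t))) _; ring.
- move=> q t.
  have -> : (C0 + 2 * C1 + C2) * weight R q =
      C0 * weight R q + 2 * (C1 * weight R q) + C2 * weight R q by ring.
  rewrite 2!rmorphD.
  apply: le_trans (ler_normD _ _) _; apply: lerD; last exact: h2.
  apply: le_trans (ler_normD _ _) _; apply: lerD; first exact: h0.
  by rewrite normrM normr_nat rmorphM rmorph_nat ler_pM2l// h1.
- have C2p : 0 <= C0 + 2 * C1 + C2.
    have pos e1 e2 K : (forall q t, `|L e1 q t * Q e2 q t| <= (K * weight R q)%:C%C) ->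
        0 <= K.
      move=> /(_ 0 0) hK; have := le_trans (normr_ge0 _) hK.
      by rewrite lecR pmulr_lge0// weight_gt0.
    by rewrite !addr_ge0 ?mulr_ge0//; [apply: pos h0|apply: pos h1|apply: pos h2].
  by move=> G; rewrite -mulr_sumr ler_wpM2l// weight_sum.
- by move=> t; exact: flow_derive.
- move=> t; apply: is_cderive_eq (is_cderiveN (flow_derive j e x y p t)) _.
  by rewrite opprK.
- by move=> t; exact: hC.
- by move=> t; exact: flow_mul.
- have sD := has_sumD (qhm_funM (del j a) b x y p) (qhm_funM a (del j b) x y p).
  have := has_sumZ (-1) sD; rewrite mulN1r.
  have -> : fn (amul (del j a) b) x y p + fn (amul a (del j b)) x y p = l.
    by rewrite /l (linD fl).
  apply: has_sum_ext => q.
  by rewrite /L /Q !flow0 mulN1r.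
Qed.

End QuantumHeisenbergDerivations.

Section QuantumHeisenbergLie.
Variables (R : realType) (c : nat) (hbar mu nu alpha : R).
Variable A : qheisenberg c hbar mu nu.
Variable del : 'I_3 -> A -> A.
Hypothesis del_fun : forall j a, qhm_fun (del j a) = qhm_delta c alpha j (qhm_fun a).
Hypothesis alpha_neq0 : alpha != 0.

Local Notation fn := (@qhm_fun R c hbar mu nu A).
Let fl := @qhm_fun_linear R c hbar mu nu A.

Let dx_linear k a b x y p :
  ddx (fn (k *: a + b)) x y p = k * ddx (fn a) x y p + ddx (fn b) x y p.
Proof.
apply: is_cderiveE; rewrite (_ : (fun t => _) = (fun t => k * fn a t y p + fn b t y p)).
  by apply: is_cderiveD; [apply: is_cderiveZ|]; exact: fn_dx.
by apply/funext => t; rewrite fn_linear.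
Qed.

Let dy_linear k a b x y p :
  ddy (fn (k *: a + b)) x y p = k * ddy (fn a) x y p + ddy (fn b) x y p.
Proof.
apply: is_cderiveE; rewrite (_ : (fun t => _) = (fun t => k * fn a x t p + fn b x t p)).
  by apply: is_cderiveD; [apply: is_cderiveZ|]; exact: fn_dy.
by apply/funext => t; rewrite fn_linear.
Qed.

Lemma qhm_del_linear j : linear (del j).
Proof.
move=> k a b; apply: qhm_fun_ext => x y p; rewrite fn_linear !del_fun.
case: j => [[|[|[|//]]] hj]; rewrite /qhm_delta /=.
- by rewrite dx_linear; ring.
- by rewrite dy_linear fn_linear; ring.
- by rewrite fn_linear; ring.
Qed.

Let smooth_dx a x y p :
  is_cderive (fun t => ddx (fn a) x t p) y (ddy (ddx (fn a)) x y p).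
Proof.
have [sm _ _ _] := qhm_Sc a.
by apply: cderivableP; case: (sm [:: true] p) => [_ h _ _]; exact: h.
Qed.

Let smooth_dy a x y p :
  is_cderive (fun t => ddy (fn a) t y p) x (ddx (ddy (fn a)) x y p).
Proof.
have [sm _ _ _] := qhm_Sc a.
by apply: cderivableP; case: (sm [:: false] p) => [h _ _ _]; exact: h.
Qed.

Lemma qhm_mixed a x y p : ddx (ddy (fn a)) x y p = ddy (ddx (fn a)) x y p.
Proof.
have [sm _ _ _] := qhm_Sc a.
have [_ _ rxy ixy] := sm [:: true; false] p.
have [_ _ ryx iyx] := sm [:: false; true] p.
apply/eqP; rewrite eq_complex; apply/andP; split; apply/eqP.
- exact: (@mixed_derivatives R (fun s t => complex.Re (fn a s t p))
    (fun s t => complex.Re (ddx (fn a) s t p)) (fun s t => complex.Re (ddy (fn a) s t p))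
    (fun s t => complex.Re (ddx (ddy (fn a)) s t p))
    (fun s t => complex.Re (ddy (ddx (fn a)) s t p)) x y
    (fun s t => (fn_dx a s t p).1) (fun s t => (fn_dy a s t p).1)
    (fun s t => (smooth_dy a s t p).1) (fun s t => (smooth_dx a s t p).1)
    rxy ryx).
- exact: (@mixed_derivatives R (fun s t => complex.Im (fn a s t p))
    (fun s t => complex.Im (ddx (fn a) s t p)) (fun s t => complex.Im (ddy (fn a) s t p))
    (fun s t => complex.Im (ddx (ddy (fn a)) s t p))
    (fun s t => complex.Im (ddy (ddx (fn a)) s t p)) x y
    (fun s t => (fn_dx a s t p).2) (fun s t => (fn_dy a s t p).2)
    (fun s t => (smooth_dy a s t p).2) (fun s t => (smooth_dx a s t p).2)
    ixy iyx).
Qed.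

Let ord3 (j : 'I_3) : [\/ j = 0, j = 1 | j = 2%:R].
Proof.
by case: j => [[|[|[|//]]] hj]; [constructor 1|constructor 2|constructor 3];
  apply: val_inj.
Qed.

Let d0 a x y p : fn (del 0 a) x y p = - ddx (fn a) x y p.
Proof. by rewrite del_fun. Qed.
Let d1 a x y p : fn (del 1 a) x y p =
  (2 * pi * c%:R * p%:~R * x)%:C%C * 'i%C * fn a x y p - ddy (fn a) x y p.
Proof. by rewrite del_fun. Qed.
Let d2 a x y p : fn (del 2%:R a) x y p =
  (2 * pi * p%:~R * c%:R * alpha)%:C%C * 'i%C * fn a x y p.
Proof. by rewrite del_fun. Qed.

Let d01 a x y p : fn (del 0 (del 1 a)) x y p =
  - ((2 * pi * c%:R * p%:~R)%:C%C * 'i%C * fn a x y p +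
     (2 * pi * c%:R * p%:~R * x)%:C%C * 'i%C * ddx (fn a) x y p) +
  ddx (ddy (fn a)) x y p.
Proof.
rewrite d0; set k := 2 * pi * c%:R * p%:~R.
rewrite (_ : ddx _ x y p = (k%:C%C * 'i%C * fn a x y p +
    (k * x)%:C%C * 'i%C * ddx (fn a) x y p) - ddx (ddy (fn a)) x y p).
  by rewrite opprB addrC.
apply: is_cderiveE.
rewrite (_ : (fun t => _) = (fun t => (k * t)%:C%C * 'i%C * fn a t y p +
    - ddy (fn a) t y p)); last by apply/funext => t; rewrite d1.
apply: is_cderiveD; last exact/is_cderiveN/smooth_dy.
have lin : is_cderive (fun t => (k * t)%:C%C * 'i%C) x (k%:C%C * 'i%C).
  have did : is_derive x 1 (fun t : R => k * t) k.
    rewrite (_ : (fun t => _) = k \*: id)//.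
    by apply: is_derive_eq; rewrite -[_ *: _]/(_ * _) mulr1.
  split.
  - rewrite (_ : (fun t => _) = cst 0); last first.
      by apply/funext => t; rewrite ReM /= mulr0 mul0r subrr.
    by rewrite ReM /= mulr0 mul0r subrr; exact: is_derive_cst.
  - rewrite (_ : (fun t => _) = (fun t : R => k * t)); last first.
      by apply/funext => t; rewrite ImM /= mulr1 mul0r addr0.
    by rewrite ImM /= mulr1 mul0r addr0.
exact: is_cderive_eq (is_cderiveM lin (fn_dx a x y p)) _.
Qed.

Let d10 a x y p : fn (del 1 (del 0 a)) x y p =
  - ((2 * pi * c%:R * p%:~R * x)%:C%C * 'i%C * ddx (fn a) x y p) +
  ddy (ddx (fn a)) x y p.
Proof.
rewrite d1 d0 mulrN; congr (_ + _).
rewrite (_ : ddy _ x y p = - ddy (ddx (fn a)) x y p) ?opprK//.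
apply: is_cderiveE; rewrite (_ : (fun t => _) = (fun t => - ddx (fn a) x t p)).
  exact/is_cderiveN/smooth_dx.
by apply/funext => t; rewrite d0.
Qed.

Let d02 a : del 0 (del 2%:R a) = del 2%:R (del 0 a).
Proof.
apply: qhm_fun_ext => x y p; rewrite d2 !d0 mulrN; congr (- _).
apply: is_cderiveE; rewrite (_ : (fun t => _) =
  (fun t => (2 * pi * p%:~R * c%:R * alpha)%:C%C * 'i%C * fn a t y p)).
  by apply: is_cderiveZ; exact: fn_dx.
by apply/funext => t; rewrite d2.
Qed.

Let d12 a : del 1 (del 2%:R a) = del 2%:R (del 1 a).
Proof.
apply: qhm_fun_ext => x y p; rewrite d2 !d1 d2 mulrBr mulrCA; congr (_ - _).
apply: is_cderiveE; rewrite (_ : (fun t => _) =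
  (fun t => (2 * pi * p%:~R * c%:R * alpha)%:C%C * 'i%C * fn a x t p)).
  by apply: is_cderiveZ; exact: fn_dy.
by apply/funext => t; rewrite d2.
Qed.

Let bracket01 a : del 0 (del 1 a) = - (alpha^-1)%:C%C *: del 2%:R a + del 1 (del 0 a).
Proof.
apply: qhm_fun_ext => x y p; rewrite fn_linear d01 d10 d2 qhm_mixed.
have -> : (2 * pi * p%:~R * c%:R * alpha)%:C%C =
    (alpha)%:C%C * (2 * pi * c%:R * p%:~R)%:C%C :> R[i].
  by rewrite -rmorphM; congr (_%:C)%C; ring.
have aK : (alpha^-1)%:C%C * alpha%:C%C = 1 :> R[i].
  by rewrite -rmorphM mulVf// rmorph1.
rewrite mulNr !mulrA aK mul1r; ring.
Qed.

(* For e(r) = 1 these functions belong to S^c, and the ones with r = 1 and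
   r = -1 are mutually inverse eigenvectors of the derivations. *)
Let circle (k : R[i]) (r : R) : R -> R -> int -> R[i] :=
  fun x y p => k * expi (r * y) * (p == 0)%:R.

Let circle_dx k r : ddx (circle k r) = circle 0 r.
Proof.
apply/funext => x; apply/funext => y; apply/funext => p; rewrite /circle !mul0r.
by apply: is_cderiveE; exact: is_cderive_cst.
Qed.

Let circle_dy k r : ddy (circle k r) = circle (k * ((2 * pi * r)%:C%C * 'i%C)) r.
Proof.
apply/funext => x; apply/funext => y; apply/funext => p; apply: is_cderiveE.
have := is_cderiveM (is_cderiveZ k (is_cderive_expi r y))
  (is_cderive_cst (p == 0)%:R y).
by move/is_cderive_eq; apply; rewrite mulr0 addr0 mulrA.
Qed.

Let circle_cderive (k : R[i]) (r y : R) (p : int) : is_cderive (fun t => k * expi (r * t) * (p == 0)%:R) y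
  (k * ((2 * pi * r)%:C%C * 'i%C * expi (r * y)) * (p == 0)%:R).
Proof.
have := is_cderiveM (is_cderiveZ k (is_cderive_expi r y))
  (is_cderive_cst (p == 0)%:R y).
by move/is_cderive_eq; apply; rewrite mulr0 addr0.
Qed.

Let is_cderive_cderivable (f : R -> R[i]) x l : is_cderive f x l -> cderivable f x.
Proof. by move=> [[dr _] [di _]]; split; [exact: dr|exact: di]. Qed.

Let circle_Sc r : expi r = 1 -> Sc c (circle 1 r).
Proof.
move=> er.
have iterE w : exists k, foldr (fun b => if b then @ddx R else @ddy R) (circle 1 r) w =
    circle k r.
  elim: w => [|b w [k /= ->]]; first by exists 1.
  by case: b; rewrite ?circle_dx ?circle_dy; eexists.
have cont k (p : int) (P : R[i] -> R) :
    (forall y : R, exists l, is_derive y 1 (fun t => P (k * expi (r * t) * (p == 0)%:R)) l) ->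
    continuous (fun z : R * R => P (circle k r z.1 z.2 p)).
  move=> dP z.
  apply: (@continuous_comp _ _ _ snd
    (fun t => P (k * expi (r * t) * (p == 0)%:R)) z); first exact: cvg_snd.
  have [l [dl _]] := dP z.2.
  exact/differentiable_continuous/derivable1_diffP.
split.
- move=> w p; have [k ->] := iterE w; split.
  + move=> x y; exact: is_cderive_cderivable (is_cderive_cst _ x).
  + move=> x y; exact: is_cderive_cderivable (circle_cderive k r y p).
  + apply: (cont k p (@complex.Re R)) => y; eexists.
    exact: (circle_cderive k r y p).1.
  + apply: (cont k p (@complex.Im R)) => y; eexists.
    exact: (circle_cderive k r y p).2.
- by move=> x y p; rewrite /circle mulrDr mulr1 expiD er mulr1.
- move=> k x y p; rewrite /circle; case: eqVneq => [->|_]; last by rewrite !mulr0.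
  by rewrite mulr0z mulr0 mul0r expi0 !mul1r.
- move=> P m n K _.
  have [k kE] : exists k, iter m (@ddx R) (iter n (@ddy R) (circle 1 r)) = circle k r.
    have [k ->] : exists k, iter n (@ddy R) (circle 1 r) = circle k r.
      elim: n => [|n [k /= ->]]; first by exists 1.
      by rewrite circle_dy; eexists.
    elim: m => [|m [k' /= ->]]; first by exists k.
    by rewrite circle_dx; eexists.
  exists (cnorm (P.[0] * k)) => x y p _; rewrite kE /circle.
  case: eqVneq => [->|_]; last by rewrite !mulr0 normr0 lecR cnorm_ge0.
  by rewrite mulr1 mulrA normrM norm_expi mulr1 -cnormE.
Qed.

Lemma qhm_lie_derivations : lie_derivations del.
Proof.
split.
- exact: qhm_del_linear.
- exact: (qhm_leibniz del_fun).
(* The only nonzero bracket is [del_0, del_1] = - alpha^-1 del_2. *)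
- exists (fun j k l => if l == 2%:R then
      if (j == 0) && (k == 1) then - (alpha^-1)%:C%C
      else if (j == 1) && (k == 0) then (alpha^-1)%:C%C else 0 else 0) => j k a.
  rewrite (bigD1 2%:R)//= big1 ?addr0 => [|l /negPf ->]; last by rewrite scale0r.
  case: (ord3 j) => ->; case: (ord3 k) => -> /=; rewrite ?subrr ?scale0r//.
  + by rewrite bracket01 addrK.
  + by rewrite d02 subrr.
  + by rewrite bracket01 opprD addrCA subrr addr0 scaleNr opprK.
  + by rewrite d12 subrr.
  + by rewrite d02 subrr.
  + by rewrite d12 subrr.
- have [u uE] := (qhm_fun_range A _).1 (circle_Sc (expi1 R)).
  have [v vE] := (qhm_fun_range A _).1 (circle_Sc (expiN1 R)).
  have prod1 (a b : A) r s : fn a = circle 1 r -> fn b = circle 1 s -> r + s = 0 ->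
      amul a b = aone.
    move=> aE bE rs; apply: qhm_fun_ext => x y p.
    rewrite (has_sum_single (i0 := 0%R) _ (qhm_funM a b x y p)) => [|q q0]; last first.
      by rewrite aE /circle (negPf q0) mulr0 mul0r.
    rewrite aE bE qhm_fun1 /circle eqxx subr0 mulr1 !mul1r mulrA.
    have [->|_] := eqVneq p 0; last by rewrite !mulr0.
    by rewrite !subr0 mulr0 mul0r subr0 -expiD -mulrDl rs mul0r expi0 mulr1.
  have eig (a : A) r j : fn a = circle 1 r ->
      del j a = (if j == 1 then - ((2 * pi * r)%:C%C * 'i%C) else 0) *: a.
    move=> aE; apply: qhm_fun_ext => x y p.
    rewrite (linZ fl) -[RHS]/(_ * fn a x y p).
    case: (ord3 j) => ->; rewrite /= ?(d0, d1, d2) aE ?circle_dx ?circle_dy /circle.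
    + by rewrite !mul0r oppr0.
    + have [->|_] := eqVneq p 0; last by rewrite !mulr0 subr0.
      by rewrite !(mulr0, mul0r) sub0r; ring.
    + have [->|_] := eqVneq p 0; last by rewrite !mulr0.
      by rewrite !(mulr0, mul0r).
  exists 1, u, v, (- ((2 * pi)%:C%C * 'i%C)); split.
  + rewrite oppr_eq0 mulf_neq0//; last by rewrite eq_complex /= oner_eq0 andbF.
    by rewrite eq_complex /= eqxx andbT mulf_neq0// gt_eqF// pi_gt0.
  + by apply: (prod1 _ _ _ _ uE vE); rewrite subrr.
  + by apply: (prod1 _ _ _ _ vE uE); rewrite addNr.
  + by move=> j; rewrite (eig u 1 j uE) mulr1.
  + move=> j; rewrite (eig v (-1) j vE) mulrN1 rmorphN mulNr; congr (_ *: _).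
    by case: ifP => _; rewrite ?oppr0.
Qed.

End QuantumHeisenbergLie.

(** * Two-forms on the product of a torus and a Heisenberg manifold *)

Theorem proposition7p1 (R : realType)
    (n : nat) (n_gt0 : (0 < n)%N)
    (Theta : 'M[R]_n) (Theta_skew : Theta^T = - Theta)
    (c : nat) (c_gt0 : (0 < c)%N) (hbar mu nu alpha : R)
    (munu_neq0 : mu ^+ 2 + nu ^+ 2 != 0) (alpha_gt1 : 1 < alpha)
    (indep : forall p q r : rat,
      ratr p + ratr q * (hbar * mu) + ratr r * (hbar * nu) = 0 :> R ->
      [/\ p = 0, q = 0 & r = 0])
    (A1 : nctorus Theta) (T1 : spectral_triple A1)
    (gamma : bop (st_hilb T1)) (HT1 : is_nct_triple T1 gamma)
    (A2 : qheisenberg c hbar mu nu) (T2 : spectral_triple A2)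
    (HT2 : is_qhm_triple alpha T2)
    (T : spectral_triple (talg A1 A2)) (HT : is_product_triple T1 gamma T2 T) :
  bimodule_iso (Omega2_D T)
    (sbimod (sbimod (tbimod (Omega2_D T1) (rbimod A2))
                    (tbimod (rbimod A1) (Omega2_D T2)))
            (tbimod (Omega1_D T1) (Omega1_D T2))).
Proof.
have [m [del1 [M1 [ket1 [Gamma [e [ders ct1 gket [e0 Gsq] Ganti]]]]]]] :=
  nct_clifford_triple n_gt0 HT1.
have dd1 := nct_lie_derivations n_gt0 ders.
have [del2 [ket2 [del2_fun gns2]]] := HT2.
have alpha0 : alpha != 0 by rewrite gt_eqF// (lt_trans ltr01).
have dd2 := qhm_lie_derivations del2_fun alpha0.
have ct2 := gns_clifford_triple (isT : (0 < 2)%N) (qhm_anticommuting R) gns2.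
have [t [tb tdot tdense trep tD]] := HT.
have ct := prod_clifford_triple ct1 ct2 dd1 dd2 gket e0 Gsq Ganti
  tb tdot tdense trep tD.
have [f1 f1c] := Omega1_coefficients dd1 ct1.
have [f2 f2c] := Omega1_coefficients dd2 ct2.
have [h1 h1c] := Omega2_coefficients dd1 ct1.
have [h2 h2c] := Omega2_coefficients dd2 ct2.
have [h hc] := Omega2_coefficients (prod_lie_derivations dd1 dd2) ct.
apply: (two_forms_of_product dd1 dd2 _ _ f1c f2c h1c h2c hc
  (phi := fun r a => nct_coef a r)).
- exact: nct_coef_functional.
- move=> a a0; apply: nct_coef_ext => r.
  by rewrite a0 (lin0 (@nct_coef_linear R n Theta A1)).
Qed.
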